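(* Let $K$ be a polygon satisfying the mesh assumptions, with triangulation $\mathcal T_K$, let $k\ge1$, let $V_k^{\mathrm c}(K)$ be the enhanced conforming virtual element space, and let $\widetilde I_k^K:V_k^{\mathrm c}(K)\to\widetilde V_k(\mathcal T_K)$ be the interpolation operator, all as defined in the context. Then for any $v_h\in V_k^{\mathrm c}(K)$, $$(\nabla\widetilde I_k^Kv_h,\nabla w_h)_K=(\nabla v_h,\nabla w_h)_K\qquad\forall w_h\in V_k^{\mathrm c}(K).$$
   Context: Notation: $(\cdot,\cdot)_S$ is the $L^2(S)$ inner product. $\mathbb P_m(S)$ is the space of polynomials of degree $\le m$ on $S$ ($\{0\}$ if $m<0$); $\overline{\mathbb P}_m(S)$ is the subspace of homogeneous polynomials of degree $m$ in $\bm x-\bm x_S$ ($\{0\}$ if $m<0$), with $\bm x_S$ the barycenter of $S$. $\mathbb M_m(S)=\{((\bm x-\bm x_S)/h_S)^{\bm\beta}:|\bm\beta|\le m\}$ is the scaled monomial basis of $\mathbb P_m(S)$ ($h_S$ the diameter; empty if $m<0$). Mesh assumptions: $K\subset\mathbb R^2$ is a polygon of diameter $h_K$, star-shaped with respect to a disc of radius $\ge\rho h_K$, all of whose edges have length $\ge\rho h_K$ ($\rho>0$ fixed). $\mathcal T_K$ is a conforming shape-regular triangulation of $K$ whose triangles have diameters comparable to $h_K$ and such that the edges of $K$ are not subdivided. $\mathcal V(K),\mathcal E(K)$ are the vertices and edges of $K$; $\mathcal V^{\mathrm{int}}(\mathcal T_K)$, $\mathcal E^{\mathrm{int}}(\mathcal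 T_K)$ are the vertices and edges of $\mathcal T_K$ in the interior of $K$; $\mathcal E^\partial(\mathcal T_K)=\mathcal E(K)$ are the boundary edges. Projections: $Q_k^K$ is the $L^2(K)$ projection onto $\mathbb P_k(K)$. For $v\in H^1(K)$, $\Pi_k^Kv\in\mathbb P_k(K)$ is defined by $(\nabla\Pi_k^Kv,\nabla q)_K=(\nabla v,\nabla q)_K$ for all $q\in\mathbb P_k(K)$ and $\int_{\partial K}\Pi_k^Kv\,\mathrm ds=\int_{\partial K}v\,\mathrm ds$. Virtual element space: with $\mathbb B_k(\partial K)=\{v\in C^0(\partial K):v|_e\in\mathbb P_k(e)\ \forall e\in\mathcal E(K)\}$, $$V_k^{\mathrm c}(K)=\{v\in H^1(K):\Delta v\in\mathbb P_k(K),\ v|_{\partial K}\in\mathbb B_k(\partial K),\ (v,q)_K=(\Pi_k^Kv,q)_K\ \forall q\in\overline{\mathbb P}_k(K)\oplus\overline{\mathbb P}_{k-1}(K)\}.$$ Macro finite element space: for a triangle $T$ with cubic bubble $b_T$ (product of the three barycentric coordinates), $\widetilde V_k(T)=\mathbb P_k(T)\oplus b_T\overline{\mathbb P}_{k-2}(T)\oplus b_T\overline{\mathbb P}_{k-1}(T)\oplus b_T\overline{\mathbb P}_k(T)$, with unisolvent degrees of freedom: values at the vertices of $T$, moments $\frac1{|e|}(v,q)_e$, $q\in\mathbb M_{k-2}(e)$, on the edges $e$ of $T$, and moments $\frac1{|T|}(v,q)_T$, $q\in\mathbb M_k(T)$. $\widetilde V_k(\mathcal T_K)=\{v\in C^0(K):v|_T\in\widetilde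 V_k(T)\ \forall T\in\mathcal T_K\}$. Interpolation: for $v_h\in V_k^{\mathrm c}(K)$, $\widetilde I_k^Kv_h\in\widetilde V_k(\mathcal T_K)$ is determined by - $\widetilde I_k^Kv_h(\delta)=v_h(\delta)$, $\delta\in\mathcal V(K)$; - $\widetilde I_k^Kv_h(\delta)=\Pi_k^Kv_h(\delta)$, $\delta\in\mathcal V^{\mathrm{int}}(\mathcal T_K)$; - $(\widetilde I_k^Kv_h-v_h,q)_e=0$, $q\in\mathbb M_{k-2}(e)$, $e\in\mathcal E^\partial(\mathcal T_K)$; - $(\widetilde I_k^Kv_h-\Pi_k^Kv_h,q)_e=0$, $q\in\mathbb M_{k-2}(e)$, $e\in\mathcal E^{\mathrm{int}}(\mathcal T_K)$; - $(\widetilde I_k^Kv_h-Q_k^Kv_h,q)_T=0$, $q\in\mathbb M_k(T)$, $T\in\mathcal T_K$. *)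

(* Defs.v *)
From HB Require Import structures.
From mathcomp Require Import all_boot all_order all_algebra.
From mathcomp Require Import all_classical all_reals all_analysis.
Set Implicit Arguments.
Unset Strict Implicit.
Unset Printing Implicit Defensive.
Import Order.TTheory GRing.Theory Num.Theory.
Import numFieldNormedType.Exports.
Local Open Scope classical_set_scope.
Local Open Scope ring_scope.

(* Points of the plane are pairs [R * R].  A function on a set S is a total
   function [R * R -> R] of which only the values on S (or, for the L^2 and
   Sobolev notions, the a.e. class on S) matter. *)

Section Plane.
Context {R : realType}.
Implicit Types (x y : R * R) (S : set (R * R)) (f g u v w : R * R -> R).
Implicit Types (k j n : nat) (m : int).

(* The product norm of [R * R] is the sup norm, hence the explicit Euclidean
   distance. *)
Definition edist x y : R :=
  Num.sqrt ((x.1 - y.1) ^+ 2 + (x.2 - y.2) ^+ 2).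

Definition disc (c : R * R) (r : R) : set (R * R) := [set x | edist c x < r].

Definition diam S : R := sup [set edist z.1 z.2 | z in S `*` S].

Definition leb2 := (@lebesgue_measure R \x @lebesgue_measure R)%E.

Definition barycenter S : R * R :=
  let a := \int[leb2]_(x in S) (cst 1 x) in
  ((\int[leb2]_(x in S) x.1) / a, (\int[leb2]_(x in S) x.2) / a).

Definition inner S f g : R := \int[leb2]_(x in S) (f x * g x).

Definition L2 S f : Prop :=
  @measurable_fun _ _ (measurableTypeR R * measurableTypeR R)%type R S f /\
  leb2.-integrable S (fun x => (f x ^+ 2)%:E).

(* Degrees are integers: negative ones give {0} (and no monomials). *)
Definition Pol m : set (R * R -> R) :=
  [set f | exists c : nat -> nat -> R, forall x,
     f x = \sum_(i < `|m|%N.+1) \sum_(j < `|m|%N.+1 | (i + j)%:Z <= m)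
             c i j * x.1 ^+ i * x.2 ^+ j].

Definition homPol m S : set (R * R -> R) :=
  [set f | exists c : nat -> nat -> R, forall x,
     f x = \sum_(i < `|m|%N.+1) \sum_(j < `|m|%N.+1 | (i + j)%:Z == m)
             c i j * (x.1 - (barycenter S).1) ^+ i
                   * (x.2 - (barycenter S).2) ^+ j].

Definition monomials m S : set (R * R -> R) :=
  [set f | exists i j : nat, (i + j)%:Z <= m /\
     f = fun x => ((x.1 - (barycenter S).1) / diam S) ^+ i
                * ((x.2 - (barycenter S).2) / diam S) ^+ j].

Definition evec (i : 'I_2) : R * R := if i == 0 then (1, 0) else (0, 1).

Definition partial (i : 'I_2) f : R * R -> R := fun x => 'D_(evec i) f x.

Definition smooth f : Prop := forall l : seq 'I_2,
  continuous (foldr partial f l) /\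
  forall (i : 'I_2) x, derivable (foldr partial f l) x (evec i).

Definition test_function S f : Prop :=
  smooth f /\
  exists C : set (R * R), [/\ compact C, C `<=` S & forall x, ~ C x -> f x = 0].

Definition is_wpartial S (i : 'I_2) v g : Prop :=
  L2 S g /\
  forall phi, test_function S phi ->
    inner S v (partial i phi) = - inner S g phi.

Definition H1 S v : Prop :=
  L2 S v /\ forall i : 'I_2, exists g, is_wpartial S i v g.

(* The weak derivative, unique up to a null set, is picked by choice; it is
   meaningful when it exists. *)
Definition wpartial S (i : 'I_2) v : R * R -> R :=
  xget (cst 0) [set g | is_wpartial S i v g].

(* (grad u, grad w)_S *)
Definition grad_inner S u w : R :=
  \sum_(i < 2) inner S (wpartial S i u) (wpartial S i w).

(* Delta v = p on S, in the sense of distributions, for v in H^1(S) *)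
Definition is_laplacian S v p : Prop :=
  forall phi, test_function S phi ->
    \sum_(i < 2) inner S (wpartial S i v) (partial i phi) = - inner S p phi.

(* A segment is represented by the pair of its endpoints. *)
Implicit Types e : (R * R) * (R * R).

Definition param e (t : R) : R * R :=
  ((1 - t) * e.1.1 + t * e.2.1, (1 - t) * e.1.2 + t * e.2.2).

Definition segment e : set (R * R) := param e @` `[0, 1].

Definition open_segment e : set (R * R) := param e @` `]0, 1[.

Definition length e : R := edist e.1 e.2.

Definition reversed e := (e.2, e.1).

Definition edge_int e f : R :=
  length e * \int[lebesgue_measure]_(t in `[0, 1]) f (param e t).

Definition edge_inner e f g : R := edge_int e (fun x => f x * g x).

Definition edge_L2 e f : Prop :=
  @measurable_fun _ _ (measurableTypeR R) R `[0, 1] (f \o param e) /\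
  lebesgue_measure.-integrable `[0, 1] (fun t => (f (param e t) ^+ 2)%:E).

Definition edge_Pol m e : set (R * R -> R) :=
  [set f | exists p : {poly R}, (size p)%:Z <= m + 1 /\
     forall t, t \in `[0, 1] -> f (param e t) = p.[t]].

(* The base of the power is (s - s_e) / h_e, where s is the arclength on e,
   s_e its value at the midpoint of e and h_e the length of e. *)
Definition edge_monomials m e : set (R * R -> R) :=
  [set f | exists j, j%:Z <= m /\
     f = fun x => let c := param e 2^-1 in
       (((x.1 - c.1) * (e.2.1 - e.1.1) + (x.2 - c.2) * (e.2.2 - e.1.2))
          / length e ^+ 2) ^+ j].

(* s is the cyclic sequence of the vertices of a polygon. *)
Implicit Types (s : seq (R * R)) (K : set (R * R)).

Definition edges s : seq ((R * R) * (R * R)) := zip s (rot 1 s).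

Definition closed_curve s : set (R * R) :=
  [set x | exists2 e, e \in edges s & segment e x].

(* K is the open region enclosed by a simple closed polygonal curve.  Flat
   angles at the vertices are allowed. *)
Record polygon s K : Prop := {
  polygon_size : (2 < size s)%N;
  polygon_uniq : uniq s;
  polygon_simple : forall e e' x, e \in edges s -> e' \in edges s -> e != e' ->
    segment e x -> segment e' x ->
    x \in [:: e.1; e.2] /\ x \in [:: e'.1; e'.2];
  polygon_open : open K;
  polygon_connected : connected K;
  polygon_bounded : bounded_set K;
  polygon_boundary : closure K `\` K = closed_curve s }.

Definition star_shaped K (B : set (R * R)) : Prop :=
  forall x y, K x -> B y -> segment (x, y) `<=` K.

Record admissible_polygon (rho : R) s K : Prop := {
  admissible_polygon_polygon : polygon s K;
  admissible_polygon_star :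
    exists c r, rho * diam K <= r /\ star_shaped K (disc c r);
  admissible_polygon_edges :
    forall e, e \in edges s -> rho * diam K <= length e }.

(* g is the trace of v on the boundary of K: the continuous extension to
   H^1(K) of the restriction map smooth f |-> f|_{boundary}, with values in
   L^2 of the boundary, is here given by the closure of its graph. *)
Definition is_trace s K v g : Prop :=
  (forall e, e \in edges s -> edge_L2 e g) /\
  exists phi : nat -> R * R -> R,
  [/\ forall n, smooth (phi n),
      (fun n => inner K (phi n \- v) (phi n \- v)) @ \oo --> (0 : R),
      forall i : 'I_2, (fun n => inner K (partial i (phi n) \- wpartial K i v)
                                  (partial i (phi n) \- wpartial K i v))
                @ \oo --> (0 : R)
    & forall e, e \in edges s ->
        (fun n => edge_inner e (phi n \- g) (phi n \- g)) @ \oo --> (0 : R)].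

Definition boundary_int s f : R := \sum_(e <- edges s) edge_int e f.

Definition boundary_Pol k s : set (R * R -> R) :=
  [set g | {within closed_curve s, continuous g} /\
           forall e, e \in edges s -> edge_Pol k%:Z e g].

Definition is_Q k K v p : Prop :=
  Pol k%:Z p /\ forall q, Pol k%:Z q -> inner K p q = inner K v q.

Definition is_Pi k s K v p : Prop :=
  [/\ Pol k%:Z p,
      forall q, Pol k%:Z q -> grad_inner K p q = grad_inner K v q
    & exists2 g, is_trace s K v g & boundary_int s p = boundary_int s g].

Definition Vc k s K : set (R * R -> R) :=
  [set v | [/\ H1 K v,
      exists2 p, Pol k%:Z p & is_laplacian K v p,
      exists2 g, is_trace s K v g & boundary_Pol k s g
    & exists2 p, is_Pi k s K v p &
        forall q q', homPol k%:Z K q -> homPol (k%:Z - 1) K q' ->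
          inner K v (q \+ q') = inner K p (q \+ q')]].

Definition triangle : Type := ((R * R) * (R * R) * (R * R))%type.
Implicit Types (T : triangle) (TT : seq triangle).

Definition vertices T : seq (R * R) := [:: T.1.1; T.1.2; T.2].

(* twice the signed area of the triangle abc *)
Definition area2 (a b c : R * R) : R :=
  (b.1 - a.1) * (c.2 - a.2) - (b.2 - a.2) * (c.1 - a.1).

Definition nondegenerate T : bool := area2 T.1.1 T.1.2 T.2 != 0.

Definition bary1 T x := area2 x T.1.2 T.2 / area2 T.1.1 T.1.2 T.2.
Definition bary2 T x := area2 T.1.1 x T.2 / area2 T.1.1 T.1.2 T.2.
Definition bary3 T x := area2 T.1.1 T.1.2 x / area2 T.1.1 T.1.2 T.2.

Definition bubble T x : R := bary1 T x * bary2 T x * bary3 T x.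

Definition closed_triangle T : set (R * R) :=
  [set x | [/\ 0 <= bary1 T x, 0 <= bary2 T x & 0 <= bary3 T x]].

Definition is_edge TT e : Prop := exists2 T, T \in TT & e \in edges (vertices T).

Definition conforming T T' : Prop :=
  let I := closed_triangle T `&` closed_triangle T' in
  [\/ I = set0,
      exists a, [/\ a \in vertices T, a \in vertices T' & I = [set a]]
    | exists a b, [/\ a != b, (a \in vertices T) && (b \in vertices T),
        (a \in vertices T') && (b \in vertices T') & I = segment (a, b)]].

(* An edge of TT is oriented by the triangle it is taken from, whence the two
   orientations in the last two fields, which express that the boundary edges
   of TT are the edges of K. *)
Record triangulation s K TT : Prop := {
  triangulation_uniq : uniq TT;
  triangulation_nondegenerate : forall T, T \in TT -> nondegenerate T;
  triangulation_cover :
    closure K = [set x | exists2 T, T \in TT & closed_triangle T x];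
  triangulation_conforming : forall T T', T \in TT -> T' \in TT -> T != T' ->
    conforming T T';
  triangulation_not_subdivided : forall e, e \in edges s ->
    is_edge TT e \/ is_edge TT (reversed e);
  triangulation_boundary : forall e, is_edge TT e ->
    segment e `<=` closed_curve s -> e \in edges s \/ reversed e \in edges s }.

Record admissible_triangulation (sigma : R) s K TT : Prop := {
  admissible_triangulation_triangulation : triangulation s K TT;
  admissible_triangulation_shape : forall T, T \in TT ->
    exists c, disc c (sigma * diam (closed_triangle T)) `<=` closed_triangle T;
  admissible_triangulation_diam : forall T, T \in TT ->
    sigma * diam K <= diam (closed_triangle T) <= sigma^-1 * diam K }.

Definition interior_vertices K TT : set (R * R) :=
  [set x | K x /\ exists2 T, T \in TT & x \in vertices T].

Definition interior_edges K TT : set ((R * R) * (R * R)) :=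
  [set e | is_edge TT e /\ open_segment e `<=` K].

Definition Vt_local k T : set (R * R -> R) :=
  [set f | exists p q2 q1 q0,
    [/\ Pol k%:Z p, homPol (k%:Z - 2) (closed_triangle T) q2,
        homPol (k%:Z - 1) (closed_triangle T) q1,
        homPol k%:Z (closed_triangle T) q0
      & forall x, closed_triangle T x ->
          f x = p x + bubble T x * q2 x + bubble T x * q1 x
                    + bubble T x * q0 x]].

Definition Vt k K TT : set (R * R -> R) :=
  [set f | {within closure K, continuous f} /\
           forall T, T \in TT -> Vt_local k T f].

(* f is the interpolant of v.  The boundary values of v are those of the
   continuous representative g of its trace. *)
Definition is_interpolant k s K TT v f : Prop :=
  Vt k K TT f /\
  exists g pi q,
  [/\ is_trace s K v g /\ boundary_Pol k s g, is_Pi k s K v pi, is_Q k K v q &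
   [/\ forall d, d \in s -> f d = g d,
       forall d, interior_vertices K TT d -> f d = pi d,
       forall e, e \in edges s ->
         forall r, edge_monomials (k%:Z - 2) e r -> edge_inner e (f \- g) r = 0,
       forall e, interior_edges K TT e ->
         forall r, edge_monomials (k%:Z - 2) e r -> edge_inner e (f \- pi) r = 0
     & forall T, T \in TT ->
         forall r, monomials k%:Z (closed_triangle T) r ->
           inner (closed_triangle T) (f \- q) r = 0]].

End Plane.

(* Main.v *)
(* Write u = I v - v.  Testing (grad (I v - v), grad w)_K = -(u, Delta w)_K + boundary terms, the right side
   vanishes: the traces of I v and v on the boundary of K are polynomials of degree k with the same vertex values
   and edge moments, hence coincide, and u is orthogonal to P_k, which contains Delta w, since the moments of I v
   on each triangle are those of Q v.  As Delta w is only known in the sense of distributions, the integration by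
   parts is carried out by mollification: for a polygon star-shaped with respect to a disc of centre c, the kernels
   x |-> kappa(x - (1 - l) c - l y), with l < 1 and small support, are test functions for every y in K, and an x
   derivative of the kernel is a y derivative up to the factor -l.  The distributional equation for w in x and
   Green's formula for u in y (on the triangles for I v, along the smooth approximants of the trace for v) give the
   identity for the mollified functions, and the limit l -> 1 concludes. *)
From HB Require Import structures.
From Pilot Require Import Defs.
From mathcomp Require Import all_boot all_order all_algebra.
From mathcomp Require Import all_classical all_reals all_analysis.
From mathcomp Require Import measurable_realfun ring lra.
Set Implicit Arguments.
Unset Strict Implicit.
Unset Printing Implicit Defensive.
Import Order.TTheory GRing.Theory Num.Theory.
Import numFieldNormedType.Exports.
Local Open Scope classical_set_scope.
Local Open Scope ring_scope.

(** * The plane Lebesgue measure and square integrable functions *)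

(** Three obstacles shape the argument. The weak equation for w admits only smooth, compactly
    supported test functions, and u is neither; averaging towards the centre c, rather than around y
    itself, keeps each kernel inside K even for y close to the boundary. Next, a trace is only a
    limit of restrictions of smooth functions phi_m, so Green's formula is applied to I v - phi_m
    instead of u, as a bound by boundary values weighted by the test function. Those boundary values
    tend to 0 in L^2 of each edge, and in the limit u satisfies the integration by parts exactly,
    against every C^1 function. Last, the averages converge pointwise only where the averaged
    function is continuous. The approximants grad(I v) - grad(phi_m) are continuous off finitely
    many lines, and Schur's test controls the approximation error uniformly in l. The same
    convergence, with the approximants that come with the trace of w, shows that the weak gradient
    of I v picked by choice may be replaced with the piecewise one when it is paired with grad w. *)

Section Leb2.
Context {R : realType}.
Notation mT := (measurableTypeR R * measurableTypeR R)%type.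

(** The plane carries the product of two Borel structures, so measurability of an open set has to go
    through countably many boxes; rational corners provide them. *)
Lemma prod_bigcup_rat (A : set (R * R)) : open A ->
  A = \bigcup_(q : rat * rat * (rat * rat))
    [set z | (z.1 \in `]ratr q.1.1, ratr q.1.2[) /\ (z.2 \in `]ratr q.2.1, ratr q.2.2[) /\
      (forall z' : R * R, z'.1 \in `]ratr q.1.1, ratr q.1.2[ -> z'.2 \in `]ratr q.2.1, ratr q.2.2[ -> A z')].
Proof.
move=> oA; apply/seteqP; split; last first.
  by move=> z [q _ /= [h1 [h2 h3]]]; exact: h3.
move=> z Az.
have /nbhs_ballP [e /= e0 he] : nbhs z A by exact: open_nbhs_nbhs.
have rt (x : R) : exists q : rat * rat, (x - e < ratr q.1 < x) /\ (x < ratr q.2 < x + e).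
  have [|p hp] := @rat_in_itvoo R (x - e) x; first by rewrite ltrBlDr ltrDl.
  have [|q hq] := @rat_in_itvoo R x (x + e); first by rewrite ltrDl.
  by move: hp hq; rewrite !in_itv /= => hp hq; exists (p, q).
have [q1 [/andP[a1 a2] /andP[a3 a4]]] := rt z.1.
have [q2 [/andP[b1 b2] /andP[b3 b4]]] := rt z.2.
exists (q1, q2) => //=; split; first by rewrite in_itv /= a2 a3.
split; first by rewrite in_itv /= b2 b3.
move=> z'; rewrite !in_itv /= => /andP[c1 c2] /andP[d1 d2].
apply: he; split; rewrite /ball /= ltr_norml; apply/andP; split; lra.
Qed.

Lemma open_measurable2 (A : set (R * R)) : open A -> measurable (A : set mT).
Proof.
move=> oA; rewrite (prod_bigcup_rat oA).
apply: countable_bigcupT_measurable; first exact: countableP.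
move=> q.
have [h|h] := pselect (forall z' : R * R, z'.1 \in `]ratr q.1.1, ratr q.1.2[ ->
    z'.2 \in `]ratr q.2.1, ratr q.2.2[ -> A z').
  rewrite (_ : [set z | _] = (`]ratr q.1.1, ratr q.1.2[%classic : set (measurableTypeR R)) `*`
    (`]ratr q.2.1, ratr q.2.2[%classic : set (measurableTypeR R))).
    by apply: measurableX; exact: measurable_itv.
  by apply/seteqP; split => z /= [? h']; split => //; by [case: h'|split].
by rewrite (_ : [set z | _] = set0)//; apply/seteqP; split => z // [_ [_]].
Qed.

Lemma closed_measurable2 (A : set (R * R)) : closed A -> measurable (A : set mT).
Proof. by move=> /closed_openC/open_measurable2/measurableC; rewrite setCK. Qed.

Lemma continuous_measurable2 (D : set mT) (f : R * R -> R) : 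
  measurable D -> continuous f -> measurable_fun D (f : mT -> R).
Proof.
move=> mD /continuousP cf; apply: (measurability _ (RGenOpens.measurableE R)).
move=> _ [_ [a [b ->] <-]]; apply: measurableI => //; apply: open_measurable2.
exact/cf/interval_open.
Qed.

HB.instance Definition _ := Measure.on (@leb2 R).

Lemma leb2_square (a b : R) : (leb2 (`[a, b]%classic `*` `[a, b]%classic : set mT) < +oo)%E.
Proof.
rewrite /leb2 product_measure1E; [|exact: measurable_itv..].
rewrite /= !lebesgue_measure_itv /=; case: ifP => _; last by rewrite mul0e ltry.
by rewrite -EFinD -EFinM ltry.
Qed.

Lemma leb2_sigma_finite : sigma_finite [set: mT] (@leb2 R).
Proof.
exists (fun n => `[- n%:R, n%:R]%classic `*` `[- n%:R, n%:R]%classic).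
  apply/seteqP; split => // z _.
  have [n hn] : exists n : nat, Num.max `|z.1| `|z.2| <= n%:R.
    by exists (Num.bound (Num.max `|z.1| `|z.2|)); apply/ltW/archi_boundP; rewrite le_max normr_ge0.
  exists n => //; move: hn; rewrite ge_max => /andP[h1 h2].
  by split; rewrite /= in_itv /= -ler_norml.
move=> k; split; last exact: leb2_square.
apply: measurableX; exact: measurable_itv.
Qed.

HB.instance Definition _ := Measure_isSigmaFinite.Build _ _ _ (@leb2 R) leb2_sigma_finite.

End Leb2.

Section L2theory.
Context {R : realType}.
Notation mT := (measurableTypeR R * measurableTypeR R)%type.
Implicit Types (S : set (R * R)) (f g h : R * R -> R).

Lemma L2_integrableM S f g : measurable (S : set mT) -> L2 S f -> L2 S g ->
  leb2.-integrable S (EFin \o (f \* g)).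
Proof.
move=> mS [mf If] [mg Ig].
apply: (@le_integrable _ _ _ leb2 S mS _ ((fun x => (f x ^+ 2)%:E) \+ (fun x => (g x ^+ 2)%:E))%E).
- by apply/measurable_EFinP; exact: measurable_funM.
- move=> x _; change ((`|f x * g x|%R%:E <= `|f x ^+ 2 + g x ^+ 2|%R%:E)%E).
  rewrite lee_fin [leRHS]ger0_norm ?addr_ge0 ?sqr_ge0// normrM.
  have := sqr_ge0 (`|f x| - `|g x|); have := sqr_ge0 (`|f x|); have := sqr_ge0 (`|g x|).
  rewrite -(real_normK (num_real (f x))) -(real_normK (num_real (g x))) sqrrB.
  nra.
- exact: integrableD.
Qed.

Lemma bounded_integrable S f M : measurable (S : set mT) -> (leb2 S < +oo)%E ->
  measurable_fun (S : set mT) (f : mT -> R) -> (forall x, S x -> `|f x| <= M) ->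
  leb2.-integrable S (EFin \o f).
Proof.
move=> mS fS mf fM.
apply: (@le_integrable _ _ _ leb2 S mS _ (cst M%:E)).
- exact/measurable_EFinP.
- by move=> x Sx; rewrite /= lee_fin (le_trans (fM _ Sx))// ler_norm.
- apply/integrableP; split => //.
  rewrite integral_cst//= lte_mul_pinfty//.
Qed.

Lemma bounded_L2 S f M : measurable (S : set mT) -> (leb2 S < +oo)%E ->
  measurable_fun (S : set mT) (f : mT -> R) -> (forall x, S x -> `|f x| <= M) ->
  L2 S f.
Proof.
move=> mS fS mf fM; split => //.
apply: (@bounded_integrable S (fun x => f x ^+ 2) (M ^+ 2)) => //.
  exact: measurable_funX.
by move=> x Sx; rewrite normrX ler_sqr ?nnegrE ?(le_trans _ (fM _ Sx))//; exact: fM.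
Qed.

Lemma L2_integrable S f : measurable (S : set mT) -> (leb2 S < +oo)%E -> L2 S f ->
  leb2.-integrable S (EFin \o f).
Proof.
move=> mS fS Lf; have L1 : L2 S (cst 1).
  by apply: (@bounded_L2 _ _ 1) => // *; rewrite normr1.
have := L2_integrableM mS Lf L1; congr (_.-integrable _ _).
by apply/funext => x /=; rewrite mulr1.
Qed.

Lemma L2Z S f (c : R) : measurable (S : set mT) -> L2 S f -> L2 S (fun x => c * f x).
Proof.
move=> mS [mf If]; split; first exact: measurable_funM.
have := integrableZl mS (c ^+ 2) If; congr (_.-integrable _ _).
by apply/funext => x /=; rewrite exprMn.
Qed.

Lemma L2D S f g : measurable (S : set mT) -> L2 S f -> L2 S g -> L2 S (f \+ g).
Proof.
move=> mS Lf Lg; have [mf If] := Lf; have [mg Ig] := Lg; split.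
  exact: measurable_funD.
have I2 := L2_integrableM mS (L2Z 2 mS Lf) Lg.
have := integrableD mS (integrableD mS If I2) Ig; congr (_.-integrable _ _).
by apply/funext => x /=; rewrite -!EFinD; congr EFin; ring.
Qed.

Lemma L2N S f : measurable (S : set mT) -> L2 S f -> L2 S (\- f).
Proof.
move=> mS /(L2Z (-1) mS); congr L2.
by apply/funext => x /=; rewrite mulN1r.
Qed.

Lemma L2B S f g : measurable (S : set mT) -> L2 S f -> L2 S g -> L2 S (f \- g).
Proof. by move=> mS Lf /(L2N mS); exact: L2D. Qed.

Lemma innerC S f g : inner S f g = inner S g f.
Proof. by apply: eq_Rintegral => x _; rewrite mulrC. Qed.

Lemma eq_inner S f f' g g' : {in S, f =1 f'} -> {in S, g =1 g'} ->
  inner S f g = inner S f' g'.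
Proof. by move=> e1 e2; apply: eq_Rintegral => x xS; rewrite e1// e2. Qed.

Lemma innerDr S f g h : measurable (S : set mT) -> L2 S f -> L2 S g -> L2 S h ->
  inner S f (g \+ h) = inner S f g + inner S f h.
Proof.
move=> mS Lf Lg Lh; rewrite /inner -RintegralD//; [|exact: L2_integrableM..].
by apply: eq_Rintegral => x _; rewrite mulrDr.
Qed.

Lemma innerBr S f g h : measurable (S : set mT) -> L2 S f -> L2 S g -> L2 S h ->
  inner S f (g \- h) = inner S f g - inner S f h.
Proof.
move=> mS Lf Lg Lh; rewrite /inner -RintegralB//; [|exact: L2_integrableM..].
by apply: eq_Rintegral => x _; rewrite mulrBr.
Qed.

Lemma innerBl S f g h : measurable (S : set mT) -> L2 S f -> L2 S g -> L2 S h ->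
  inner S (g \- h) f = inner S g f - inner S h f.
Proof. by move=> *; rewrite innerC innerBr// [in RHS]innerC [X in _ - X]innerC. Qed.

Lemma innerZr S f g c : measurable (S : set mT) -> L2 S f -> L2 S g ->
  inner S f (fun x => c * g x) = c * inner S f g.
Proof.
move=> mS Lf Lg; rewrite /inner -RintegralZl//; last exact: L2_integrableM.
by apply: eq_Rintegral => x _; rewrite mulrCA.
Qed.

Lemma inner_ge0 S f : 0 <= inner S f f.
Proof. by apply: Rintegral_ge0 => x _; rewrite -expr2 sqr_ge0. Qed.

Lemma young (a b t : R) : 0 < t -> `|a * b| <= t / 2 * a ^+ 2 + t^-1 / 2 * b ^+ 2.
Proof.
move=> t0; rewrite normrM -(real_normK (num_real a)) -(real_normK (num_real b)).
set x := `|a|; set y := `|b|.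
have : 0 <= t / 2 * (x - t^-1 * y) ^+ 2.
  by rewrite mulr_ge0 ?sqr_ge0// divr_ge0// ltW.
have -> : t / 2 * (x - t^-1 * y) ^+ 2 = t / 2 * x ^+ 2 + t^-1 / 2 * y ^+ 2 - x * y.
  by field; rewrite gt_eqF.
by rewrite subr_ge0.
Qed.

Lemma inner_young S f g (t : R) : measurable (S : set mT) -> L2 S f -> L2 S g -> 0 < t ->
  `|inner S f g| <= t / 2 * inner S f f + t^-1 / 2 * inner S g g.
Proof.
move=> mS Lf Lg t0.
have Iff := L2_integrableM mS Lf Lf.
have Igg := L2_integrableM mS Lg Lg.
apply: (le_trans (le_normr_Rintegral mS (L2_integrableM mS Lf Lg))).
rewrite /inner -!RintegralZl// -RintegralD//; last 2 first.
- exact: (integrableZl mS (t/2) Iff).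
- exact: (integrableZl mS (t^-1/2) Igg).
apply: le_Rintegral => //.
- by apply: (integrable_norm (L2_integrableM mS Lf Lg)).
- apply: (integrableD mS (integrableZl mS (t/2) Iff) (integrableZl mS (t^-1/2) Igg)).
- by move=> x _; rewrite -!expr2; exact: young.
Qed.

(** Plays the part of Cauchy-Schwarz in the limits: the weight [t] first makes the fixed term small,
    then [d] is chosen to absorb the large factor [t^-1]. *)
Lemma young_small (a b eps : R) : 0 <= a -> 0 < eps ->
  exists t d : R, [/\ 0 < t, 0 < d & forall b, b < d -> t / 2 * a + t^-1 / 2 * b < eps].
Proof.
move=> a0 e0; pose t := eps / (a + 1).
have t0 : 0 < t by rewrite divr_gt0// ltr_wpDl.
exists t, (eps * t); split => // [|b' hb]; first exact: mulr_gt0.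
have h1 : t / 2 * a < eps / 2.
  rewrite /t mulrAC ltr_pM2r ?invr_gt0// mulrAC ltr_pdivrMr ?ltr_wpDl//.
  by rewrite ltr_pM2l// ltrDl.
have h2 : t^-1 / 2 * b' < eps / 2.
  by rewrite mulrAC ltr_pM2r ?invr_gt0// mulrC ltr_pdivrMr.
lra.
Qed.

Lemma inner_cvg S g h (hn : nat -> R * R -> R) : measurable (S : set mT) ->
  L2 S g -> L2 S h -> (forall n, L2 S (hn n)) ->
  (fun n => inner S (hn n \- h) (hn n \- h)) @ \oo --> (0 : R) ->
  (fun n => inner S g (hn n)) @ \oo --> inner S g h.
Proof.
move=> mS Lg Lh Lhn c0.
apply/cvgrPdist_lt => e e0.
have [t [d [t0 d0 H]]] := young_small 0 (inner_ge0 S g) e0.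
move/cvgrPdist_lt : c0 => /(_ _ d0); apply: filterS => n.
rewrite sub0r normrN => hd.
rewrite distrC -innerBr//; apply: (le_lt_trans (inner_young mS Lg (L2B mS (Lhn n) Lh) t0)).
by apply: H; exact: le_lt_trans (ler_norm _) hd.
Qed.

End L2theory.

(** * Integration along lines parallel to the axes *)

Section Lines.
Context {R : realType}.
Notation mT := (measurableTypeR R * measurableTypeR R)%type.
Notation leb := (@lebesgue_measure R).

(** The line parallel to [evec i] whose other coordinate is [a], with parameter [t]. Indexing by [i]
    treats both orders of integration at once. *)
Definition pt (i : 'I_2) (a t : R) : R * R := if i == 0 then (t, a) else (a, t).

Lemma measurable_pt i a : measurable_fun [set: measurableTypeR R] (pt i a : measurableTypeR R -> mT).
Proof. by rewrite /pt; case: (i == 0); apply: measurable_fun_pair. Qed.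

Lemma fubini_pt i (h : mT -> \bar R) : measurable_fun setT h -> (forall x, 0 <= h x)%E ->
  (\int[leb2]_x h x = \int[leb]_a \int[leb]_t h (pt i a t))%E.
Proof.
move=> mh h0; rewrite /pt; case: (i == 0).
  exact: (@fubini_tonelli2 _ _ _ _ _ leb leb h mh h0).
exact: (@fubini_tonelli1 _ _ _ _ _ leb leb h mh h0).
Qed.

Lemma integral_pt i (h : mT -> \bar R) : leb2.-integrable setT h ->
  [/\ (\int[leb2]_x h x = \int[leb]_a \int[leb]_t h (pt i a t))%E,
   measurable_fun setT (fun a => \int[leb]_t h (pt i a t))%E &
  {ae leb, forall a, leb.-integrable setT (fun t => h (pt i a t))}].
Proof.
move=> ih; rewrite /pt; case: (i == 0); split.
- by rewrite (@integral21_prod_meas1 _ _ _ _ _ leb leb h ih).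
- exact: (@measurable_fubini_G _ _ _ _ _ leb leb h ih).
- exact: (@ae_integrable2 _ _ _ _ _ leb leb h ih).
- by rewrite -(@integral12_prod_meas1 _ _ _ _ _ leb leb h ih).
- exact: (@measurable_fubini_F _ _ _ _ _ leb leb h ih).
- exact: (@ae_integrable1 _ _ _ _ _ leb leb h ih).
Qed.

(** The bound is required on almost every line only: the lines that contain an edge of the polygon
    will have to be left out. *)
Lemma integral_le_lines i (K : set (R * R)) (g : R * R -> R) (B : R -> \bar R) :
  measurable (K : set mT) -> leb2.-integrable K (EFin \o g) ->
  measurable_fun setT B -> (forall a, 0 <= B a)%E ->
  {ae leb, forall a, leb.-integrable [set t | K (pt i a t)] (fun t => (g (pt i a t))%:E) ->
     (`| \int[leb]_(t in [set t | K (pt i a t)]) (g (pt i a t))%:E | <= B a)%E} ->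
  (`| \int[leb2]_(x in K) (g x)%:E | <= \int[leb]_a B a)%E.
Proof.
move=> mK ig mB B0 H.
have ig' : leb2.-integrable setT ((EFin \o g) \_ K).
  by apply/(integrable_mkcond _ mK).
have [e1 m1 ae1] := integral_pt i ig'.
rewrite integral_mkcond e1.
apply: le_trans (le_abse_integral _ _ _) _ => //.
apply: ae_ge0_le_integral => //.
  exact: measurableT_comp.
have mKa a : measurable ([set t | K (pt i a t)] : set (measurableTypeR R)).
  by rewrite -[X in measurable X]setTI; apply: measurable_pt.
apply: (@filterS2 _ _ (ae_filter_ringOfSetsType leb) _ _ _ _ H ae1) => a Ha ia _.
have e a' t : ((EFin \o g) \_ K) (pt i a' t) =
    ((fun t => (g (pt i a' t))%:E) \_ [set t | K (pt i a' t)]) t.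
  by rewrite !patchE /in_mem /= /in_set /=.
under eq_integral do rewrite e.
rewrite -integral_mkcond; apply: Ha.
apply/(integrable_mkcond _ (mKa a)); move: ia; congr (_.-integrable _ _).
Qed.

Lemma null_line (a b c : R) : (a != 0) || (b != 0) ->
  leb2 ([set x : R * R | a * x.1 + b * x.2 + c = 0] : set mT) = 0.
Proof.
move=> ab; set A := [set _ | _].
have mA : measurable (A : set mT).
  rewrite (_ : A = ~` [set x | a * x.1 + b * x.2 + c != 0]); last first.
    by apply/seteqP; split => x /=; [move=> ->; rewrite eqxx|move/negP; rewrite negbK => /eqP].
  apply: measurableC; apply: open_measurable2.
  rewrite (_ : [set _ | _] = (fun x : R * R => a * x.1 + b * x.2 + c) @^-1` [set y | y != 0])//.
  apply: open_comp; last exact: open_neq.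
  move=> x _; apply: cvgD; last exact: cvg_cst.
  by apply: cvgD; (apply: cvgM; first exact: cvg_cst); [exact: cvg_fst|exact: cvg_snd].
rewrite -[A]setIT -integral_indic//.
(* Slicing along an axis whose coefficient is nonzero, so that each slice meets the line in the
   single point [p]. *)
pose i : 'I_2 := if a != 0 then 0 else 1.
rewrite (fubini_pt i); last 2 first.
- exact/measurable_EFinP.
- by move=> x; rewrite lee_fin.
apply: integral0_eq => y _.
pose p : R := if a != 0 then - (b * y + c) / a else - (a * y + c) / b.
rewrite (_ : (fun t => _) = (fun t => (\1_([set t | A (pt i y t)]) t)%:E)); last first.
  by apply/funext => t; rewrite !indicE /in_mem /= /in_set.
have mAy : measurable ([set t | A (pt i y t)] : set (measurableTypeR R)).
  by rewrite -[X in measurable X]setTI; apply: measurable_pt.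
rewrite integral_indic// setIT.
apply/eqP; rewrite eq_le measure_ge0 andbT.
rewrite -(lebesgue_measure_set1 p) le_measure ?inE//.
move=> t; rewrite /A /pt /i /p /=; case: (boolP (a != 0)) => [a0|a0] /= h.
  by rewrite (_ : - _ = a * t) ?(mulrC a) ?mulfK//; lra.
have b0 : b != 0 by move: ab; rewrite (negbTE a0).
by rewrite (_ : - _ = b * t) ?(mulrC b) ?mulfK//; lra.
Qed.

(** The image of the Lebesgue measure under the affine map, multiplied by [|al|], gives half-open
    intervals their length; uniqueness of the Lebesgue measure identifies the two. *)
Lemma integral_affine (al be : R) (h : R -> \bar R) : al != 0 ->
  measurable_fun [set: measurableTypeR R] (h : measurableTypeR R -> \bar R) -> (forall x, 0 <= h x)%E ->
  (\int[leb]_t h (al * t + be)%R = (`|al|^-1)%:E * \int[leb]_t h t)%E.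
Proof.
move=> al0 mh h0.
have nn : (0 <= `|al|) by [].
pose phi : measurableTypeR R -> measurableTypeR R := fun t => al * t + be.
have mphi : measurable_fun setT phi.
  by apply: measurable_funD => //; exact: measurable_funM.
pose m : {measure set (measurableTypeR R) -> \bar R} := mscale (NngNum nn)
  (measure_function_pushforward__canonical__measure_function_Measure leb mphi).
have E : forall A, measurable A -> leb A = m A.
  apply: lebesgue_measure_unique => _ [[a b] _ <-].
  change (leb `]a, b] = (`|al|)%:E * leb (phi @^-1` `]a, b]))%E.
  have [ap|an|az] := ltgtP 0 al; last by rewrite -az eqxx in al0.
    rewrite (_ : phi @^-1` _ = `](a - be) / al, (b - be)/al]%classic); last first.
      by apply/seteqP; split => t; rewrite /= !in_itv /= ltr_pdivrMr// ler_pdivlMr// ltrBlDr lerBrDr mulrC.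
    rewrite !lebesgue_measure_itv /= !lte_fin ltr_pM2r ?invr_gt0// ltrD2r.
    case: ifP => _; last by rewrite mule0.
    by rewrite -!EFinB -EFinM gtr0_norm//; congr EFin; field; rewrite gt_eqF.
  rewrite (_ : phi @^-1` _ = `[(b - be) / al, (a - be)/al[%classic); last first.
    by apply/seteqP; split => t; rewrite /= !in_itv /= ltr_ndivlMr// ler_ndivrMr// ltrBlDr lerBrDr mulrC andbC.
  rewrite !lebesgue_measure_itv /= !lte_fin ltr_nM2r ?invr_lt0// ltrD2r.
  case: ifP => _; last by rewrite mule0.
  by rewrite -!EFinB -EFinM ltr0_norm//; congr EFin; field; rewrite lt_eqF.
rewrite [in RHS](@eq_measure_integral _ _ _ _ m); last first.
  by move=> A mA _; rewrite -E.
rewrite ge0_integral_mscale//= ge0_integral_pushforward//.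
rewrite muleA -EFinM mulVf ?normr_eq0// mul1e.
by apply: eq_integral.
Qed.

End Lines.

(** * Integral of a derivative over a one-dimensional section *)

Section Section1D.
Context {R : realType}.
Notation leb := (@lebesgue_measure R).

Lemma Rintegral_FTC (a b : R) (H H' : R -> R) : a < b ->
  (forall t : R, is_derive t 1 H (H' t)) -> continuous H' ->
  \int[leb]_(t in `[a, b]) H' t = H b - H a.
Proof.
move=> ab dH cH'; rewrite /Rintegral (@continuous_FTC2 _ H' H)//.
- exact: continuous_subspaceT.
- split.
  + by move=> x _; exact: ex_derive.
  + have : {for a, continuous H} by apply: differentiable_continuous; apply/derivable1_diffP; exact: ex_derive.
    exact: cvg_at_right_filter.
  + have : {for b, continuous H} by apply: differentiable_continuous; apply/derivable1_diffP; exact: ex_derive.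
    exact: cvg_at_left_filter.
- by move=> x _; rewrite derive1E derive_val.
Qed.

Variables (O : set R) (h h' : R -> R) (Q : seq R).
Hypothesis oO : open O.
Hypothesis HQ : forall t, closure O t -> ~ O t -> t \in Q.
Hypothesis Hseg : forall a b, a < b -> (forall q, q \in Q -> ~ (a < q < b)) ->
  (forall t, a < t < b -> O t) ->
  exists H H' : R -> R, [/\ (forall t, a <= t <= b -> h t = H t),
    (forall t : R, is_derive t 1 H (H' t)), continuous H' &
    (forall t, a < t < b -> h' t = H' t)].
Hypothesis ih' : leb.-integrable O (EFin \o h').

Definition bdry q := `[< closure O q /\ ~ O q >].

Lemma open_ball_subset t : O t -> exists e : R, 0 < e /\ forall y, `|y - t| < e -> O y.
Proof.
move=> Ot; have /nbhs_ballP [e /= e0 he] : nbhs t O by exact: open_nbhs_nbhs.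
by exists e; split => // y hy; apply: he; rewrite /ball /= distrC.
Qed.

(** Connectedness: in an interval free of boundary points of [O], the set [O] is both relatively
    open and relatively closed. *)
Lemma breakless_dichotomy a b : a < b -> (forall q, q \in Q -> ~ (a < q < b)) ->
  (exists2 t, a < t < b & O t) -> forall t, a < t < b -> O t.
Proof.
move=> ab hq [t0 h0 Ot0].
have co : connected (`]a, b[%classic : set R).
  by apply/connected_intervalP; exact: interval_is_interval.
have E : `]a, b[%classic `&` O = `]a, b[%classic.
  apply: co.
  - by exists t0; split => //; rewrite /= in_itv.
  - by exists O.
  - exists (closure O); first exact: closed_closure.
    apply/seteqP; split => t [h1 h2]; split => //; first exact: subset_closure.
    apply: contrapT => nOt; move: h1; rewrite /= in_itv /=; apply: hq.
    exact: HQ.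
by move=> t ht; have : `]a, b[%classic t by []; rewrite -E => -[].
Qed.

(** Weight with which the lower end [a] of the next gap enters the telescoping sum: 1 if that gap
    lies in [O], and 0 if not or beyond the last candidate. *)
Definition ind a (l : seq R) : R := if l is b :: _ then (`[< forall t, a < t < b -> O t >])%:R else 0.

Lemma measurableO : measurable (O : set (measurableTypeR R)).
Proof. exact: open_measurable. Qed.

(* Induction along the sorted candidate boundary points [l] of [O]; the term in [h a]
   accounts for a component of [O] that extends on both sides of [a]. *)
Lemma section_ind l a : path <%R a l -> (forall q, q \in Q -> a < q -> q \in l) ->
  (forall t, O t -> t < last a l) ->
  `| \int[leb]_(t in `]a, +oo[) ((h' \_ O) t) + ind a l * h a | <= \sum_(q <- l | bdry q) `|h q|.
Proof.
have ig (A : set R) : measurable (A : set (measurableTypeR R)) -> leb.-integrable A (EFin \o (h' \_ O)).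
  move=> mA; rewrite -restrict_EFin; apply/integrable_restrict => //.
    exact: measurableO.
  by apply: integrableS ih' => //; [exact: measurableO|apply: measurableI => //; exact: measurableO].
elim: l a => [|b l IH] a /=.
  move=> _ _ hO; rewrite mul0r addr0 big_nil.
  rewrite (@eq_Rintegral _ _ _ _ _ (cst 0)); last first.
    move=> t; rewrite inE /= in_itv /= andbT => at'.
    rewrite patchE; case: ifPn => // /set_mem /hO; rewrite ltNge => /negP[].
    exact: ltW.
  by rewrite Rintegral_cst// mul0r normr0.
move=> /andP[ab pl] hQ hO.
have hQ' : forall q, q \in Q -> b < q -> q \in l.
  move=> q qQ bq; have := hQ q qQ (lt_trans ab bq); rewrite inE => /orP[/eqP e|//].
  by rewrite e ltxx in bq.
have {}IH := IH b pl hQ' hO.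
have nb : forall q, q \in Q -> ~ (a < q < b).
  move=> q qQ /andP[aq qb]; have := hQ q qQ aq; rewrite inE => /orP[/eqP e|ql].
    by rewrite e ltxx in qb.
  have /allP/(_ _ ql) := order_path_min lt_trans pl.
  by rewrite ltNge (ltW qb).
have nb2 c l2 : l = c :: l2 -> forall q, q \in Q -> ~ (b < q < c).
  move=> el q qQ /andP[bq qc]; have := hQ' q qQ bq; rewrite el inE => /orP[/eqP e|ql].
    by rewrite e ltxx in qc.
  move: pl; rewrite el /= => /andP[_ /(order_path_min lt_trans)/allP/(_ _ ql)].
  by rewrite ltNge (ltW qc).
have bc c l2 : l = c :: l2 -> b < c by move=> el; move: pl; rewrite el /= => /andP[].
set o := `[< _ >].
(* A gap between candidates lies in [O], where the fundamental theorem applies, or misses it, and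
   the integrand vanishes. *)
have i1 : \int[leb]_(t in `]a, b[) ((h' \_ O) t) = o%:R * (h b - h a).
  rewrite /o; case: asboolP => hab.
    have [H [H' [e1 dH cH' e2]]] := Hseg ab nb hab.
    rewrite (e1 a) ?lexx ?ltW// (e1 b) ?lexx ?ltW// mul1r -(Rintegral_FTC ab dH cH').
    have iH : leb.-integrable `[a, b] (EFin \o H').
      by apply: continuous_compact_integrable; [exact: segment_compact|exact: continuous_subspaceT].
    rewrite -Rintegral_itv_obnd_cbnd; last first.
      by apply: integrableS iH => //; exact: subset_itv_oc_cc.
    rewrite -Rintegral_itv_bndo_bndc; last first.
      by apply: integrableS iH => //; exact: subset_itv_oo_cc.
    apply: eq_Rintegral => t; rewrite inE /= in_itv /= => ht.
    by rewrite patchE mem_set ?e2//; exact: hab.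
  rewrite mul0r (@eq_Rintegral _ _ _ _ _ (cst 0)); last first.
    move=> t; rewrite inE /= in_itv /= => ht.
    rewrite patchE; case: ifPn => // /set_mem Ot; exfalso; apply: hab.
    by apply: breakless_dichotomy => //; exists t.
  by rewrite Rintegral_cst// mul0r.
have -> : \int[leb]_(t in `]a, +oo[) ((h' \_ O) t) =
    o%:R * (h b - h a) + \int[leb]_(t in `]b, +oo[) ((h' \_ O) t).
  rewrite -(@Rintegral_itvB _ _ (BRight a) +oo%O b)//.
  - rewrite -i1 Rintegral_itv_bndo_bndc; first lra.
    exact: ig.
  - exact: ig.
  - by rewrite bnd_simp ltW.
have -> : o%:R * (h b - h a) + \int[leb]_(t in `]b, +oo[) (h' \_ O) t + o%:R * h a =
  (\int[leb]_(t in `]b, +oo[) (h' \_ O) t + ind b l * h b) + (o%:R - ind b l) * h b by lra.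
apply: (le_trans (ler_normD _ _)).
rewrite big_cons.
(* Either [b] is a boundary point and its value is paid for by the sum, or the gaps on its two sides
   are both in [O] or both outside, and [h b] cancels. *)
have step : bdry b \/ o%:R = ind b l.
  rewrite /bdry /o; case: (asboolP (forall t, a < t < b -> O t)) => hab.
    have clb : closure O b.
      move=> B /nbhs_ballP[e /= e0 hB]; pose y := Num.max ((a + b) / 2) (b - e / 2).
      exists y; split.
        by apply: hab; rewrite /y lt_max gt_max; apply/andP; split; [apply/orP; left|apply/andP; split]; lra.
      apply: hB; rewrite /ball /= gtr0_norm ?subr_gt0; last by rewrite /y gt_max; apply/andP; split; lra.
      rewrite ltrBlDr -ltrBlDl /y lt_max; apply/orP; right; lra.
    have [Ob|nOb] := pselect (O b); last by left; apply/asboolP.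
    right; rewrite /ind; case: l pl hO hQ hQ' IH nb2 bc => [|c l] pl hO hQ hQ' IH nb2 bc.
      by have := hO _ Ob; rewrite /= ltxx.
    rewrite asboolT// => t ht; apply: (breakless_dichotomy _ (nb2 c l erefl)) => //.
      exact: (bc c l).
    have [e [e0 he]] := open_ball_subset Ob; have bc' := bc c l erefl.
    exists (Num.min ((b + c) / 2) (b + e / 2)).
      by rewrite gt_min lt_min; apply/andP; split; [apply/andP; split|apply/orP; left]; lra.
    apply: he; rewrite gtr0_norm ?subr_gt0; last by rewrite lt_min; apply/andP; split; lra.
    by rewrite ltrBlDr gt_min; apply/orP; right; lra.
  rewrite /ind; case: l pl hO hQ hQ' IH nb2 bc => [|c l] pl hO hQ hQ' IH nb2 bc; first by right.
  case: (asboolP (forall t, b < t < c -> O t)) => hbc; last by right.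
  left; have bc' := bc c l erefl; apply/asboolP; split.
    move=> B /nbhs_ballP[e /= e0 hB]; pose y := Num.min ((b + c) / 2) (b + e / 2).
    exists y; split.
      by apply: hbc; rewrite /y gt_min lt_min; apply/andP; split; [apply/andP; split|apply/orP; left]; lra.
    apply: hB; rewrite /ball /= ltr0_norm ?subr_lt0; last by rewrite /y lt_min; apply/andP; split; lra.
    by rewrite opprB ltrBlDr /y gt_min; apply/orP; right; lra.
  move=> Ob; apply: hab; apply: breakless_dichotomy => //.
  have [e [e0 he]] := open_ball_subset Ob.
  exists (Num.max ((a + b) / 2) (b - e / 2)).
    by rewrite lt_max gt_max; apply/andP; split; [apply/orP; left|apply/andP; split]; lra.
  apply: he; rewrite ltr0_norm ?subr_lt0; last by rewrite gt_max; apply/andP; split; lra.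
  by rewrite opprB ltrBlDr -ltrBlDl lt_max; apply/orP; right; lra.
case: ifPn => hb.
  rewrite addrC lerD// normrM ler_piMl//.
  have : (0 <= ind b l <= 1) by rewrite /ind; case: (l) => [|? ?]; [|case: asboolP => _]; rewrite lexx ?ler01.
  by case: (o) => /= /andP[? ?]; rewrite ler_norml; apply/andP; split; lra.
case: step => [|->]; first by rewrite (negbTE hb).
by rewrite subrr mul0r normr0 addr0.
Qed.

Lemma section_bound (M : R) : (forall t, O t -> `|t| < M) -> M \in Q ->
  `| \int[leb]_(t in O) h' t | <= \sum_(q <- undup Q | bdry q) `|h q|.
Proof.
move=> hM MQ.
(* Strictly to the left of [O] and of all candidates, so that every candidate is met and no value at
   [a0] remains. On the right, [M \in Q] puts the last candidate beyond [O]. *)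
pose a0 := - `|M| - 1 - \sum_(q <- Q) `|q|.
pose l := sort <=%R (undup Q).
have sl : path <%R a0 l.
  rewrite path_sortedE; last exact: lt_trans.
  rewrite lt_sorted_uniq_le sort_uniq undup_uniq sort_sorted ?andbT; last exact: le_total.
  apply/allP => q; rewrite mem_sort mem_undup => qQ.
  have : `|q| <= \sum_(q <- Q) `|q|.
    by rewrite (big_rem q)//= lerDl sumr_ge0.
  rewrite /a0; have := normr_ge0 M; have := ler_norm (- q); rewrite normrN; lra.
have a0M t : t <= a0 -> ~ O t.
  move=> ta /hM; rewrite ltr_norml => /andP[h1 h2].
  have : 0 <= \sum_(q <- Q) `|q| by rewrite sumr_ge0.
  move: ta; rewrite /a0; have := ler_norm M; lra.
have lastO t : O t -> t < last a0 l.
  move=> /hM /(le_lt_trans (ler_norm _)) tM; apply: (lt_le_trans tM).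
  have : M \in l by rewrite mem_sort mem_undup.
  move: sl; elim: l {a0M} a0 => // b l IH a0 /= /andP[_ pl]; rewrite inE => /orP[/eqP->|]; last exact: IH.
  by move: pl; case: (l) => //= c l2 /andP[bc]; move=> /(order_path_min lt_trans)/allP H;
    have := mem_last c l2; rewrite inE => /orP[/eqP ->|/H /ltW]; [exact: ltW|apply: le_trans; exact: ltW].
have hl q : q \in Q -> a0 < q -> q \in l by move=> qQ _; rewrite mem_sort mem_undup.
have := section_ind sl hl lastO.
have -> : ind a0 l = 0.
  rewrite /ind; case: (l) sl => // b l2 /= /andP[ab _]; case: asboolP => // H.
  have : 0 <= \sum_(q <- Q) `|q| by rewrite sumr_ge0.
  (* If the first gap lay in [O], this point of it would be below [- |M|], outside the bounds of
     [O]. *)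
  move=> s0; have /H /hM : a0 < (a0 + Num.min b (- `|M|)) / 2 < b.
    have : a0 < Num.min b (- `|M|) by rewrite lt_min ab /= /a0; lra.
    have : Num.min b (- `|M|) <= b by rewrite ge_min lexx.
    by move=> h1 h2; apply/andP; split; lra.
  rewrite ltr_norml => /andP[].
  have : Num.min b (- `|M|) <= - `|M| by rewrite ge_min lexx orbT.
  by rewrite /a0; have := ler_norm M; lra.
rewrite mul0r addr0 -Rintegral_mkcondr (_ : `]a0, +oo[%classic `&` O = O); last first.
  apply/seteqP; split => [t []//|t Ot]; split => //.
  by rewrite /= in_itv /= andbT ltNge; apply/negP => /a0M.
by rewrite (perm_big (undup Q))//; apply/permPl; exact: perm_sort.
Qed.

End Section1D.

(** * Continuously differentiable functions *)

Section C1functions.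
Context {R : realType}.
Implicit Types (f g : R * R -> R).

Definition C1 f := continuous f /\ forall i : 'I_2,
  (forall x, derivable f x (evec i)) /\ continuous (partial i f).

Lemma smooth_C1 f : smooth f -> C1 f.
Proof.
move=> sf; have [cf df] := sf [::]; split => // i; split => [x|]; first exact: df.
by have [] := sf [:: i].
Qed.

Lemma C1_cst (c : R) : C1 (fun=> c).
Proof.
split=> [|i]; first exact: cst_continuous.
have e : partial i (fun=> c) = fun=> 0 by apply/funext => x; exact: derive_cst.
by split => [x|]; [exact: derivable_cst|rewrite e; exact: cst_continuous].
Qed.

Lemma partialD i f g : C1 f -> C1 g -> partial i (f \+ g) = partial i f \+ partial i g.
Proof.
by move=> [_ /(_ i)[df _]] [_ /(_ i)[dg _]]; apply/funext => x; exact: deriveD.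
Qed.

Lemma C1D f g : C1 f -> C1 g -> C1 (f \+ g).
Proof.
move=> Cf Cg; have [cf df] := Cf; have [cg dg] := Cg; split => [x|i].
  by apply: continuousD; [exact: cf|exact: cg].
have [df1 cpf] := df i; have [dg1 cpg] := dg i.
split => [x|]; first exact: derivableD.
by rewrite partialD// => x; apply: continuousD; [exact: cpf|exact: cpg].
Qed.

Lemma partialM i f g : C1 f -> C1 g ->
  partial i (f \* g) = (partial i f \* g) \+ (f \* partial i g).
Proof.
move=> [_ /(_ i)[df _]] [_ /(_ i)[dg _]]; apply/funext => x.
rewrite /partial deriveM// /= addrC; congr (_ + _); by rewrite /GRing.scale /= mulrC.
Qed.

Lemma C1M f g : C1 f -> C1 g -> C1 (f \* g).
Proof.
move=> Cf Cg; have [cf df] := Cf; have [cg dg] := Cg; split => [x|i].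
  by apply: continuousM; [exact: cf|exact: cg].
have [df1 cpf] := df i; have [dg1 cpg] := dg i.
split => [x|]; first exact: derivableM.
rewrite partialM// => x; apply: continuousD; apply: continuousM;
  [exact: cpf|exact: cg|exact: cf|exact: cpg].
Qed.

Lemma C1N f : C1 f -> C1 (\- f).
Proof.
move=> Cf; rewrite (_ : (\- f) = (fun=> -1) \* f); first exact: C1M (C1_cst _) Cf.
by apply/funext => x /=; rewrite mulN1r.
Qed.

Lemma C1B f g : C1 f -> C1 g -> C1 (f \- g).
Proof. by move=> Cf Cg; exact: C1D Cf (C1N Cg). Qed.

Lemma partialB i f g : C1 f -> C1 g -> partial i (f \- g) = partial i f \- partial i g.
Proof.
by move=> [_ /(_ i)[df _]] [_ /(_ i)[dg _]]; apply/funext => x; exact: deriveB.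
Qed.

Lemma C1X f n : C1 f -> C1 (fun x => f x ^+ n).
Proof.
move=> Cf; elim: n => [|n IH]; first exact: (C1_cst 1).
rewrite (_ : (fun x => _) = f \* (fun x => f x ^+ n)); first exact: C1M.
by apply/funext => x; rewrite exprS.
Qed.

Lemma C1_sum I (r : seq I) (P : pred I) (F : I -> R * R -> R) :
  (forall i, C1 (F i)) -> C1 (fun x => \sum_(i <- r | P i) F i x).
Proof.
move=> CF; elim: r => [|i r IH].
  rewrite (_ : (fun x => _) = fun=> 0); first exact: C1_cst.
  by apply/funext => x; rewrite big_nil.
rewrite (_ : (fun x => _) = (fun x => (P i)%:R * F i x) \+ (fun x => \sum_(i <- r | P i) F i x)).
  by apply: C1D => //; apply: C1M => //; exact: C1_cst.
by apply/funext => x; rewrite big_cons; case: (P i); rewrite /= ?mul1r ?mul0r ?add0r.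
Qed.

Lemma pt_shift i (a t h : R) : pt i a (h + t) = h *: evec i + pt i a t.
Proof.
have E (u v u' v' : R) : u = u' -> v = v' -> (u, v) = (u', v') by move=> -> ->.
rewrite /pt /evec; case: (i == 0); apply: E.
- by change (h + t = h * 1 + t); rewrite mulr1.
- by change (a = h * 0 + a); rewrite mulr0 add0r.
- by change (a = h * 0 + a); rewrite mulr0 add0r.
- by change (h + t = h * 1 + t); rewrite mulr1.
Qed.

Lemma derive_pt i f a (t : R) : C1 f ->
  is_derive t 1 (fun t => f (pt i a t)) (partial i f (pt i a t)).
Proof.
move=> [_ /(_ i)[df _]].
have e2 : (fun h : R => h^-1 *: (((fun t => f (pt i a t)) \o shift t) (h *: 1) - f (pt i a t))) =
  (fun h : R => h^-1 *: ((f \o shift (pt i a t)) (h *: evec i) - f (pt i a t))).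
  apply/funext => h /=.
  by rewrite (_ : h%:A = h) ?pt_shift// /GRing.scale /= mulr1.
apply: DeriveDef.
  by rewrite /derivable e2; exact: df.
by rewrite /derive /partial /derive e2.
Qed.

Lemma C1_fst : C1 (fst : R * R -> R).
Proof.
have d x (i : 'I_2) : is_derive x (evec i) (fst : R * R -> R) ((evec i : R * R).1).
  apply: DeriveDef.
    apply: (cvgP ((evec i : R * R).1)).
    apply: (@cvg_trans _ (nbhs ((evec i : R * R).1))) => //.
    apply: cvg_near_cst; near=> h; rewrite /= addrK /GRing.scale /= mulKf//.
    by near: h; exact: nbhs_dnbhs_neq.
  apply/cvg_lim => //; apply: cvg_near_cst; near=> h; rewrite /= addrK /GRing.scale /= mulKf//.
  by near: h; exact: nbhs_dnbhs_neq.
split; first by move=> x; exact: cvg_fst.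
move=> i; split => [x|]; first exact: (@ex_derive _ _ _ _ _ _ _ (d x i)).
rewrite (_ : partial i _ = fun=> (evec i : R * R).1); first exact: cst_continuous.
by apply/funext => x; exact: (@derive_val _ _ _ _ _ _ _ (d x i)).
Unshelve. all: by end_near. Qed.

Lemma C1_snd : C1 (snd : R * R -> R).
Proof.
have d x (i : 'I_2) : is_derive x (evec i) (snd : R * R -> R) ((evec i : R * R).2).
  apply: DeriveDef.
    apply: (cvgP ((evec i : R * R).2)).
    apply: cvg_near_cst; near=> h; rewrite /= addrK /GRing.scale /= mulKf//.
    by near: h; exact: nbhs_dnbhs_neq.
  apply/cvg_lim => //; apply: cvg_near_cst; near=> h; rewrite /= addrK /GRing.scale /= mulKf//.
  by near: h; exact: nbhs_dnbhs_neq.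
split; first by move=> x; exact: cvg_snd.
move=> i; split => [x|]; first exact: (@ex_derive _ _ _ _ _ _ _ (d x i)).
rewrite (_ : partial i _ = fun=> (evec i : R * R).2); first exact: cst_continuous.
by apply/funext => x; exact: (@derive_val _ _ _ _ _ _ _ (d x i)).
Unshelve. all: by end_near. Qed.

Lemma C1_Pol m f : Pol m f -> C1 f.
Proof.
move=> [c fE]; have -> : f = (fun x => \sum_(i < `|m|%N.+1) \sum_(j < `|m|%N.+1 | (i + j)%:Z <= m)
             c i j * x.1 ^+ i * x.2 ^+ j) by apply/funext.
apply: C1_sum => i; apply: C1_sum => j.
by apply: C1M; [apply: C1M; [exact: C1_cst|exact: C1X C1_fst]|exact: C1X C1_snd].
Qed.

Lemma C1_homPol m S f : homPol m S f -> C1 f.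
Proof.
move=> [c fE]; have -> : f = (fun x => \sum_(i < `|m|%N.+1) \sum_(j < `|m|%N.+1 | (i + j)%:Z == m)
             c i j * (x.1 - (barycenter S).1) ^+ i
                   * (x.2 - (barycenter S).2) ^+ j) by apply/funext.
apply: C1_sum => i; apply: C1_sum => j.
by apply: C1M; [apply: C1M; [exact: C1_cst|]|]; apply: C1X; apply: C1B; 
  [exact: C1_fst|exact: C1_cst|exact: C1_snd|exact: C1_cst].
Qed.

Lemma C1_affine (a b c : R) : C1 (fun x => a * x.1 + b * x.2 + c).
Proof.
apply: C1D; last exact: C1_cst.
by apply: C1D; apply: C1M; [exact: C1_cst|exact: C1_fst|exact: C1_cst|exact: C1_snd].
Qed.

Definition bary (j : 'I_3) (T : @triangle R) x : R := if j == 0 then bary1 T x else if j == 1 then bary2 T x else bary3 T x.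

Lemma bary_affine j (T : @triangle R) : exists a b c : R,
  [/\ bary j T = (fun x => a * x.1 + b * x.2 + c) & Pilot.Defs.nondegenerate T -> (a != 0) || (b != 0)].
Proof.
case: T => [[[a1 a2] [b1 b2]] [c1 c2]].
pose D := area2 (a1,a2) (b1,b2) (c1,c2).
rewrite /bary /bary1 /bary2 /bary3 /Pilot.Defs.nondegenerate /= -/D.
(* The nonzero number [D] is a combination of the numerators of the two coefficients, which
   therefore do not both vanish. *)
have key (u v w w' : R) (p : R) : (D != 0 -> D = u * w + v * w') ->
   D != 0 -> (u / D != 0) || (v / D != 0).
  move=> h D0; rewrite -negb_and !mulf_eq0 !invr_eq0 (negbTE D0) !orbF.
  by apply/negP => /andP[/eqP u0 /eqP v0]; have := h D0; rewrite u0 v0 !mul0r addr0 => e; move: D0; rewrite e eqxx.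
case: (j == 0); [|case: (j == 1)].
- exists ((b2 - c2) / D), ((c1 - b1) / D), ((b1 * c2 - b2 * c1) / D); split.
    by apply/funext => x; rewrite /area2 /=; ring.
  by apply: (key _ _ (a1 - c1) (a2 - c2) 0) => _; rewrite /D /area2 /=; ring.
- exists ((c2 - a2) / D), ((a1 - c1) / D), ((c1 * a2 - c2 * a1) / D); split.
    by apply/funext => x; rewrite /area2 /=; ring.
  by apply: (key _ _ (b1 - a1) (b2 - a2) 0) => _; rewrite /D /area2 /=; ring.
- exists ((a2 - b2) / D), ((b1 - a1) / D), ((a1 * b2 - a2 * b1) / D); split.
    by apply/funext => x; rewrite /area2 /=; ring.
  by apply: (key _ _ (c1 - a1) (c2 - a2) 0) => _; rewrite /D /area2 /=; ring.
Qed.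

Lemma closed_triangleP (T : @triangle R) x : closed_triangle T x <-> forall j, 0 <= bary j T x.
Proof.
split=> [[h1 h2 h3] j|h]; first by rewrite /bary; case: (j == 0); [|case: (j == 1)].
by split; [have := h 0|have := h 1|have := h 2%:R].
Qed.

Lemma C1_bary j (T : @triangle R) : C1 (bary j T).
Proof. by have [a [b [c [-> _]]]] := bary_affine j T; exact: C1_affine. Qed.

Lemma C1_bubble (T : @triangle R) : C1 (bubble T).
Proof.
exact: (C1M (C1M (C1_bary 0 T) (C1_bary 1 T)) (C1_bary 2%:R T)).
Qed.

Lemma closed_closed_triangle (T : @triangle R) : closed (closed_triangle T).
Proof.
rewrite (_ : closed_triangle T = \bigcap_(j : 'I_3) [set x | 0 <= bary j T x]); last first.
  by apply/seteqP; split => x; [move/closed_triangleP => h j _; exact: h|move=> h; apply/closed_triangleP => j; exact: h].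
apply: closed_bigI => j _.
rewrite (_ : [set _ | _] = bary j T @^-1` [set y | 0 <= y])//.
apply: preimage_closed; last exact: closed_ge.
by move=> x; have [+ _] := C1_bary j T; exact.
Qed.

End C1functions.

(** * Piecewise functions on a triangulation *)

Section Square.
Context {R : realType}.

Lemma continuous_bounded_square (f : R * R -> R) (M : R) : continuous f ->
  exists C : R, forall x, `|x.1| <= M -> `|x.2| <= M -> `|f x| <= C.
Proof.
move=> cf; pose Sq : set (R * R) := `[- M, M]%classic `*` `[- M, M]%classic.
have cS : compact Sq by apply: compact_setX; exact: segment_compact.
have : compact (f @` Sq) by apply: continuous_compact => //; exact: continuous_subspaceT.
move/compact_bounded => [C [_ hC]]; exists (C + 1) => x h1 h2.
apply: hC; first by rewrite ltrDl.
by exists x => //; split; rewrite /= in_itv /= -ler_norml.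
Qed.

End Square.

Section Piecewise.
Context {R : realType}.
Notation mT := (measurableTypeR R * measurableTypeR R)%type.
Implicit Types (TT : seq (@triangle R)) (G : @triangle R -> R * R -> R).

(* The first triangle of [TT] containing [x]; a junk triangle when there is none. *)
Definition selT TT (x : R * R) : @triangle R :=
  nth ((0, 0), (0, 0), (0, 0)) TT (find (fun T => `[< closed_triangle T x >]) TT).

(** Piecewise derivatives jump across edges; making [pw] total and letting the order of [TT] settle
    the ties changes them on a null set only. *)
Definition pw TT G (x : R * R) := G (selT TT x) x.

Lemma selT_in TT x : (exists2 T, T \in TT & closed_triangle T x) ->
  selT TT x \in TT /\ closed_triangle (selT TT x) x.
Proof.
move=> [T TTT Tx].
have h : has (fun T => `[< closed_triangle T x >]) TT.
  by apply/hasP; exists T => //; apply/asboolP.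
split; first by rewrite /selT mem_nth// -has_find.
by apply/asboolP; exact: (nth_find _ h).
Qed.

Lemma selT_cons T TT x : selT (T :: TT) x = if `[< closed_triangle T x >] then T else selT TT x.
Proof. by rewrite /selT /=; case: ifP. Qed.

Lemma measurable_pw (D : set mT) TT G : measurable D -> (forall T, continuous (G T)) ->
  measurable_fun D (pw TT G : mT -> R).
Proof.
move=> mD cG; elim: TT => [|T TT IH].
  exact: (continuous_measurable2 mD (cG ((0, 0), (0, 0), (0, 0)))).
have -> : pw (T :: TT) G = fun x => if `[< closed_triangle T x >] then G T x else pw TT G x.
  by apply/funext => x; rewrite /pw selT_cons; case: ifP.
apply: (@measurable_fun_if _ _ mT _ _ _ D mD (fun x => `[< closed_triangle T x >])).
- apply: (@measurable_fun_bool _ mT D _ true).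
  rewrite (_ : _ @^-1` _ = closed_triangle T); last first.
    by apply/seteqP; split => x /= => [/asboolP//|h]; exact/asboolP.
  apply: measurableI => //; apply: closed_measurable2; exact: closed_closed_triangle.
- apply: continuous_measurable2 (cG T).
  apply: measurableI => //.
  rewrite (_ : _ @^-1` _ = closed_triangle T); last first.
    by apply/seteqP; split => x /= => [/asboolP//|h]; exact/asboolP.
  apply: closed_measurable2; exact: closed_closed_triangle.
- by apply: measurable_funS IH => //; exact: subIsetl.
Qed.

Lemma bounded_pw TT G (M : R) : (forall T, continuous (G T)) ->
  exists C : R, forall x, `|x.1| <= M -> `|x.2| <= M -> `|pw TT G x| <= C.
Proof.
move=> cG; elim: TT => [|T TT [C HC]].
  by have [C HC] := continuous_bounded_square M (cG ((0, 0), (0, 0), (0, 0))); exists C.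
have [C' HC'] := continuous_bounded_square M (cG T).
exists (Num.max C C') => x h1 h2; rewrite le_max.
by rewrite /pw selT_cons; case: ifP => _; [rewrite HC' ?orbT|rewrite HC].
Qed.

(** The whole lines carrying the sides, not just the sides: off them every barycentric coordinate
    keeps its sign nearby, so the selected triangle is locally constant. *)
Definition on_line TT x := exists2 T, T \in TT & exists j, bary j T x = 0.

Lemma near_selT TT x : ~ on_line TT x -> \forall y \near x, selT TT y = selT TT x.
Proof.
elim: TT => [|T TT IH] nx; first by apply: (@nearW _ (nbhs x)) => y; rewrite /selT !nth_nil.
have h : \forall y \near x, `[< closed_triangle T y >] = `[< closed_triangle T x >].
  have hj j : \forall y \near x, (0 <= bary j T y) = (0 <= bary j T x).
    have cb : {for x, continuous (bary j T)} by have [+ _] := C1_bary j T; exact.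
    have [neg|pos|z] := ltgtP (bary j T x) 0.
    - near=> y; apply/negbTE; rewrite -ltNge; near: y.
      by apply: (cb [set z | z < 0]); apply: open_nbhs_nbhs; split => //; exact: open_lt.
    - near=> y; apply: ltW; near: y.
      by apply: (cb [set z | 0 < z]); apply: open_nbhs_nbhs; split => //; exact: open_gt.
    - by exfalso; apply: nx; exists T; rewrite ?mem_head//; exists j.
  near=> y.
  have ej j : (0 <= bary j T y) = (0 <= bary j T x).
    move: j; near: y; apply: filter_forall => j; exact: hj.
  by apply/asboolP/asboolP => /closed_triangleP H; apply/closed_triangleP => j; have := H j; rewrite ej.
have {}IH : \forall y \near x, selT TT y = selT TT x.
  by apply: IH => -[T' T'T hj]; apply: nx; exists T' => //; rewrite inE T'T orbT.
by near=> y; rewrite !selT_cons (near h y)// (near IH y).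
Unshelve. all: by end_near. Qed.

Lemma continuous_pw TT G x : ~ on_line TT x -> (forall T, continuous (G T)) ->
  {for x, continuous (pw TT G)}.
Proof.
move=> nx cG.
have : pw TT G @ x --> G (selT TT x) x.
  apply: cvg_trans (cG (selT TT x) x).
  apply: near_eq_cvg; have := near_selT nx; apply: filterS => y e.
  by rewrite /pw e.
by [].
Qed.

Lemma null_on_line TT : (forall T, T \in TT -> Pilot.Defs.nondegenerate T) ->
  exists N : set mT, [/\ measurable N, leb2 N = 0 & forall x, on_line TT x -> N x].
Proof.
elim: TT => [|T TT IH] nd.
  by exists set0; split; rewrite ?measure0// => x [].
have [N [mN N0 NN]] := IH (fun T' h => nd T' (mem_behead (s := T :: TT) h)).
pose L (j : 'I_3) : set mT := [set x | bary j T x = 0].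
have mL j : measurable (L j).
  apply: closed_measurable2; rewrite (_ : L j = bary j T @^-1` [set 0])//.
  apply: preimage_closed; last exact: closed_eq.
  by move=> x; have [+ _] := C1_bary j T; exact.
have L0 j : leb2 (L j) = 0.
  have [a [b [c [e ab]]]] := bary_affine j T.
  by rewrite /L e; apply: null_line; apply: ab; apply: nd; rewrite mem_head.
exists (L 0 `|` L 1 `|` L 2%:R `|` N); split.
- by repeat apply: measurableU.
- have m01 : measurable (L 0 `|` L 1) by exact: measurableU.
  have m012 : measurable (L 0 `|` L 1 `|` L 2%:R) by exact: measurableU.
  exact: (null_set_setU m012 mN (null_set_setU m01 (mL _) (null_set_setU (mL _) (mL _) (L0 _) (L0 _)) (L0 _)) N0).
- move=> x [T']; rewrite inE => /orP[/eqP -> [j]|TT' hj]; last by right; apply: NN; exists T'.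
  case: (eqVneq j 0) => [->|j0]; first by left; left; left.
  case: (eqVneq j 1) => [->|j1]; first by left; left; right.
  have -> : j = 2%:R by apply/val_inj; case: j j0 j1 => [[|[|[]]]].
  by left; right.
Qed.

End Piecewise.

(** * Green's formula up to the boundary *)

Section Green.
Context {R : realType}.
Notation mT := (measurableTypeR R * measurableTypeR R)%type.
Notation leb := (@lebesgue_measure R).
Variables (K : set (R * R)) (s : seq (R * R)) (TT : seq (@triangle R)) (M : R).
Hypothesis oK : open K.
Hypothesis bK : forall x, K x -> `|x.1| < M /\ `|x.2| < M.
Hypothesis bdK : closure K `\` K = closed_curve s.
Hypothesis cov : closure K = [set x | exists2 T, T \in TT & closed_triangle T x].

(** [co i] is the coordinate along the axis [i], and [cr i] below the one across it, which labels
    the lines [pt i a]. *)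
Definition co (i : 'I_2) (x : R * R) := if i == 0 then x.1 else x.2.
Definition cr (i : 'I_2) (x : R * R) := if i == 0 then x.2 else x.1.

Lemma pt_co i x : pt i (cr i x) (co i x) = x.
Proof. by rewrite /pt /cr /co; case: x => ? ?; case: (i == 0). Qed.
Lemma co_pt i a t : co i (pt i a t) = t.
Proof. by rewrite /pt /co; case: (i == 0). Qed.
Lemma cr_pt i a t : cr i (pt i a t) = a.
Proof. by rewrite /pt /cr; case: (i == 0). Qed.

(* The parameter at which [e] crosses the line on which [cr i] is [a]; junk value
   if [e] is parallel to this line. *)
Definition te i (e : (R * R) * (R * R)) a := (a - cr i e.1) / (cr i e.2 - cr i e.1).

Lemma cr_param i e t : cr i (param e t) = (1 - t) * cr i e.1 + t * cr i e.2.
Proof. by rewrite /cr /param; case: (i == 0). Qed.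

Lemma continuous_pt i a : continuous (pt i a : R -> R * R).
Proof.
rewrite /pt; case: (i == 0) => t.
  by apply: (@cvg_pair _ _ _ (nbhs t) (nbhs t) (nbhs a) _ _ _ id (cst a)) => //; exact: cvg_cst.
by apply: (@cvg_pair _ _ _ (nbhs t) (nbhs a) (nbhs t) _ _ _ (cst a) id) => //; exact: cvg_cst.
Qed.

Lemma open_line i a : open [set t | K (pt i a t)].
Proof.
rewrite (_ : [set _ | _] = pt i a @^-1` K)//.
by apply: open_comp => // t _; exact: continuous_pt.
Qed.

Lemma closure_line i a t : closure [set t | K (pt i a t)] t -> closure K (pt i a t).
Proof.
move=> h B nB; have [t' [h1 h2]] := h _ (continuous_pt (i := i) (a := a) (x := t) nB).
by exists (pt i a t').
Qed.

Definition edge_break i e a := co i (param e (te i e a)).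

Lemma bary_line i j T a : exists A B : R, forall t, bary j T (pt i a t) = A + B * t.
Proof.
have [u [v [w [-> _]]]] := bary_affine j T.
rewrite /pt; case: (i == 0).
  by exists (v * a + w), u => t /=; ring.
by exists (u * a + w), v => t /=; ring.
Qed.

(** Zero on the line of the affine function [bary j T], computed from its values at 0 and 1. If the
    function is constant there, division by 0 yields 0, a harmless extra candidate. *)
Definition tri_break i j (T : @triangle R) a :=
  let A := bary j T (pt i a 0) in let B := bary j T (pt i a 1) - A in - A / B.

(** An affine function of one variable without zero inside an interval keeps its sign there, up to
    the endpoints. *)
Lemma tri_break_sign i j T a u v t0 : ~ (u < tri_break i j T a < v) ->
  u < t0 < v -> 0 <= bary j T (pt i a t0) ->
  forall t, u <= t <= v -> 0 <= bary j T (pt i a t).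
Proof.
have [A [B AB]] := bary_line i j T a; rewrite /tri_break !AB mulr0 addr0 mulr1 addrAC subrr add0r.
move=> nb /andP[ut0 t0v] h t /andP[ut tv]; rewrite AB.
case: (eqVneq B 0) => [B0|B0]; first by move: h; rewrite B0 !mul0r.
set q := - A / B in nb; have Aq : A = - B * q by rewrite /q; field.
move: h; rewrite Aq => h; clearbody q.
have [qu|uq] := leP q u.
  have Bp : 0 < B.
    rewrite lt_neqAle eq_sym B0 leNgt; apply/negP => Bn.
    have : B * (t0 - q) < 0 by rewrite nmulr_rlt0//; lra.
    by lra.
  have Bq : 0 <= B * (t - q) by apply: mulr_ge0; [exact: ltW|lra].
  by lra.
have qv : v <= q by rewrite leNgt; apply/negP => qv; apply: nb; rewrite uq qv.
have Bn : B < 0.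
  rewrite lt_neqAle B0 leNgt; apply/negP => Bp.
  have : 0 < B * (q - t0) by rewrite mulr_gt0//; lra.
  by lra.
have Bq : 0 <= B * (t - q) by rewrite nmulr_rge0//; lra.
by lra.
Qed.

Variables (U : R * R -> R) (UT : @triangle R -> R * R -> R).
Hypothesis C1U : forall T, C1 (UT T).
Hypothesis UE : forall T x, T \in TT -> closed_triangle T x -> U x = UT T x.

(** Edge breaks catch the boundary points of the section, triangle breaks the places where it may
    change triangle, and [M] is the right-hand sentinel asked for by [section_bound]. *)
Definition breaks i a := M :: [seq edge_break i e a | e <- edges s] ++
  flatten [seq [seq tri_break i j T a | j <- enum 'I_3] | T <- TT].

Definition pdU i := pw TT (fun T => partial i (UT T)).

Definition edge_bound i e a : R :=
  if (cr i e.2 - cr i e.1 != 0) && (te i e a \in `[0, 1]) then `|U (param e (te i e a))| else 0.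

Lemma in_flatten_breaks i j T a : T \in TT -> tri_break i j T a \in breaks i a.
Proof.
move=> TTT; rewrite inE mem_cat; apply/orP; right; apply/orP; right.
apply/flattenP; exists [seq tri_break i j T a | j <- enum 'I_3].
  by apply/mapP; exists T.
by apply/mapP; exists j => //; rewrite mem_enum.
Qed.

(** Since [U] has a single value where the line passes from one triangle to the next, interior edges
    telescope away; what is left are boundary points, each lying on an edge that is transversal to
    the line. *)
Lemma line_bound i a : (forall e, e \in edges s -> cr i e.1 = cr i e.2 -> a <> cr i e.1) ->
  leb.-integrable [set t | K (pt i a t)] (fun t => (pdU i (pt i a t))%:E) ->
  `| \int[leb]_(t in [set t | K (pt i a t)]) pdU i (pt i a t) | <=
   \sum_(e <- edges s) edge_bound i e a.
Proof.
move=> na iU.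
have bd t : closure [set t | K (pt i a t)] t -> ~ K (pt i a t) ->
    exists e, [/\ e \in edges s, cr i e.2 - cr i e.1 != 0, te i e a \in `[0, 1],
      param e (te i e a) = pt i a t & edge_break i e a = t].
  move=> h1 h2; have : closed_curve s (pt i a t) by rewrite -bdK; split => //; exact: closure_line.
  move=> [e eE [r r01 er]]; exists e.
  have := cr_param i e r; rewrite er cr_pt => ea.
  have d0 : cr i e.2 - cr i e.1 != 0.
    rewrite subr_eq0; apply/eqP => ec; apply: (na e eE) => //.
    by rewrite ea ec; ring.
  have tr : te i e a = r by rewrite /te ea; field.
  by split => //; rewrite ?tr// /edge_break tr er co_pt.
have sel u v : u < v -> (forall q, q \in breaks i a -> ~ (u < q < v)) ->
    (forall t, u < t < v -> K (pt i a t)) ->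
    exists2 T, T \in TT & (forall t, u <= t <= v -> closed_triangle T (pt i a t)) /\
      (forall t, u < t < v -> selT TT (pt i a t) = T).
  move=> uv nb hK.
  have tri T t0 : T \in TT -> u < t0 < v -> closed_triangle T (pt i a t0) ->
      forall t, u <= t <= v -> closed_triangle T (pt i a t).
    move=> TTT ht0 /closed_triangleP h t ht; apply/closed_triangleP => j.
    apply: (tri_break_sign (nb _ (in_flatten_breaks i j a TTT)) ht0 (h j) ht).
  (* The triangle selected at the midpoint serves for the whole gap, because no membership can
     change without a break. *)
  pose m := (u + v) / 2; have hm : u < m < v by rewrite /m; apply/andP; split; lra.
  have := subset_closure (hK m hm); rewrite cov => /selT_in [TTT Tm].
  exists (selT TT (pt i a m)) => //; split; first exact: tri TTT hm Tm.
  move=> t ht.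
  have E : {in TT, (fun T => `[< closed_triangle T (pt i a t) >]) =1 (fun T => `[< closed_triangle T (pt i a m) >])}.
    move=> T T_TT; apply/asboolP/asboolP => h; apply: (tri T _ T_TT _ h) => //.
      by case/andP: hm => *; rewrite !ltW.
    by case/andP: ht => *; rewrite !ltW.
  by rewrite /selT (eq_in_find E).
have HQ t : closure [set t | K (pt i a t)] t -> ~ [set t | K (pt i a t)] t -> t \in breaks i a.
  move=> h1 h2; have [e [eE _ _ _ <-]] := bd t h1 h2.
  by rewrite inE mem_cat; apply/orP; right; apply/orP; left; apply/mapP; exists e.
have Hseg u v : u < v -> (forall q, q \in breaks i a -> ~ (u < q < v)) ->
    (forall t, u < t < v -> [set t | K (pt i a t)] t) ->
    exists H H' : R -> R, [/\ (forall t, u <= t <= v -> U (pt i a t) = H t),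
    (forall t : R, is_derive t 1 H (H' t)), continuous H' &
    (forall t, u < t < v -> pdU i (pt i a t) = H' t)].
  move=> uv nb hK; have [T TTT [h1 h2]] := sel u v uv nb hK.
  exists (fun t => UT T (pt i a t)), (fun t => partial i (UT T) (pt i a t)); split.
  - by move=> t ht; apply: UE => //; exact: h1.
  - by move=> t; exact: derive_pt.
  - have [_ /(_ i)[_ cp]] := C1U T.
    by move=> t; apply: continuous_comp; [exact: continuous_pt|exact: cp].
  - by move=> t ht; rewrite /pdU /pw h2.
have hM t : [set t | K (pt i a t)] t -> `|t| < M.
  by move=> /bK; rewrite /pt; case: (i == 0) => -[].
have MQ : M \in breaks i a by rewrite mem_head.
apply: (le_trans (@section_bound R _ (fun t => U (pt i a t)) _ _ (@open_line i a) HQ Hseg iU M hM MQ)).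
have eb0 e : 0 <= edge_bound i e a by rewrite /edge_bound; case: ifP.
rewrite big_mkcond /=.
(* Each boundary point is the break of at least one edge; a vertex of the polygon may be counted
   twice, which only increases the bound. *)
apply: (@le_trans _ _ (\sum_(q <- undup (breaks i a)) \sum_(e <- edges s) (if q == edge_break i e a then edge_bound i e a else 0))).
  apply: ler_sum => q _; case: ifP => [/asboolP[h1 h2]|_]; last first.
    by apply: sumr_ge0 => e _; case: ifP.
  have [e [eE d0 te01 ep eq]] := bd q h1 h2.
  rewrite (big_rem e)//= eq eqxx /edge_bound d0 te01 /= ep lerDl.
  by apply: sumr_ge0 => e' _; case: ifP => // _; exact: eb0.
rewrite exchange_big /=; apply: ler_sum => e _.
have [h|h] := boolP (edge_break i e a \in undup (breaks i a)).
  rewrite (bigD1_seq _ h (undup_uniq _))/= eqxx big1 ?addr0// => q /negbTE ->//.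
rewrite big_seq big1// => q hq; case: eqP => // qe; by rewrite -qe hq in h.
Qed.

(** The parameter [te i e a] is affine in [a], and its inverse slope [cr i e.2 - cr i e.1] is, up to
    sign, the length of the edge times the component [i] of its unit normal. *)
Lemma integral_edge_bound i e : 
  measurable_fun (`[0, 1]%classic : set (measurableTypeR R)) (U \o param e : measurableTypeR R -> R) ->
  measurable_fun [set: measurableTypeR R] (fun a => (edge_bound i e a)%:E : \bar R) /\
  (\int[leb]_a (edge_bound i e a)%:E =
   `|cr i e.2 - cr i e.1|%:E * \int[leb]_(t in `[0%R, 1%R]) `|U (param e t)|%:E)%E.
Proof.
move=> mU; have [d0|d0] := eqVneq (cr i e.2 - cr i e.1) 0.
  have e0 : (fun a => (edge_bound i e a)%:E : \bar R) = cst 0%E.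
    by apply/funext => a; rewrite /edge_bound d0 eqxx.
  by rewrite e0 d0 normr0 mul0e integral0; split => //; exact: measurable_cst.
pose h : R -> \bar R := (fun t => `|U (param e t)|%:E) \_ `[0, 1]%classic.
have mh : measurable_fun [set: measurableTypeR R] (h : measurableTypeR R -> \bar R).
  apply/(measurable_restrictT _ _).1 => //.
  by apply/measurable_EFinP; exact: measurableT_comp.
have h0 x : (0 <= h x)%E by rewrite /h patchE; case: ifP => // _; rewrite lee_fin.
pose al := (cr i e.2 - cr i e.1)^-1; pose be := - cr i e.1 / (cr i e.2 - cr i e.1).
have E a : (edge_bound i e a)%:E = h (al * a + be).
  have -> : al * a + be = te i e a by rewrite /te /al /be; field.
  rewrite /edge_bound /h patchE d0 /=.
  have -> : (te i e a \in `[0, 1]%classic) = (te i e a \in `[0, 1]).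
    by rewrite mem_setE.
  by case: ifP.
split.
  rewrite (_ : (fun a => _) = h \o (fun a => al * a + be)); last by apply/funext => a; rewrite E.
  apply: measurableT_comp => //.
  by apply: measurable_funD => //; exact: measurable_funM.
under eq_integral do rewrite E.
rewrite integral_affine//; last by rewrite /al invr_eq0.
by rewrite /al normfV invrK -integral_mkcond.
Qed.

(* The integral is bounded by boundary values only, without orienting the edges or
   introducing normals: this suffices since the bound is later applied to functions
   whose boundary values tend to [0]. *)
Lemma Green_bound i : leb2.-integrable K (EFin \o pdU i) ->
  (forall e, e \in edges s ->
    measurable_fun (`[0, 1]%classic : set (measurableTypeR R)) (U \o param e : measurableTypeR R -> R)) ->
  (`| \int[leb2]_(x in K) (pdU i x)%:E | <= \sum_(e <- edges s)
     `|cr i e.2 - cr i e.1|%:E * \int[leb]_(t in `[0%R, 1%R]) `|U (param e t)|%:E)%E.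
Proof.
move=> iU mU.
have mK : measurable (K : set mT) by exact: open_measurable2.
have eb0 e a : (0 <= (edge_bound i e a)%:E)%E.
  by rewrite lee_fin /edge_bound; case: ifP.
have S (l : seq ((R * R) * (R * R))) : {subset l <= edges s} ->
    measurable_fun [set: measurableTypeR R] (fun a => \sum_(e <- l) (edge_bound i e a)%:E : \bar R)%E /\
    (\int[leb]_a (\sum_(e <- l) (edge_bound i e a)%:E) = \sum_(e <- l)
     `|cr i e.2 - cr i e.1|%:E * \int[leb]_(t in `[0%R, 1%R]) `|U (param e t)|%:E)%E.
  elim: l => [|e l IH] sl.
    rewrite big_nil (_ : (fun a => _) = cst 0%E); last by apply/funext => a; rewrite big_nil.
    by rewrite integral0; split => //; exact: measurable_cst.
  have [m1 e1] : _ /\ _ := IH (fun x xl => sl x (mem_behead (s := e :: l) xl)).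
  have [m2 e2] := integral_edge_bound i (mU e (sl e (mem_head _ _))).
  rewrite (_ : (fun a => _) = (fun a => (edge_bound i e a)%:E + \sum_(e <- l) (edge_bound i e a)%:E)%E); last first.
    by apply/funext => a; rewrite big_cons.
  split; first exact: emeasurable_funD.
  rewrite ge0_integralD//; last by move=> a _; exact: sume_ge0.
  by rewrite e1 e2 big_cons.
have [mS <-] := S (edges s) (fun _ => id).
apply: (integral_le_lines (i := i)) => //.
  by move=> a; exact: sume_ge0.
(* Finitely many lines, among them all those that contain an edge. *)
pose L := [seq cr i e.1 | e <- edges s].
exists [set` L]; split.
- by apply: countable_measurable => //; apply: finite_set_countable; exact: finite_seq.
- apply: countable_lebesgue_measure0; apply: finite_set_countable; exact: finite_seq.
- move=> a /= ha; apply: contrapT => aL; apply: ha => ia.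
  rewrite -EFin_normr_Rintegral//; last first.
    by apply: open_measurable; exact: open_line.
  rewrite sumEFin lee_fin; apply: line_bound => // e eE _ ae; apply: aL.
  by rewrite /= ae; apply: map_f.
Qed.

End Green.

(** * Bounded measurable functions on the unit interval *)

Section UnitInterval.
Context {R : realType}.
Notation leb := (@lebesgue_measure R).
Notation I01 := (`[0%R, 1%R]%classic : set (measurableTypeR R)).

Definition bmeas (h : R -> R) := measurable_fun I01 (h : measurableTypeR R -> R) /\
  exists C, forall t, t \in `[0, 1] -> `|h t| <= C.

Lemma bmeas_integrable h : bmeas h -> leb.-integrable `[0, 1] (EFin \o h).
Proof.
move=> [mh [C hC]].
apply: (@le_integrable _ _ _ leb I01 _ _ (cst C%:E)) => //.
- exact/measurable_EFinP.
- by move=> t ht; rewrite /= lee_fin (le_trans (hC _ ht))// ler_norm.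
- apply/integrableP; split => //.
  rewrite integral_cst//= lte_mul_pinfty//.
  by rewrite lebesgue_measure_itv /= lte_fin ltr01 -EFinB ltry.
Qed.

Lemma bmeasM h k : bmeas h -> bmeas k -> bmeas (h \* k).
Proof.
move=> [mh [C hC]] [mk [D kD]]; split; first exact: measurable_funM.
exists (C * D) => t ht /=; rewrite normrM ler_pM//; [exact: hC|exact: kD].
Qed.

Lemma bmeasB h k : bmeas h -> bmeas k -> bmeas (h \- k).
Proof.
move=> [mh [C hC]] [mk [D kD]]; split; first exact: measurable_funB.
exists (C + D) => t ht /=; rewrite (le_trans (ler_normB _ _))// lerD//; [exact: hC|exact: kD].
Qed.

Lemma bmeas_norm h : bmeas h -> bmeas (fun t => `|h t|).
Proof.
move=> [mh [C hC]]; split; first exact: measurableT_comp.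
by exists C => t ht /=; rewrite normr_id; exact: hC.
Qed.

Lemma bmeasZ c h : bmeas h -> bmeas (fun t => c * h t).
Proof.
move=> hh; apply: (@bmeasM (cst c)) => //; split => //.
by exists `|c| => t _ /=.
Qed.

Lemma bmeas_young h k (t : R) : bmeas h -> bmeas k -> 0 < t ->
  \int[leb]_(x in `[0, 1]) `|h x * k x| <=
  t / 2 * \int[leb]_(x in `[0, 1]) (h x * h x) + t^-1 / 2 * \int[leb]_(x in `[0, 1]) (k x * k x).
Proof.
move=> bh bk t0.
have ih := bmeas_integrable (bmeasM bh bh).
have ik := bmeas_integrable (bmeasM bk bk).
have ih' := bmeas_integrable (bmeasZ (t / 2) (bmeasM bh bh)).
have ik' := bmeas_integrable (bmeasZ (t^-1 / 2) (bmeasM bk bk)).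
rewrite -!RintegralZl// -RintegralD//.
apply: le_Rintegral => //.
- exact: (bmeas_integrable (bmeas_norm (bmeasM bh bk))).
- exact: (integrableD _ ih' ik').
- by move=> x _; rewrite -!expr2; exact: young.
Qed.

End UnitInterval.

Lemma inner_cvgl (R : realType) (S : set (R * R)) g h (hn : nat -> R * R -> R) :
  measurable (S : set (measurableTypeR R * measurableTypeR R)%type) ->
  L2 S g -> L2 S h -> (forall n, L2 S (hn n)) ->
  (fun n => inner S (hn n \- h) (hn n \- h)) @ \oo --> (0 : R) ->
  (fun n => inner S (hn n) g) @ \oo --> inner S h g.
Proof.
move=> mS Lg Lh Ln c; rewrite innerC (_ : (fun n => _) = (fun n => inner S g (hn n))).
  exact: inner_cvg.
by apply/funext => n; rewrite innerC.
Qed.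

(** * Weak derivatives and integration by parts against functions not vanishing on the boundary *)

Section Weak.
Context {R : realType}.
Notation mT := (measurableTypeR R * measurableTypeR R)%type.
Notation leb := (@lebesgue_measure R).
Notation I01 := (`[0%R, 1%R]%classic : set (measurableTypeR R)).
Variables (K : set (R * R)) (s : seq (R * R)) (TT : seq (@triangle R)) (M : R).
Hypothesis oK : open K.
Hypothesis bK : forall x, K x -> `|x.1| < M /\ `|x.2| < M.
Hypothesis bdK : closure K `\` K = closed_curve s.
Hypothesis cov : closure K = [set x | exists2 T, T \in TT & closed_triangle T x].

Lemma mK : measurable (K : set mT). Proof. exact: open_measurable2. Qed.

Lemma finK : (leb2 K < +oo)%E.
Proof.
apply: le_lt_trans (leb2_square (- M) M); apply: le_measure; rewrite ?inE.
- exact: mK.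
- by apply: measurableX; exact: measurable_itv.
- by move=> x /bK [h1 h2]; split; rewrite /= in_itv /= -ler_norml ltW.
Qed.

Lemma bclK x : closure K x -> `|x.1| <= M /\ `|x.2| <= M.
Proof.
move=> h; split; rewrite leNgt; apply/negP => hM.
  have nB : nbhs x [set y : R * R | M < `|y.1|].
    apply: open_nbhs_nbhs; split => //.
    rewrite (_ : [set _ | _] = (fun y : R * R => `|y.1|) @^-1` [set z | M < z])//.
    apply: open_comp; last exact: open_gt.
    by move=> y _; apply: continuous_comp; [exact: cvg_fst|exact: norm_continuous].
  by have [y [/bK[+ _] /=]] := h _ nB => /lt_trans h1 /h1; rewrite ltxx.
have nB : nbhs x [set y : R * R | M < `|y.2|].
  apply: open_nbhs_nbhs; split => //.
  rewrite (_ : [set _ | _] = (fun y : R * R => `|y.2|) @^-1` [set z | M < z])//.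
  apply: open_comp; last exact: open_gt.
  by move=> y _; apply: continuous_comp; [exact: cvg_snd|exact: norm_continuous].
by have [y [/bK[_ +] /=]] := h _ nB => /lt_trans h1 /h1; rewrite ltxx.
Qed.

Lemma L2_continuous f : continuous f -> L2 K f.
Proof.
move=> cf; have [C HC] := continuous_bounded_square M cf.
apply: (@bounded_L2 _ _ _ C mK finK); first exact: continuous_measurable2 mK cf.
by move=> x /bK[h1 h2]; apply: HC; exact: ltW.
Qed.

Lemma L2_pw G : (forall T, continuous (G T)) -> L2 K (pw TT G).
Proof.
move=> cG; have [C HC] := bounded_pw TT M cG.
apply: (@bounded_L2 _ _ _ C mK finK); first exact: measurable_pw mK cG.
by move=> x /bK[h1 h2]; apply: HC; exact: ltW.
Qed.

Lemma in_curve e t : e \in edges s -> t \in `[0, 1] -> closed_curve s (param e t).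
Proof. by move=> eE ht; exists e => //; exists t. Qed.

Lemma curve_closure x : closed_curve s x -> closure K x.
Proof. by rewrite -bdK => -[]. Qed.

Lemma curve_notK x : closed_curve s x -> ~ K x.
Proof. by rewrite -bdK => -[]. Qed.

Lemma measurable_param e : measurable_fun [set: measurableTypeR R] (param e : measurableTypeR R -> mT).
Proof.
apply: measurable_fun_pair; apply: measurable_funD; apply: measurable_funM => //;
  exact: measurable_funB.
Qed.

Lemma bmeas_pw e G : e \in edges s -> (forall T, continuous (G T)) -> bmeas (pw TT G \o param e).
Proof.
move=> eE cG; split.
  apply: (@measurable_funTS _ _ (measurableTypeR R)).
  apply: (@measurableT_comp _ _ _ _ mT); last exact: measurable_param.
  exact: measurable_pw.
have [C HC] := bounded_pw TT M cG; exists C => t ht.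
by have [h1 h2] := bclK (curve_closure (in_curve eE ht)); exact: HC.
Qed.

Lemma eq_bmeas (h k : R -> R) : (forall t, t \in `[0, 1] -> h t = k t) -> bmeas h -> bmeas k.
Proof.
move=> hk [mh [C hC]]; split.
  by apply: eq_measurable_fun mh => t; rewrite inE => ht; exact: hk.
by exists C => t ht; rewrite -hk//; exact: hC.
Qed.

Section WithU.
Variables (U : R * R -> R) (UT : @triangle R -> R * R -> R).
Hypothesis C1U : forall T, C1 (UT T).
Hypothesis UE : forall T x, T \in TT -> closed_triangle T x -> U x = UT T x.

Lemma pw_eq x : closure K x -> U x = pw TT UT x.
Proof. by rewrite cov => /selT_in[h1 h2]; exact: UE. Qed.

Lemma cUT T : continuous (UT T). Proof. by have [] := C1U T. Qed.
Lemma cpUT i T : continuous (partial i (UT T)). Proof. by have [_ /(_ i)[]] := C1U T. Qed.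

Lemma bmeas_U e : e \in edges s -> bmeas (U \o param e).
Proof.
move=> eE; apply: eq_bmeas (bmeas_pw eE cUT) => t ht /=.
by rewrite pw_eq//; exact/curve_closure/in_curve.
Qed.

Lemma L2_U : L2 K U.
Proof.
have [m i] := L2_pw cUT; split.
  by apply: eq_measurable_fun m => x; rewrite inE => Kx; rewrite pw_eq//; exact: subset_closure.
apply: eq_integrable i; first exact: mK.
by move=> x; rewrite inE => Kx; rewrite -pw_eq//; exact: subset_closure.
Qed.

Lemma L2_pdU i : L2 K (pdU TT UT i).
Proof. by apply: L2_pw => T; exact: cpUT. Qed.

Lemma Green_boundR i : `| \int[leb2]_(x in K) pdU TT UT i x | <= \sum_(e <- edges s)
     `|cr i e.2 - cr i e.1| * \int[leb]_(t in `[0, 1]) `|U (param e t)|.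
Proof.
have iU := L2_integrable mK finK (L2_pdU i).
rewrite -lee_fin EFin_normr_Rintegral//; last exact: mK.
apply: le_trans (Green_bound oK bK bdK cov C1U UE iU _) _.
  by move=> e eE; have [] := bmeas_U eE.
rewrite -sumEFin; rewrite big_seq [leRHS]big_seq; apply: lee_sum => e eE.
rewrite EFinM lee_wpmul2l ?lee_fin// /Rintegral fineK//.
apply: (@integrable_fin_num _ _ _ leb) => //.
exact: (bmeas_integrable (bmeas_norm (bmeas_U eE))).
Qed.

End WithU.

Section WithF.
Variables (f : R * R -> R) (fT : @triangle R -> R * R -> R).
Hypothesis C1f : forall T, C1 (fT T).
Hypothesis fE : forall T x, T \in TT -> closed_triangle T x -> f x = fT T x.
Notation Df := (pdU TT fT).

Lemma pdUM i h x : C1 h -> pdU TT (fun T => fT T \* h) i x = Df i x * h x + pw TT fT x * partial i h x.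
Proof. by move=> Ch; rewrite /pdU /pw partialM. Qed.

Lemma pdUB i h x : C1 h -> pdU TT (fun T => fT T \- h) i x = Df i x - partial i h x.
Proof. by move=> Ch; rewrite /pdU /pw partialB. Qed.

(** Green's bound for the product of [f] and [h], whose pieces are again C^1. *)
Lemma parts_bound i h : C1 h -> `| inner K (Df i) h + inner K f (partial i h) | <=
  \sum_(e <- edges s) `|cr i e.2 - cr i e.1| *
    \int[leb]_(t in `[0, 1]) `|f (param e t) * h (param e t)|.
Proof.
move=> Ch; have Lh : L2 K h by apply: L2_continuous; have [] := Ch.
have Lph : L2 K (partial i h) by apply: L2_continuous; have [_ /(_ i)[]] := Ch.
have C1fh T : C1 (fT T \* h) by exact: C1M.
have fhE T x : T \in TT -> closed_triangle T x -> (f \* h) x = (fT T \* h) x.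
  by move=> TTT Tx /=; rewrite (fE TTT Tx).
have := Green_boundR C1fh fhE i; congr (`| _ | <= _).
rewrite /inner -RintegralD//; last 3 first.
- exact: mK.
- by apply: L2_integrableM => //; [exact: mK|exact: L2_pdU].
- by apply: L2_integrableM => //; [exact: mK|exact: L2_U C1f fE].
apply: eq_Rintegral => x; rewrite inE => Kx.
by rewrite pdUM// (pw_eq fE)//; exact: subset_closure.
Qed.

(** A test function is 0 on the boundary curve, which makes the bound of [parts_bound] vanish. *)
Lemma wpartial_pw i : is_wpartial K i f (Df i).
Proof.
split; first exact: L2_pdU.
move=> phi [sphi [C [cC CK phi0]]].
apply/eqP; rewrite -addr_eq0 addrC -normr_le0.
apply: le_trans (parts_bound i (smooth_C1 sphi)) _.
rewrite big_seq; apply: sumr_le0 => e eE.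
rewrite (@eq_Rintegral _ _ _ _ _ (cst 0)) ?Rintegral_cst// ?mul0r ?mulr0//.
move=> t; rewrite inE => ht; rewrite phi0 ?mulr0 ?normr0//.
by move=> /CK; apply: curve_notK; exact: in_curve.
Qed.

End WithF.

Section WithV.
Variables (f : R * R -> R) (fT : @triangle R -> R * R -> R).
Hypothesis C1f : forall T, C1 (fT T).
Hypothesis fE : forall T x, T \in TT -> closed_triangle T x -> f x = fT T x.
Notation Df := (pdU TT fT).
Variables (v g : R * R -> R) (Dv : 'I_2 -> R * R -> R) (phi : nat -> R * R -> R).
Hypothesis Lv : L2 K v.
Hypothesis LDv : forall i, L2 K (Dv i).
Hypothesis C1phi : forall n, C1 (phi n).
Hypothesis cvg_phi : (fun n => inner K (phi n \- v) (phi n \- v)) @ \oo --> (0 : R).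
Hypothesis cvg_dphi : forall i : 'I_2, (fun n => inner K (partial i (phi n) \- Dv i)
                                  (partial i (phi n) \- Dv i)) @ \oo --> (0 : R).
Hypothesis cvg_edge : forall e, e \in edges s ->
        (fun n => edge_inner e (phi n \- g) (phi n \- g)) @ \oo --> (0 : R).
Hypothesis fg : forall e t, e \in edges s -> t \in `[0, 1] -> f (param e t) = g (param e t).

Lemma edge_small i h e (eps : R) : C1 h -> e \in edges s -> 0 < eps ->
  \forall n \near \oo, `|cr i e.2 - cr i e.1| *
    \int[leb]_(t in `[0, 1]) `|(f \- phi n) (param e t) * h (param e t)| < eps.
Proof.
move=> Ch eE e0.
have [d0|d0] := eqVneq (cr i e.2 - cr i e.1) 0.
  by apply: nearW => n; rewrite d0 normr0 mul0r.
have l0 : 0 < length e.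
  rewrite /length /edist sqrtr_gt0 lt0r addr_ge0 ?sqr_ge0// andbT.
  rewrite paddr_eq0 ?sqr_ge0// !sqrf_eq0 !subr_eq0; apply: contra d0.
  by rewrite /cr; case: (i == 0) => /andP[/eqP h1 /eqP h2]; rewrite ?h1 ?h2 subrr.
have bh : bmeas (h \o param e).
  by apply: (bmeas_pw (G := fun=> h)) => // T; have [] := Ch.
have bf n : bmeas ((f \- phi n) \o param e).
  apply: (@bmeas_U _ (fun T => fT T \- phi n)) => //.
  - by move=> T; exact: C1B.
  - by move=> T x h1 h2 /=; rewrite (fE h1 h2).
set c := `|_|; have c0 : 0 < c by rewrite normr_gt0.
have a0 : 0 <= \int[leb]_(x in `[0, 1]) (h (param e x) * h (param e x)).
  by apply: Rintegral_ge0 => x _; rewrite -expr2 sqr_ge0.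
have [t [d [t0 dd H]]] := young_small 0 a0 (divr_gt0 e0 c0).
(* The threshold is scaled because [edge_inner] carries the factor [length e], absent from the
   integral over the parameter. *)
have : 0 < length e * d by rewrite mulr_gt0.
move/cvgrPdist_lt : (cvg_edge eE) => /[apply]; apply: filterS => n.
rewrite sub0r normrN => hd.
rewrite mulrC -ltr_pdivlMr//.
under eq_Rintegral do rewrite mulrC.
apply: le_lt_trans (bmeas_young bh (bf n) t0) _; apply: H.
rewrite -(ltr_pM2l l0); apply: le_lt_trans hd; apply: le_trans (ler_norm _).
rewrite /edge_inner /edge_int ler_pM2l// le_eqVlt; apply/orP; left; apply/eqP.
apply: eq_Rintegral => x; rewrite inE => hx; rewrite /= (fg eE hx); ring.
Qed.

(** The function [f \- v] has zero trace, so its integration by parts extends from test functions to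
    all C^1 functions. For [f \- phi n] it holds up to a boundary term, which tends to 0 because [f]
    and [g] agree on the edges. *)
Lemma extension i h : C1 h ->
  inner K (Df i \- Dv i) h + inner K (f \- v) (partial i h) = 0.
Proof.
move=> Ch.
have Lh : L2 K h by apply: L2_continuous; have [] := Ch.
have Lph : L2 K (partial i h) by apply: L2_continuous; have [_ /(_ i)[]] := Ch.
have Lf := L2_U C1f fE.
have Lphi n : L2 K (phi n) by apply: L2_continuous; have [] := C1phi n.
have Lpphi n : L2 K (partial i (phi n)) by apply: L2_continuous; have [_ /(_ i)[]] := C1phi n.
have LDf : L2 K (Df i) by exact: L2_pdU.
have c1 : (fun n => (inner K (Df i) h - inner K (partial i (phi n)) h) +
    (inner K f (partial i h) - inner K (phi n) (partial i h))) @ \oo -->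
    (inner K (Df i \- Dv i) h + inner K (f \- v) (partial i h)).
  rewrite !innerBl//; try exact: mK.
  apply: cvgD; apply: cvgB; (try exact: cvg_cst).
    exact: inner_cvgl mK Lh (LDv i) Lpphi (cvg_dphi i).
  exact: inner_cvgl mK Lph Lv Lphi cvg_phi.
have c2 : (fun n => (inner K (Df i) h - inner K (partial i (phi n)) h) +
    (inner K f (partial i h) - inner K (phi n) (partial i h))) @ \oo --> (0 : R).
  apply/cvgrPdist_lt => eps eps0.
  (* One more than the number of edges, so that the sum over the edges stays strictly below
     [eps]. *)
  pose N := (size (edges s)).+1.
  have N0 : 0 < N%:R :> R by rewrite ltr0n.
  have H : \forall n \near \oo, forall e, e \in edges s -> `|cr i e.2 - cr i e.1| *
    \int[leb]_(t in `[0, 1]) `|(f \- phi n) (param e t) * h (param e t)| < eps / N%:R.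
    have := edge_small i Ch _ (divr_gt0 eps0 N0).
    elim: (edges s) => [|e l IH] He; first by apply: nearW => n e.
    have h1 := He e (mem_head _ _).
    have h2 := IH (fun e' h' => He e' (mem_behead (s := e :: l) h')).
    near=> n => e'; rewrite inE => /orP[/eqP ->|].
      by near: n.
    by move: e'; near: n.
  move: H; apply: filterS => n Hn; rewrite sub0r normrN.
  rewrite -!innerBl//; try exact: mK.
  have C1n T : C1 (fT T \- phi n) by exact: C1B.
  have nE T x : T \in TT -> closed_triangle T x -> (f \- phi n) x = (fT T \- phi n) x.
    by move=> h1 h2 /=; rewrite (fE h1 h2).
  have := parts_bound C1n nE i Ch.
  rewrite (@eq_inner _ K _ (Df i \- partial i (phi n)) h h) //; last first.
    by move=> x _; rewrite pdUB.
  move/le_lt_trans; apply.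
  apply: (@le_lt_trans _ _ (\sum_(e <- edges s) eps / N%:R)).
    by rewrite big_seq [leRHS]big_seq; apply: ler_sum => e /Hn /ltW.
  rewrite big_const_seq count_predT iter_addr_0 -(mulr_natr (eps / N%:R)).
  by rewrite mulrAC ltr_pdivrMr// ltr_pM2l// ltr_nat.
exact: cvg_unique c1 c2.
Unshelve. all: by end_near. Qed.

End WithV.

End Weak.

(** * Bump functions and the mollification kernel *)

Section Bump.
Context {R : realType}.
Notation leb := (@lebesgue_measure R).
Implicit Types (p q : {poly R}).

(* The functions [p(1/x) exp(-1/x)], prolonged by [0], are stable under differentiation:
   [(flat p)' = flat (dflat p)]. *)
Definition flat p (x : R) : R := if 0 < x then p.[x^-1] * expR (- x^-1) else 0.
Definition dflat p : {poly R} := 'X^2 * (p - p^`()).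

(** The inequality [y / n <= expR (y / n)] raised to the power [n]; for [n = 0] it reads
    [1 <= expR y]. *)
Lemma expR_pow_bound (n : nat) (y : R) : 0 <= y -> y ^+ n <= n%:R ^+ n * expR y.
Proof.
move=> y0; case: n => [|n]; first by rewrite !expr0 mul1r -{1}expR0 ler_expR.
have n0 : (n.+1%:R : R) != 0 by rewrite pnatr_eq0.
have -> : expR y = expR (y / n.+1%:R) ^+ n.+1 by rewrite -expRM_natl; congr expR; field.
rewrite -exprMn; apply: lerXn2r; rewrite ?nnegrE//.
rewrite mulrC -ler_pdivrMr ?ltr0n//; apply: le_trans (expR_ge1Dx _).
by rewrite lerDr.
Qed.

Lemma flat_bounded p : exists C, forall x, `|flat p x| <= C.
Proof.
exists (\sum_(i < size p) `|p`_i| * i%:R ^+ i) => x.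
have C0 : 0 <= \sum_(i < size p) `|p`_i| * (i%:R : R) ^+ i.
  by apply: sumr_ge0 => i _; rewrite mulr_ge0// exprn_ge0.
rewrite /flat; case: ifPn => x0; last by rewrite normr0.
have y0 : 0 <= x^-1 by rewrite invr_ge0 ltW.
rewrite normrM (ger0_norm (expR_ge0 _)) expRN ler_pdivrMr ?expR_gt0// horner_coef.
apply: (le_trans (ler_norm_sum _ _ _)); rewrite mulr_suml; apply: ler_sum => i _.
rewrite normrM -mulrA ler_wpM2l// normrX ger0_norm//; exact: expR_pow_bound.
Qed.

Lemma flat_le0 p x : x <= 0 -> flat p x = 0.
Proof. by rewrite /flat ltNge => ->. Qed.

(** Extracts a factor [x ^+ 2] in front of a bounded function, whence the derivative 0 at the
    origin. *)
Lemma flatXM p x : 0 < x -> flat p x = x ^+ 2 * flat ('X^2 * p) x.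
Proof.
move=> x0; rewrite /flat x0 hornerM hornerXn mulrA mulrA -exprMn divff ?gt_eqF// expr1n mul1r//.
Qed.

Lemma near_is_derive (f g : R -> R) (x d : R) : (\forall y \near x, f y = g y) ->
  is_derive x 1 g d -> is_derive x 1 f d.
Proof.
move=> e [d1 d2].
have e' : \forall y \near x, g y = f y by apply: filterS e => y ->.
apply: DeriveDef; first exact: near_eq_derivable e' d1.
by rewrite (near_eq_derive _ e).
Qed.

Lemma is_derive_mul (f g : R -> R) (x a b : R) : is_derive x 1 f a -> is_derive x 1 g b ->
  is_derive x 1 (fun y => f y * g y) (a * g x + f x * b).
Proof.
move=> df dg; apply: (@is_derive_eq _ _ _ _ _ _ _ _ (is_deriveM df dg)).
by rewrite /GRing.scale /= addrC [g x * a]mulrC.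
Qed.

Lemma is_derive_flat p (x : R) : is_derive x 1 (flat p) (flat (dflat p) x).
Proof.
have [x0|x0|x0] := ltgtP x 0.
- rewrite flat_le0 ?ltW//.
  have e : \forall y \near x, flat p y = cst 0 y.
    near=> y; apply: flat_le0; apply: ltW; near: y; exact: lt_nbhsl.
  by apply: near_is_derive e _; exact: is_derive_cst.
- have e : \forall y \near x, flat p y = p.[y^-1] * expR (- y^-1).
    by near=> y; rewrite /flat ifT//; near: y; apply: open_nbhs_nbhs; split => //; exact: open_gt.
  have xn : x != 0 by rewrite gt_eqF.
  have di : is_derive x 1 (fun y : R => y^-1) (- x ^- 2).
    apply: DeriveDef; first exact: derivableV.
    by rewrite deriveV// derive_id /GRing.scale /= mulr1.
  have dp : is_derive x 1 (fun y : R => p.[y^-1]) (p^`().[x^-1] * - x ^- 2).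
    exact: (@is_derive1_comp _ (horner p) (fun y => y^-1)).
  have de : is_derive x 1 (fun y : R => expR (- y^-1)) (expR (- x^-1) * x ^- 2).
    have dn : is_derive x 1 (fun y : R => - y^-1) (x ^- 2) by rewrite -[x ^- 2]opprK; exact: is_deriveN.
    exact: (@is_derive1_comp _ expR (fun y => - y^-1)).
  apply: near_is_derive e _; apply: (@is_derive_eq _ _ _ _ _ _ _ _ (is_derive_mul dp de)).
  by rewrite /flat x0 /dflat hornerM hornerXn hornerD hornerN /GRing.scale /= exprVn; ring.
- rewrite x0 [flat (dflat p) 0]flat_le0//.
  have [C HC] := flat_bounded ('X^2 * p).
  have C0 : 0 <= C by apply: le_trans (HC 0).
  have c0 : (fun h : R => h^-1 *: ((flat p \o shift 0) (h *: 1) - flat p 0)) @ 0^' --> (0 : R).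
    have e h : h^-1 *: ((flat p \o shift 0) (h *: 1) - flat p 0) = h^-1 * flat p h.
      by rewrite (flat_le0 p (lexx 0)) subr0 /= addr0 /GRing.scale /= mulr1.
    under eq_fun do rewrite e.
    apply/cvgrPdist_lt => eps e0; near=> h.
    have h0 : h != 0 by near: h; exact: nbhs_dnbhs_neq.
    rewrite sub0r normrN normrM.
    have [hp|hn] := ltP 0 h; last by rewrite flat_le0// normr0 mulr0.
    rewrite flatXM// normrM normfV (gtr0_norm hp) (ger0_norm (sqr_ge0 h)) mulrA expr2 mulrA mulVf// mul1r.
    apply: (@le_lt_trans _ _ (h * (C + 1))).
      rewrite ler_pM2l//; apply: (le_trans (HC h)); rewrite lerDl//.
    rewrite -ltr_pdivlMr ?ltr_wpDl//.
    have : `|h| < eps / (C + 1).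
      near: h; apply: dnbhs0_lt; rewrite divr_gt0// ltr_wpDl//.
    by rewrite gtr0_norm.
  by apply: DeriveDef; [exact: cvgP c0|exact: cvg_lim c0].
Unshelve. all: by end_near. Qed.

(* [b n] is the [n]-th derivative of [b 0]. *)
Definition dseq (b : nat -> R -> R) := forall n (x : R), is_derive x 1 (b n) (b n.+1 x).

(** A class of functions that vanish outside ]-1, 1[ and is closed under differentiation: [dflats]
    is the product rule, the minus sign coming from the argument [1 - x]. *)
Definition flats (l : seq ({poly R} * {poly R})) (x : R) :=
  \sum_(pq <- l) flat pq.1 (1 - x) * flat pq.2 (1 + x).
Definition dflats (l : seq ({poly R} * {poly R})) :=
  [seq (- dflat pq.1, pq.2) | pq <- l] ++ [seq (pq.1, dflat pq.2) | pq <- l].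

Lemma flatN p x : flat (- p) x = - flat p x.
Proof. by rewrite /flat; case: ifP => _; rewrite ?oppr0// hornerN mulNr. Qed.

Lemma is_derive_flats l (x : R) : is_derive x 1 (flats l) (flats (dflats l) x).
Proof.
rewrite /flats /dflats big_cat !big_map /= -big_split /=.
elim: l => [|[p q] l IH].
  rewrite big_nil (_ : (fun _ => _) = cst 0); first exact: is_derive_cst.
  by apply/funext => y; rewrite big_nil.
rewrite big_cons (_ : (fun _ => _) = (fun x => flat p (1 - x) * flat q (1 + x)) +
  (fun x => \sum_(pq <- l) flat pq.1 (1 - x) * flat pq.2 (1 + x))); last first.
  by apply/funext => y; rewrite big_cons.
apply: is_deriveD => /=.
have d1 : is_derive x 1 (fun x => flat p (1 - x)) (- flat (dflat p) (1 - x)).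
  have d : is_derive x 1 (fun x : R => 1 - x) (-1).
    rewrite -[X in is_derive _ _ _ X]add0r.
    apply: is_deriveD; apply: is_deriveN.
  have dd := is_derive_flat p (1 - x).
  rewrite -mulrN1; exact: (@is_derive1_comp _ (flat p) (fun x => 1 - x)).
have d2 : is_derive x 1 (fun x => flat q (1 + x)) (flat (dflat q) (1 + x)).
  have d : is_derive x 1 (fun x : R => 1 + x) 1.
    rewrite -[X in is_derive _ _ _ X]add0r; exact: is_deriveD.
  have dd := is_derive_flat q (1 + x).
  rewrite -[X in is_derive _ _ _ X]mulr1; exact: (@is_derive1_comp _ (flat q) (fun x => 1 + x)).
apply: (@is_derive_eq _ _ _ _ _ _ _ _ (is_derive_mul d1 d2)).
by rewrite flatN.
Qed.

(** For [n = 0] this is exp(-2 / (1 - x^2)) on ]-1, 1[, the usual bump function. *)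
Definition bump0 n := flats (iter n dflats [:: (1, 1)]).

Lemma dseq_bump0 : dseq bump0.
Proof. by move=> n x; exact: is_derive_flats. Qed.

Lemma flats_out l x : 1 <= `|x| -> flats l x = 0.
Proof.
move=> hx; rewrite /flats big1// => -[p q] _ /=.
have [x0|x0] := leP 0 x.
  by rewrite (@flat_le0 p) ?mul0r// subr_le0; move: hx; rewrite ger0_norm.
rewrite (@flat_le0 q) ?mulr0//; move: hx; rewrite ltr0_norm//; lra.
Qed.

Lemma flats_bounded l : exists C, forall x, `|flats l x| <= C.
Proof.
elim: l => [|[p q] l [C HC]].
  by exists 0 => x; rewrite /flats big_nil normr0.
have [A HA] := flat_bounded p; have [B HB] := flat_bounded q.
exists (A * B + C) => x; rewrite /flats big_cons (le_trans (ler_normD _ _))//; apply: lerD; last exact: HC.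
by rewrite /= normrM ler_pM.
Qed.

Lemma is_derive_continuous (f g : R -> R) : (forall x : R, is_derive x 1 f (g x)) -> continuous f.
Proof. by move=> d x; apply: differentiable_continuous; apply/derivable1_diffP; exact: ex_derive. Qed.

Lemma continuous_dseq b n : dseq b -> continuous (b n).
Proof. by move=> db; apply: (@is_derive_continuous _ (b n.+1)); exact: db. Qed.

Lemma bump0_ge0 x : 0 <= bump0 0%N x.
Proof.
rewrite /bump0 /flats big_seq1 /= mulr_ge0// /flat; case: ifP => // _; by rewrite hornerC mul1r expR_ge0.
Qed.

Lemma measurable_dseq b n : dseq b -> measurable_fun [set: measurableTypeR R] (b n : measurableTypeR R -> R).
Proof. by move=> db; apply: continuous_measurable_fun; exact: continuous_dseq. Qed.

Lemma bump0_int : exists2 c : R, 0 < c & (\int[leb]_x (bump0 0%N x)%:E = c%:E)%E.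
Proof.
have m := measurable_dseq 0%N dseq_bump0.
have me : measurable_fun [set: measurableTypeR R] (fun x => (bump0 0%N x)%:E : \bar R) by exact/measurable_EFinP.
have [C HC] := flats_bounded (iter 0 dflats [:: (1, 1)]).
have fin : (\int[leb]_x (bump0 0%N x)%:E < +oo)%E.
  apply: (@le_lt_trans _ _ (\int[leb]_x (C%:E * (\1_(`[-1, 1]%classic) x)%:E))%E).
    apply: ge0_le_integral => //.
    - by move=> x _; rewrite lee_fin bump0_ge0.
    - by apply/measurable_EFinP; exact: measurable_funM.
    - move=> x _; rewrite -EFinM lee_fin indicE.
      have [h|h] := boolP (x \in `[-1, 1]%classic).
        by rewrite mulr1 (le_trans (ler_norm _))//; exact: HC.
      rewrite mulr0 /bump0 flats_out//; move: h; rewrite mem_setE in_itv /= -ler_norml -ltNge.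
      exact: ltW.
  rewrite integralZl//; last first.
    apply/integrableP; split; first exact/measurable_EFinP.
    under eq_integral do rewrite gee0_abs ?lee_fin//.
    rewrite integral_indic//= setIT lebesgue_measure_itv /=.
    by case: ifP => _; rewrite ?ltry// -EFinB ltry.
  rewrite integral_indic//= setIT lebesgue_measure_itv /=.
  by case: ifP => _; rewrite ?mule0 ?ltry// -EFinB -EFinM ltry.
have pos : (0 < \int[leb]_x (bump0 0%N x)%:E)%E.
  (* Lower bound of the bump on [0, 1/2], where 1 / (1 - x) and 1 / (1 + x) are at most 2. *)
  pose d := expR (- 2) * expR (- 2) : R.
  have d0 : 0 < d by rewrite mulr_gt0// expR_gt0.
  apply: (@lt_le_trans _ _ (\int[leb]_x (d%:E * (\1_(`[0, 2^-1]%classic) x)%:E))%E).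
    rewrite integralZl//; last first.
      apply/integrableP; split; first exact/measurable_EFinP.
      under eq_integral do rewrite gee0_abs ?lee_fin//.
      rewrite integral_indic//= setIT lebesgue_measure_itv /=.
      by case: ifP => _; rewrite ?ltry// -EFinB ltry.
    rewrite integral_indic//= setIT lebesgue_measure_itv /= lte_fin invr_gt0 ltr0n.
    by rewrite sube0 -EFinM lte_fin mulr_gt0.
  apply: ge0_le_integral => //.
  - by move=> x _; rewrite mule_ge0// lee_fin ltW.
  - by apply/measurable_EFinP; exact: measurable_funM.
  - move=> x _; rewrite -EFinM lee_fin indicE.
    have [h|h] := boolP (x \in `[0, 2^-1]%classic); last by rewrite mulr0 bump0_ge0.
    move: h; rewrite mem_setE in_itv /= => /andP[x0 x1].
    rewrite mulr1 /bump0 /flats big_seq1 /= /d /flat !ifT; try lra.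
    rewrite !hornerC !mul1r ler_pM ?expR_ge0// ler_expR lerN2.
      by rewrite -[leRHS]invrK lef_pV2 ?posrE ?invr_gt0//; lra.
    by rewrite -[leRHS]invrK lef_pV2 ?posrE ?invr_gt0//; lra.
move: fin pos; case: (integral _ _ _) => [c| |] //; rewrite lte_fin => _ c0.
by exists c.
Qed.

Lemma dseqZ b c : dseq b -> dseq (fun n x => c * b n x).
Proof.
move=> db n x; have := db n x => d.
exact: (is_deriveZ c d).
Qed.

Lemma exists_bump : exists b : nat -> R -> R, [/\ dseq b,
  forall n x, 1 <= `|x| -> b n x = 0, forall n, exists C, forall x, `|b n x| <= C,
  forall x, 0 <= b 0%N x & (\int[leb]_x (b 0%N x)%:E = 1)%E].
Proof.
have [c c0 ic] := bump0_int.
exists (fun n x => c^-1 * bump0 n x); split.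
- exact: dseqZ dseq_bump0.
- by move=> n x hx; rewrite /bump0 flats_out// mulr0.
- move=> n; have [C HC] := flats_bounded (iter n dflats [:: (1, 1)]).
  exists (c^-1 * C) => x; rewrite normrM (gtr0_norm (_ : 0 < c^-1)) ?invr_gt0//.
  by rewrite ler_pM2l ?invr_gt0//; exact: HC.
- by move=> x; rewrite mulr_ge0 ?bump0_ge0// invr_ge0 ltW.
- under eq_integral do rewrite EFinM.
  rewrite ge0_integralZl//.
  + by rewrite ic -EFinM mulVf// gt_eqF.
  + by apply/measurable_EFinP; apply: measurable_dseq dseq_bump0.
  + by move=> x _; rewrite lee_fin bump0_ge0.
  + by rewrite lee_fin invr_ge0 ltW.
Qed.

End Bump.

(** * Smoothness of tensor products *)

Section SmoothProduct.
Context {R : realType}.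

Lemma is_derive_co i (f : R * R -> R) x D : 
  is_derive (co i x) 1 (fun t => f (pt i (cr i x) t)) D -> is_derive x (evec i) f D.
Proof.
move=> [d1 d2].
have e : (fun h : R => h^-1 *: (((fun t => f (pt i (cr i x) t)) \o shift (co i x)) (h *: 1) - f (pt i (cr i x) (co i x)))) =
  (fun h : R => h^-1 *: ((f \o shift x) (h *: evec i) - f x)).
  apply/funext => h /=.
  by rewrite (_ : h%:A = h) ?pt_shift ?pt_co// /GRing.scale /= mulr1.
apply: DeriveDef; first by move: d1; rewrite /derivable e.
by rewrite -d2 /derive e.
Qed.

Lemma is_derive_prod (b1 b2 : nat -> R -> R) n1 n2 i (x : R * R) : dseq b1 -> dseq b2 ->
  is_derive x (evec i) (fun x => b1 n1 x.1 * b2 n2 x.2)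
    (if i == 0 then b1 n1.+1 x.1 * b2 n2 x.2 else b1 n1 x.1 * b2 n2.+1 x.2).
Proof.
move=> d1 d2; apply: is_derive_co; rewrite /co /cr /pt; case: (i == 0) => /=.
  have h1 := d1 n1 x.1; have h2 := @is_derive_cst R R R (b2 n2 x.2) x.1 1.
  by apply: (@is_derive_eq _ _ _ _ _ _ _ _ (is_derive_mul h1 h2)); rewrite mulr0 addr0.
have h1 := d2 n2 x.2; have h2 := @is_derive_cst R R R (b1 n1 x.1) x.2 1.
by apply: (@is_derive_eq _ _ _ _ _ _ _ _ (is_derive_mul h2 h1)); rewrite mul0r add0r.
Qed.

Lemma partial_prod (b1 b2 : nat -> R -> R) n1 n2 i : dseq b1 -> dseq b2 ->
  partial i (fun x => b1 n1 x.1 * b2 n2 x.2) =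
  fun x => if i == 0 then b1 n1.+1 x.1 * b2 n2 x.2 else b1 n1 x.1 * b2 n2.+1 x.2.
Proof.
move=> d1 d2; apply/funext => x.
exact: (@derive_val _ _ _ _ _ _ _ (is_derive_prod n1 n2 i x d1 d2)).
Qed.

Lemma continuous_prod (b1 b2 : R -> R) : continuous b1 -> continuous b2 ->
  continuous (fun x : R * R => b1 x.1 * b2 x.2).
Proof.
move=> c1 c2 x; apply: continuousM.
  by apply: (@continuous_comp _ _ _ fst b1); [exact: cvg_fst|exact: c1].
by apply: (@continuous_comp _ _ _ snd b2); [exact: cvg_snd|exact: c2].
Qed.

Lemma smooth_prod (b1 b2 : nat -> R -> R) : dseq b1 -> dseq b2 ->
  smooth (fun x => b1 0%N x.1 * b2 0%N x.2).
Proof.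
move=> d1 d2 l.
have [n1 [n2 ->]] : exists n1 n2, foldr partial (fun x => b1 0%N x.1 * b2 0%N x.2) l = fun x => b1 n1 x.1 * b2 n2 x.2.
  elim: l => [|i l [n1 [n2 /= ->]]]; first by exists 0%N, 0%N.
  rewrite (partial_prod _ _ _ d1 d2); case: (i == 0); first by exists n1.+1, n2.
  by exists n1, n2.+1.
split; first by apply: continuous_prod; exact: continuous_dseq.
by move=> i x; exact: (@ex_derive _ _ _ _ _ _ _ (is_derive_prod n1 n2 i x d1 d2)).
Qed.

Lemma dseq_affine (b : nat -> R -> R) (a c : R) : dseq b -> dseq (fun n x => a ^+ n * b n (a * x + c)).
Proof.
move=> db n x.
have d : is_derive x 1 (fun x : R => a * x + c) a.
  apply: (@is_derive_eq _ _ _ _ _ _ _ _ (is_deriveD (is_deriveZ a (is_derive_id x 1)) (is_derive_cst c x 1))).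
  by rewrite addr0 /GRing.scale /= mulr1.
have d2 : is_derive x 1 (fun x => b n (a * x + c)) (b n.+1 (a * x + c) * a).
  exact: (@is_derive1_comp _ (b n) (fun x => a * x + c)).
apply: (@is_derive_eq _ _ _ _ _ _ _ _ (is_deriveZ (a ^+ n) d2)).
by rewrite /GRing.scale /= exprSr; ring.
Qed.

End SmoothProduct.

(** * The mollification kernel *)

Section Kernel.
Context {R : realType}.
Notation mT := (measurableTypeR R * measurableTypeR R)%type.
Notation leb := (@lebesgue_measure R).
Variables (b : nat -> R -> R).
Hypothesis db : dseq b.
Hypothesis b_out : forall n x, 1 <= `|x| -> b n x = 0.
Hypothesis b_bd : forall n, exists C, forall x, `|b n x| <= C.
Hypothesis b0 : forall x, 0 <= b 0%N x.
Hypothesis b_int : (\int[leb]_x (b 0%N x)%:E = 1)%E.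
Variables (c : R * R) (la ep : R).
Hypothesis la0 : 0 < la.
Hypothesis ep0 : 0 < ep.

(* With [ep] small with respect to [1 - la], the support of [kap _ y] is near the point
   [(1 - la) c + la y], inside [K] for every [y] in [K] even near the boundary, by
   star-shapedness: no restriction to a smaller domain is needed. *)
Definition k1 (d : R) n u v : R := ep^-1 * b n ((u - (1 - la) * d - la * v) / ep).
Definition kap (x y : R * R) : R := k1 c.1 0 x.1 y.1 * k1 c.2 0 x.2 y.2.
Definition dkap (i : 'I_2) (x y : R * R) : R :=
  if i == 0 then ep^-1 * k1 c.1 1 x.1 y.1 * k1 c.2 0 x.2 y.2
  else k1 c.1 0 x.1 y.1 * (ep^-1 * k1 c.2 1 x.2 y.2).

Lemma dseq_k1u d v : dseq (fun n u => ep^-1 ^+ n * k1 d n u v).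
Proof.
have := dseqZ ep^-1 (dseq_affine ep^-1 (- ((1 - la) * d + la * v) / ep) db).
congr dseq; apply/funext => n; apply/funext => u; rewrite /k1 mulrCA; congr (_ * (_ * b n _)).
by field; rewrite gt_eqF.
Qed.

Lemma dseq_k1v d u : dseq (fun n v => (- la / ep) ^+ n * k1 d n u v).
Proof.
have := dseqZ ep^-1 (dseq_affine (- la / ep) ((u - (1 - la) * d) / ep) db).
congr dseq; apply/funext => n; apply/funext => v; rewrite /k1 mulrCA; congr (_ * (_ * b n _)).
by field; rewrite gt_eqF.
Qed.

Lemma kapxE y : (fun x => kap x y) = (fun x => (ep^-1 ^+ 0 * k1 c.1 0 x.1 y.1) * (ep^-1 ^+ 0 * k1 c.2 0 x.2 y.2)).
Proof. by apply/funext => x; rewrite /kap !expr0 !mul1r. Qed.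

Lemma kapyE x : (fun y => kap x y) = (fun y => ((- la / ep) ^+ 0 * k1 c.1 0 x.1 y.1) * ((- la / ep) ^+ 0 * k1 c.2 0 x.2 y.2)).
Proof. by apply/funext => y; rewrite /kap !expr0 !mul1r. Qed.

Lemma smooth_kapx y : smooth (fun x => kap x y).
Proof. rewrite kapxE; apply: (smooth_prod (dseq_k1u c.1 y.1) (dseq_k1u c.2 y.2)). Qed.

Lemma smooth_kapy x : smooth (fun y => kap x y).
Proof. rewrite kapyE; apply: (smooth_prod (dseq_k1v c.1 x.1) (dseq_k1v c.2 x.2)). Qed.

Lemma partial_kapx i y : partial i (fun x => kap x y) = fun x => dkap i x y.
Proof.
rewrite kapxE (partial_prod 0 0 i (dseq_k1u c.1 y.1) (dseq_k1u c.2 y.2)).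
by apply/funext => x; rewrite /dkap !expr0 !expr1 !mul1r.
Qed.

Lemma partial_kapy i x : partial i (fun y => kap x y) = fun y => - la * dkap i x y.
Proof.
rewrite kapyE (partial_prod 0 0 i (dseq_k1v c.1 x.1) (dseq_k1v c.2 x.2)).
by apply/funext => y; rewrite /dkap !expr0 !expr1 !mul1r; case: (i == 0); ring.
Qed.

Lemma k1_ge0 d u v : 0 <= k1 d 0 u v.
Proof. by rewrite mulr_ge0// invr_ge0 ltW. Qed.

Lemma kap_ge0 x y : 0 <= kap x y.
Proof. by rewrite mulr_ge0// k1_ge0. Qed.

Lemma k1_bd d n : exists C, forall u v, `|k1 d n u v| <= C.
Proof.
have [C HC] := b_bd n; exists (`|ep^-1| * C) => u v.
by rewrite normrM ler_wpM2l.
Qed.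

Lemma kap_bd : exists C, forall x y, `|kap x y| <= C.
Proof.
have [A HA] := k1_bd c.1 0; have [B HB] := k1_bd c.2 0.
by exists (A * B) => x y; rewrite normrM ler_pM.
Qed.

Lemma dkap_bd i : exists C, forall x y, `|dkap i x y| <= C.
Proof.
have [A HA] := k1_bd c.1 0; have [B HB] := k1_bd c.2 0.
have [A' HA'] := k1_bd c.1 1; have [B' HB'] := k1_bd c.2 1.
rewrite /dkap; case: (i == 0).
  by exists (`|ep^-1| * A' * B) => x y; rewrite normrM ler_pM// normrM; exact: ler_wpM2l.
by exists (A * (`|ep^-1| * B')) => x y; rewrite normrM ler_pM// normrM; exact: ler_wpM2l.
Qed.

Lemma measurable_k1 d n (f g : mT * mT -> R) : measurable_fun setT f -> measurable_fun setT g ->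
  measurable_fun setT (fun z => k1 d n (f z) (g z)).
Proof.
move=> mf mg; apply: measurable_funM => //.
apply: (@measurableT_comp _ _ _ _ (measurableTypeR R) _ (b n)); first exact: measurable_dseq.
apply: measurable_funM => //; apply: measurable_funB; first exact: measurable_funB.
exact: measurable_funM.
Qed.

Let m11 : measurable_fun [set: mT * mT] (fun z => z.1.1 : R).
Proof. exact: (measurableT_comp measurable_fst measurable_fst). Qed.
Let m12 : measurable_fun [set: mT * mT] (fun z => z.1.2 : R).
Proof. exact: (measurableT_comp measurable_snd measurable_fst). Qed.
Let m21 : measurable_fun [set: mT * mT] (fun z => z.2.1 : R).
Proof. exact: (measurableT_comp measurable_fst measurable_snd). Qed.
Let m22 : measurable_fun [set: mT * mT] (fun z => z.2.2 : R).
Proof. exact: (measurableT_comp measurable_snd measurable_snd). Qed.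

Lemma measurable_kap : measurable_fun [set: mT * mT] (fun z => kap z.1 z.2 : R).
Proof. by apply: measurable_funM; exact: measurable_k1. Qed.

Lemma measurable_dkap i : measurable_fun [set: mT * mT] (fun z => dkap i z.1 z.2 : R).
Proof.
rewrite /dkap; case: (i == 0); apply: measurable_funM; try exact: measurable_k1;
  by apply: measurable_funM => //; exact: measurable_k1.
Qed.

Lemma integral_k1 (al be : R) (h : R -> R) : al != 0 -> (forall t, h t = ep^-1 * b 0%N (al * t + be)) ->
  (\int[leb]_t (h t)%:E = (ep^-1 * `|al|^-1)%:E)%E.
Proof.
move=> al0 hE; under eq_integral do rewrite hE EFinM.
have mb : measurable_fun [set: measurableTypeR R] (fun t => (b 0%N t)%:E : \bar R).
  by apply/measurable_EFinP; exact: measurable_dseq.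
rewrite ge0_integralZl//; last 3 first.
- apply/measurable_EFinP; apply: (@measurableT_comp _ _ _ (measurableTypeR R) _ _ (b 0%N)).
    exact: measurable_dseq.
  by apply: measurable_funD => //; exact: measurable_funM.
- by move=> t _; rewrite lee_fin.
- by rewrite lee_fin invr_ge0 ltW.
rewrite (@integral_affine _ al be (fun t => (b 0%N t)%:E))// ?b_int.
by rewrite mule1 -EFinM.
Qed.

Lemma integral_k1u d v : (\int[leb]_u (k1 d 0 u v)%:E = 1)%E.
Proof.
rewrite (@integral_k1 ep^-1 (- ((1 - la) * d + la * v) / ep)).
- by rewrite gtr0_norm ?invr_gt0// invrK mulVf// gt_eqF.
- by rewrite invr_eq0 gt_eqF.
- by move=> u; rewrite /k1; congr (_ * b 0 _); field; rewrite gt_eqF.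
Qed.

Lemma integral_k1v d u : (\int[leb]_v (k1 d 0 u v)%:E = (la^-1)%:E)%E.
Proof.
rewrite (@integral_k1 (- la / ep) ((u - (1 - la) * d) / ep)).
- rewrite mulNr normrN gtr0_norm ?divr_gt0//; congr EFin; field.
  by rewrite !gt_eqF.
- by rewrite mulf_neq0 ?oppr_eq0 ?invr_eq0 ?gt_eqF.
- by move=> v; rewrite /k1; congr (_ * b 0 _); field; rewrite gt_eqF.
Qed.

Lemma continuous_k1u d v : continuous (fun u => k1 d 0 u v).
Proof.
have := @continuous_dseq R _ 0%N (dseq_k1u d v); rewrite (_ : (fun u => _) = (fun u => k1 d 0 u v)) //.
by apply/funext => u; rewrite expr0 mul1r.
Qed.
Lemma continuous_k1v d u : continuous (fun v => k1 d 0 u v).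
Proof.
have := @continuous_dseq R _ 0%N (dseq_k1v d u); rewrite (_ : (fun v => _) = (fun v => k1 d 0 u v)) //.
by apply/funext => v; rewrite expr0 mul1r.
Qed.

Lemma integral_prod (f g : R -> R) (A B : R) : continuous f -> continuous g ->
  (forall t, 0 <= f t) -> (forall t, 0 <= g t) ->
  (\int[leb]_t (f t)%:E = A%:E)%E -> (\int[leb]_t (g t)%:E = B%:E)%E ->
  (\int[leb2]_x (f x.1 * g x.2)%:E = (A * B)%:E)%E.
Proof.
move=> cf cg f0 g0 fA gB.
have mf := continuous_measurable_fun cf; have mg := continuous_measurable_fun cg.
have A0 : 0 <= A by rewrite -lee_fin -fA; apply: integral_ge0 => t _; rewrite lee_fin.
rewrite (fubini_pt 0); last 2 first.
- by apply/measurable_EFinP; apply: continuous_measurable2 => //; exact: continuous_prod.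
- by move=> x; rewrite lee_fin mulr_ge0.
rewrite (@eq_integral _ (measurableTypeR R) _ _ _ (fun a => A%:E * (g a)%:E)%E); last first.
  move=> a _; rewrite /pt eqxx /=; under eq_integral do rewrite mulrC EFinM.
  rewrite ge0_integralZl// ?fA 1?muleC//.
  - exact/measurable_EFinP.
  - by move=> t _; rewrite lee_fin.
  - by rewrite lee_fin.
rewrite ge0_integralZl// ?gB//.
- exact/measurable_EFinP.
- by move=> t _; rewrite lee_fin.
Qed.

Lemma integral_kapx y : (\int[leb2]_x (kap x y)%:E = 1)%E.
Proof.
rewrite (@integral_prod (fun u => k1 c.1 0 u y.1) (fun u => k1 c.2 0 u y.2) 1 1) ?mul1r//;
  by [exact: continuous_k1u|move=> t; exact: k1_ge0|exact: integral_k1u].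
Qed.

(** The kernel is normalized in [x]; in [y] the dilation by [la] leaves a factor 1 / [la] per
    coordinate, which tends to 1. *)
Lemma integral_kapy x : (\int[leb2]_y (kap x y)%:E = (la^-1 * la^-1)%:E)%E.
Proof.
rewrite (@integral_prod (fun v => k1 c.1 0 x.1 v) (fun v => k1 c.2 0 x.2 v) la^-1 la^-1)//;
  by [exact: continuous_k1v|move=> t; exact: k1_ge0|exact: integral_k1v].
Qed.

Lemma kap_supp x y : kap x y != 0 -> `|x.1 - (1 - la) * c.1 - la * y.1| < ep /\
   `|x.2 - (1 - la) * c.2 - la * y.2| < ep.
Proof.
have S z : 1 <= `|z / ep| -> b 0%N (z / ep) = 0 by exact: b_out.
have S2 z : ep <= `|z| -> b 0%N (z / ep) = 0.
  by move=> h; apply: S; rewrite normrM normfV (gtr0_norm ep0) ler_pdivlMr// mul1r.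
move=> h; split; rewrite ltNge; apply: contra h => /S2 h.
  by rewrite /kap /k1 h mulr0 mul0r.
by rewrite /kap /k1 h !mulr0.
Qed.

Lemma test_kap (K : set (R * R)) y :
  (forall x, `|x.1 - (1 - la) * c.1 - la * y.1| <= ep ->
   `|x.2 - (1 - la) * c.2 - la * y.2| <= ep -> K x) ->
  test_function K (fun x => kap x y).
Proof.
move=> HK; split; first exact: smooth_kapx.
pose m1 := (1 - la) * c.1 + la * y.1; pose m2 := (1 - la) * c.2 + la * y.2.
exists (`[m1 - ep, m1 + ep]%classic `*` `[m2 - ep, m2 + ep]%classic); split.
- by apply: compact_setX; exact: segment_compact.
- move=> x [/=]; rewrite !in_itv /= => /andP[h1 h2] /andP[h3 h4]; apply: HK; rewrite ler_norml.
    by move: h1 h2; rewrite /m1 => *; apply/andP; split; lra.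
  by move: h3 h4; rewrite /m2 => *; apply/andP; split; lra.
- move=> x nC; apply/eqP; apply: contrapT => /negP /kap_supp; rewrite !ltr_norml => -[/andP[h1 h2] /andP[h3 h4]].
  apply: nC; split; rewrite /= in_itv /= /m1 /m2; apply/andP; split; lra.
Qed.

End Kernel.

(** * Convergence of the mollified inner products *)

Section Joint.
Context {R : realType}.
Notation mT := (measurableTypeR R * measurableTypeR R)%type.
Variable K : set (R * R).
Hypothesis mK : measurable (K : set mT).
Variables (k : R * R -> R * R -> R).
Hypothesis mk : measurable_fun [set: mT * mT] (fun z => k z.1 z.2 : R).

(** The integrand of the double integral over K x K, extended by 0 to the whole product so that
    Fubini's theorem applies to it. *)
Definition joint (g h : R * R -> R) (z : mT * mT) : R := (g \_ K) z.1 * (h \_ K) z.2 * k z.1 z.2.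

Lemma restrE (f : R * R -> R) x : (f \_ K) x = if x \in K then f x else 0.
Proof. by rewrite patchE. Qed.

Lemma measurable_restr (g : R * R -> R) : measurable_fun (K : set mT) (g : mT -> R) ->
  measurable_fun setT (g \_ K : mT -> R).
Proof. by move=> mg; apply/(measurable_restrictT _ _).1. Qed.

Lemma measurable_joint g h : measurable_fun (K : set mT) (g : mT -> R) ->
  measurable_fun (K : set mT) (h : mT -> R) -> measurable_fun setT (joint g h).
Proof.
move=> mg mh; apply: measurable_funM => //; apply: measurable_funM.
- exact: (measurableT_comp (measurable_restr mg) measurable_fst).
- exact: (measurableT_comp (measurable_restr mh) measurable_snd).
Qed.

Lemma integrable_restr (g : R * R -> R) : leb2.-integrable K (EFin \o g) ->
  leb2.-integrable setT (EFin \o (g \_ K)).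
Proof. by move=> ig; rewrite -restrict_EFin; apply/(integrable_mkcond _ mK). Qed.

Lemma measurable_fun_int g : leb2.-integrable K (EFin \o g) -> measurable_fun (K : set mT) (g : mT -> R).
Proof. by move=> /measurable_int /measurable_EFinP. Qed.

Hypothesis k_bd : exists C, forall x y, `|k x y| <= C.

Lemma integrable_joint g h : leb2.-integrable K (EFin \o g) -> leb2.-integrable K (EFin \o h) ->
  (leb2 \x leb2)%E.-integrable setT (EFin \o joint g h).
Proof.
move=> ig ih; have [C HC] := k_bd.
have C0 : 0 <= C by apply: le_trans (HC 0 0).
have ig1 := integrable_restr ig; have ih1 := integrable_restr ih.
have mj : measurable_fun setT (joint g h).
  by apply: measurable_joint; exact: measurable_fun_int.
have mg1 := measurable_restr (measurable_fun_int ig).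
have mh1 := measurable_restr (measurable_fun_int ih).
apply/integrable12ltyP; first exact/measurable_EFinP.
have /integrableP[_ fg] := ig1; have /integrableP[_ fh] := ih1.
set H := (\int[_]_x _)%E in fh.
have H0 : (0 <= H)%E by apply: integral_ge0.
apply: (@le_lt_trans _ _ (\int[leb2]_x (`|(g \_ K) x|%:E * (C%:E * H)))%E).
  apply: ge0_le_integral => //.
  - by move=> x _; apply: integral_ge0.
  - apply: (@measurable_fun_fubini_tonelli_F _ _ _ _ _ leb2 (abse \o (EFin \o joint g h))) => //.
      by apply: measurableT_comp => //; exact/measurable_EFinP.
    by move=> z; exact: abse_ge0.
  - apply: emeasurable_funM => //; apply/measurable_EFinP; exact: measurableT_comp.
  - move=> x _; apply: (@le_trans _ _ (\int[leb2]_y (`|(g \_ K) x|%:E * C%:E * `|(h \_ K) y|%:E))%E).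
      apply: ge0_le_integral => //.
      + apply: measurableT_comp => //; apply/measurable_EFinP.
        exact: (measurableT_comp mj (measurable_pair1 x)).
      + by apply: emeasurable_funM => //; apply/measurable_EFinP; exact: measurableT_comp.
      + move=> y _; rewrite /= /joint /= -!EFinM lee_fin !normrM mulrAC.
        by rewrite ler_wpM2r// ler_wpM2l.
    rewrite ge0_integralZl//.
    + by rewrite -muleA.
    + by apply/measurable_EFinP; exact: measurableT_comp.
    + by rewrite mule_ge0// lee_fin.
rewrite ge0_integralZr//.
- by apply: lte_mul_pinfty => //; [exact: integral_ge0|rewrite ge0_fin_numE//; exact: integral_ge0|apply: lte_mul_pinfty].
- by apply/measurable_EFinP; exact: measurableT_comp.
- by rewrite mule_ge0// lee_fin.
Qed.

Lemma measurable_kx x : measurable_fun [set: mT] (fun y => k x y : R).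
Proof. exact: (measurableT_comp mk (measurable_pair1 (x : mT))). Qed.

Lemma measurable_ky y : measurable_fun [set: mT] (fun x => k x y : R).
Proof. exact: (measurableT_comp mk (measurable_pair2 (y : mT))). Qed.

Lemma integrableM_bounded (h j : R * R -> R) : leb2.-integrable setT (EFin \o h) ->
  measurable_fun [set: mT] (j : mT -> R) -> (exists C, forall x, `|j x| <= C) ->
  leb2.-integrable setT (EFin \o (h \* j)).
Proof.
move=> ih mj [C HC].
apply: (@le_integrable _ _ _ leb2 _ _ _ (fun x => C%:E * (EFin \o h) x)%E) => //.
- apply/measurable_EFinP; apply: measurable_funM => //.
  by apply/measurable_EFinP; exact: measurable_int ih.
- move=> x _; change ((`|h x * j x|%:E <= `|C * h x|%:E)%E); rewrite lee_fin !normrM mulrC ler_wpM2r//.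
  by rewrite (le_trans (HC x))// ler_norm.
- exact: integrableZl.
Qed.

Lemma joint_iter1 g h : leb2.-integrable K (EFin \o g) -> leb2.-integrable K (EFin \o h) ->
  \int[leb2]_(x in K) (g x * \int[leb2]_(y in K) (h y * k x y)) =
  fine (\int[leb2 \x leb2]_z (joint g h z)%:E)%E.
Proof.
move=> ig ih; have [C HC] := k_bd; have ij := integrable_joint ig ih.
rewrite -(integral12_prod_meas1 ij) Rintegral_mkcond /Rintegral; congr fine.
apply: eq_integral => x _; rewrite /fubini_F /joint /=.
have ihk : leb2.-integrable setT (EFin \o ((h \_ K) \* k x)).
  apply: integrableM_bounded; [exact: integrable_restr|exact: measurable_kx|by exists C => y; exact: HC].
under [RHS]eq_integral do rewrite -mulrA EFinM.
rewrite (integralZl _ ihk)//.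
have -> : (\int[leb2]_y (EFin \o ((h \_ K) \* k x)%R) y = (\int[leb2]_(y in K) (h y * k x y))%:E)%E.
  rewrite Rintegral_mkcond /Rintegral fineK; last first.
    rewrite (_ : (fun y => _) = EFin \o ((h \_ K) \* k x)); first exact: integrable_fin_num.
    by apply/funext => y /=; rewrite !patchE; case: ifP => //; rewrite mul0r.
  apply: eq_integral => y _ /=; rewrite !patchE; case: ifP => //; by rewrite mul0r.
by rewrite -EFinM !patchE; case: ifP => //; rewrite mul0r.
Qed.

Lemma joint_iter2 g h : leb2.-integrable K (EFin \o g) -> leb2.-integrable K (EFin \o h) ->
  \int[leb2]_(y in K) (h y * \int[leb2]_(x in K) (g x * k x y)) =
  fine (\int[leb2 \x leb2]_z (joint g h z)%:E)%E.
Proof.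
move=> ig ih; have [C HC] := k_bd; have ij := integrable_joint ig ih.
rewrite -(integral21_prod_meas1 ij) Rintegral_mkcond /Rintegral; congr fine.
apply: eq_integral => y _; rewrite /fubini_G /joint /=.
have igk : leb2.-integrable setT (EFin \o ((g \_ K) \* (k^~ y))).
  apply: integrableM_bounded; [exact: integrable_restr|exact: measurable_ky|by exists C => x; exact: HC].
under [RHS]eq_integral do rewrite mulrAC mulrC EFinM.
rewrite (integralZl _ igk)//.
have -> : (\int[leb2]_x (EFin \o ((g \_ K) \* (k^~ y))%R) x = (\int[leb2]_(x in K) (g x * k x y))%:E)%E.
  rewrite Rintegral_mkcond /Rintegral fineK; last first.
    rewrite (_ : (fun x => _) = EFin \o ((g \_ K) \* (k^~ y))); first exact: integrable_fin_num.
    by apply/funext => x /=; rewrite !patchE; case: ifP => //; rewrite mul0r.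
  apply: eq_integral => x _ /=; rewrite !patchE; case: ifP => //; by rewrite mul0r.
by rewrite -EFinM !patchE; case: ifP => //; rewrite mul0r.
Qed.

Lemma joint_swap g h : leb2.-integrable K (EFin \o g) -> leb2.-integrable K (EFin \o h) ->
  \int[leb2]_(x in K) (g x * \int[leb2]_(y in K) (h y * k x y)) =
  \int[leb2]_(y in K) (h y * \int[leb2]_(x in K) (g x * k x y)).
Proof. by move=> ig ih; rewrite joint_iter1// joint_iter2. Qed.

Lemma joint_sub g h h' : leb2.-integrable K (EFin \o g) -> leb2.-integrable K (EFin \o h) ->
  leb2.-integrable K (EFin \o h') ->
  \int[leb2]_(x in K) (g x * \int[leb2]_(y in K) ((h \- h') y * k x y)) =
  \int[leb2]_(x in K) (g x * \int[leb2]_(y in K) (h y * k x y)) -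
  \int[leb2]_(x in K) (g x * \int[leb2]_(y in K) (h' y * k x y)).
Proof.
move=> ig ih ih'; have ihh : leb2.-integrable K (EFin \o (h \- h')).
  by have := integrableB mK ih ih'; congr (_.-integrable _ _).
rewrite !joint_iter1//.
have := RintegralB measurableT (integrable_joint ig ih) (integrable_joint ig ih').
rewrite /Rintegral => <-; congr fine; apply: eq_integral => z _; congr EFin.
by rewrite /joint !restrE; case: ifP => _; case: ifP => _ /=; ring.
Qed.

(** On [K] the average is the Fubini marginal of [joint 1 h], whence its measurability in [x]. *)
Lemma measurable_avg h : (leb2 K < +oo)%E -> leb2.-integrable K (EFin \o h) ->
  measurable_fun (K : set mT) ((fun x => \int[leb2]_(y in K) (h y * k x y)) : mT -> R).
Proof.
move=> fK ih; have [C HC] := k_bd.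
have i1 : leb2.-integrable K (EFin \o (cst 1 : R * R -> R)).
  apply: (@bounded_integrable _ K (cst 1) 1) => // x _; by rewrite /= normr1.
have := measurable_fubini_F (integrable_joint i1 ih) => mF.
apply/measurable_EFinP; apply: eq_measurable_fun (measurable_funTS mF) => x xK.
have ihk : leb2.-integrable setT (EFin \o ((h \_ K) \* k x)).
  apply: integrableM_bounded; [exact: integrable_restr|exact: measurable_kx|by exists C => y; exact: HC].
rewrite /fubini_F /= Rintegral_mkcond /Rintegral fineK; last first.
  rewrite (_ : (fun y => _) = EFin \o ((h \_ K) \* k x)); first exact: integrable_fin_num.
  by apply/funext => y /=; rewrite !restrE; case: ifP => //; rewrite mul0r.
apply: eq_integral => y _ /=; rewrite /joint !restrE /= xK mul1r; case: ifP => //; by rewrite mul0r.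
Qed.

Hypothesis k0 : forall x y, 0 <= k x y.
Variables (m : R).
Hypothesis m0 : 0 <= m.
Hypothesis kx1 : forall y, (\int[leb2]_x (k x y)%:E = 1)%E.
Hypothesis kym : forall x, (\int[leb2]_y (k x y)%:E = m%:E)%E.
Hypothesis fK : (leb2 K < +oo)%E.

(** Schur's test: Young's inequality splits the integrand into a square of [g] and a square of [h],
    each times the kernel, which is then integrated in the variable that the square does not
    contain. The bound involves the kernel through its two masses only. *)
Lemma schur g h (t : R) : L2 K g -> L2 K h -> 0 < t ->
  `|\int[leb2]_(x in K) (g x * \int[leb2]_(y in K) (h y * k x y))| <=
  t / 2 * (m * inner K g g) + t^-1 / 2 * inner K h h.
Proof.
move=> Lg Lh t0.
have ig := L2_integrable mK fK Lg; have ih := L2_integrable mK fK Lh.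
have ij := integrable_joint ig ih.
have igg := L2_integrableM mK Lg Lg; have ihh := L2_integrableM mK Lh Lh.
have mg1 := measurable_restr (measurable_fun_int ig).
have mh1 := measurable_restr (measurable_fun_int ih).
rewrite joint_iter1//.
have fj := integrable_fin_num measurableT ij.
rewrite -lee_fin -abse_EFin fineK//.
apply: le_trans (le_abse_integral _ measurableT (measurable_int _ ij)) _.
pose G1 (z : mT * mT) : \bar R := (t / 2 * (g \_ K) z.1 ^+ 2 * k z.1 z.2)%:E.
pose G2 (z : mT * mT) : \bar R := (t^-1 / 2 * (h \_ K) z.2 ^+ 2 * k z.1 z.2)%:E.
have t2 : 0 <= t / 2 by rewrite divr_ge0// ltW.
have t2' : 0 <= t^-1 / 2 by rewrite divr_ge0// invr_ge0 ltW.
have G10 z : (0 <= G1 z)%E by rewrite lee_fin; apply: mulr_ge0 => //; apply: mulr_ge0 => //; exact: sqr_ge0.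
have G20 z : (0 <= G2 z)%E by rewrite lee_fin; apply: mulr_ge0 => //; apply: mulr_ge0 => //; exact: sqr_ge0.
have mG1 : measurable_fun setT G1.
  apply/measurable_EFinP; apply: measurable_funM => //; apply: measurable_funM => //.
  by apply: measurable_funX; exact: (measurableT_comp mg1 measurable_fst).
have mG2 : measurable_fun setT G2.
  apply/measurable_EFinP; apply: measurable_funM => //; apply: measurable_funM => //.
  by apply: measurable_funX; exact: (measurableT_comp mh1 measurable_snd).
apply: (@le_trans _ _ (\int[leb2 \x leb2]_z (G1 z + G2 z))%E).
  apply: ge0_le_integral => //.
  - by apply: measurableT_comp => //; exact: measurable_int ij.
  - exact: emeasurable_funD.
  - move=> z _; rewrite /G1 /G2 /joint /= -EFinD lee_fin normrM (ger0_norm (k0 _ _)) -mulrDl.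
    by rewrite ler_wpM2r//; exact: young.
rewrite ge0_integralD// EFinD; apply: leeD.
  rewrite (@fubini_tonelli1 _ _ _ _ _ leb2 leb2 G1 mG1 G10).
  rewrite (@eq_integral _ mT _ _ _ (fun x => (t / 2 * m)%:E * (((g \* g) \_ K) x)%:E)%E); last first.
    move=> x _; rewrite /fubini_F /G1 /=; under eq_integral do rewrite EFinM.
    rewrite ge0_integralZl//.
    + rewrite kym -!EFinM !restrE; congr EFin; case: ifP => _ /=; ring.
    + by apply/measurable_EFinP; exact: measurable_kx.
    + by move=> y _; rewrite lee_fin.
    + by rewrite lee_fin mulr_ge0// sqr_ge0.
  rewrite integralZl//; last exact: integrable_restr igg.
  rewrite mulrA [leRHS]EFinM; apply: lee_wpmul2l; first by rewrite lee_fin; exact: mulr_ge0.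
  rewrite /inner Rintegral_mkcond /Rintegral fineK//.
  by apply: integrable_fin_num => //; exact: integrable_restr igg.
rewrite (@fubini_tonelli2 _ _ _ _ _ leb2 leb2 G2 mG2 G20).
rewrite (@eq_integral _ mT _ _ _ (fun y => (t^-1 / 2)%:E * (((h \* h) \_ K) y)%:E)%E); last first.
  move=> y _; rewrite /fubini_G /G2 /=; under eq_integral do rewrite EFinM.
  rewrite ge0_integralZl//.
  + rewrite kx1 mule1 -!EFinM !restrE; congr EFin; case: ifP => _ /=; ring.
  + by apply/measurable_EFinP; exact: measurable_ky.
  + by move=> x _; rewrite lee_fin.
  + by rewrite lee_fin mulr_ge0// sqr_ge0.
rewrite integralZl//; last exact: integrable_restr ihh.
rewrite [leRHS]EFinM; apply: lee_wpmul2l; first by rewrite lee_fin.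
rewrite /inner Rintegral_mkcond /Rintegral fineK//.
by apply: integrable_fin_num => //; exact: integrable_restr ihh.
Qed.

Lemma integrable_kx x : leb2.-integrable setT (EFin \o k x).
Proof.
apply/integrableP; split; first by apply/measurable_EFinP; exact: measurable_kx.
under eq_integral do rewrite /= ger0_norm//.
by rewrite kym ltry.
Qed.

(** The kernel is nonnegative with total mass [m], and on its support [h] stays within [e] of
    [h x]. *)
Lemma avg_close (h : R * R -> R) (C : R) x (e : R) : 0 <= e ->
  measurable_fun (K : set mT) (h : mT -> R) -> (forall y, K y -> `|h y| <= C) ->
  (forall y, k x y != 0 -> K y /\ `|h y - h x| <= e) ->
  `|\int[leb2]_(y in K) (h y * k x y) - m * h x| <= m * e.
Proof.
move=> e0 mh hC near_x.
have mh1 := measurable_restr mh.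
have i1 : leb2.-integrable setT (EFin \o (fun y => (h \_ K) y * k x y)).
  rewrite (_ : (fun y => _) = k x \* (h \_ K)); last by apply/funext => y /=; rewrite mulrC.
  apply: integrableM_bounded => //; first exact: integrable_kx.
  exists `|C| => y; rewrite patchE; case: ifPn => [/set_mem Ky|_]; last by rewrite normr0.
  by rewrite (le_trans (hC _ Ky))// ler_norm.
have i2 : leb2.-integrable setT (EFin \o (fun y => h x * k x y)).
  have := integrableZl measurableT (h x) (integrable_kx x); congr (_.-integrable _ _).
have mi : \int[leb2]_y k x y = m by rewrite /Rintegral kym.
have -> : \int[leb2]_(y in K) (h y * k x y) = \int[leb2]_y ((h \_ K) y * k x y).
  rewrite Rintegral_mkcond; apply: eq_Rintegral => y _; rewrite !patchE.
  by case: ifP => // _; rewrite mul0r.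
have -> : m * h x = \int[leb2]_y (h x * k x y).
  by rewrite RintegralZl//; [rewrite mi mulrC|exact: integrable_kx].
rewrite -RintegralB//.
have i3 := integrableB measurableT i1 i2.
apply: le_trans (le_normr_Rintegral measurableT _) _; first exact: i3.
have -> : m * e = \int[leb2]_y (e * k x y).
  by rewrite RintegralZl//; [rewrite mi mulrC|exact: integrable_kx].
apply: le_Rintegral => //.
- exact: (integrable_norm i3).
- have := integrableZl measurableT e (integrable_kx x); congr (_.-integrable _ _).
- move=> y _; rewrite -mulrBl normrM (ger0_norm (k0 _ _)).
  have [->|kn] := eqVneq (k x y) 0; first by rewrite !mulr0.
  have [Ky hy] := near_x y kn.
  by rewrite patchE mem_set// ler_wpM2r.
Qed.

Lemma avg_bound (h : R * R -> R) (C : R) x :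
  measurable_fun (K : set mT) (h : mT -> R) -> (forall y, K y -> `|h y| <= C) -> 0 <= C ->
  `|\int[leb2]_(y in K) (h y * k x y)| <= m * C.
Proof.
move=> mh hC C0; have mh1 := measurable_restr mh.
have hb y : `|(h \_ K) y| <= C.
  by rewrite patchE; case: ifPn => [/set_mem Ky|_]; [exact: hC|rewrite normr0].
have i1 : leb2.-integrable setT (EFin \o (fun y => (h \_ K) y * k x y)).
  rewrite (_ : (fun y => _) = k x \* (h \_ K)); last by apply/funext => y /=; rewrite mulrC.
  apply: integrableM_bounded => //; first exact: integrable_kx.
  by exists C.
have mi : \int[leb2]_y k x y = m by rewrite /Rintegral kym.
have -> : \int[leb2]_(y in K) (h y * k x y) = \int[leb2]_y ((h \_ K) y * k x y).
  rewrite Rintegral_mkcond; apply: eq_Rintegral => y _; rewrite !patchE.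
  by case: ifP => // _; rewrite mul0r.
apply: le_trans (le_normr_Rintegral measurableT i1) _.
have -> : m * C = \int[leb2]_y (C * k x y).
  by rewrite RintegralZl//; [rewrite mi mulrC|exact: integrable_kx].
apply: le_Rintegral => //.
- exact: (integrable_norm i1).
- have := integrableZl measurableT C (integrable_kx x); congr (_.-integrable _ _).
- by move=> y _; rewrite normrM (ger0_norm (k0 _ _)) ler_wpM2r.
Qed.

End Joint.

Lemma close2 (R : realType) (T M h e : R) :
  `|T - M| <= 4 * (e / 16) -> `|h - M| < e / 2 -> `|h - T| < e.
Proof.
rewrite ler_norml !ltr_norml => /andP[? ?] /andP[? ?].
by apply/andP; split; lra.
Qed.

Lemma close3 (R : realType) (A B C D e : R) :
  `|B - A| < e / 3 -> `|C - D| < e / 3 -> `|B - C| < e / 3 -> `|A - D| < e.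
Proof.
rewrite !ltr_norml => /andP[? ?] /andP[? ?] /andP[? ?].
by apply/andP; split; lra.
Qed.

(** * Concentration of the kernels on the diagonal *)

Section Limit.
Context {R : realType}.
Notation mT := (measurableTypeR R * measurableTypeR R)%type.
Notation leb := (@lebesgue_measure R).
Variables (b : nat -> R -> R).
Hypothesis db : dseq b.
Hypothesis b_out : forall n x, 1 <= `|x| -> b n x = 0.
Hypothesis b_bd : forall n, exists C, forall x, `|b n x| <= C.
Hypothesis b0 : forall x, 0 <= b 0%N x.
Hypothesis b_int : (\int[leb]_x (b 0%N x)%:E = 1)%E.
Variables (c : R * R) (r : R).
Hypothesis r0 : 0 < r.

(** Starting at 1/2 keeps [la n] at least 1/2, hence the mass of the kernel in [y] at most 4. *)
Definition dl (n : nat) : R := n.+2%:R^-1.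
Definition la n : R := 1 - dl n.
(** A square of half-side [dl n * r / 2] fits in a disc of radius [dl n * r], the image under
    dilation of the disc for which K is star-shaped. *)
Definition ep n : R := dl n * r / 2.
Definition kn n := kap b c (la n) (ep n).

Lemma dl_gt0 n : 0 < dl n. Proof. by rewrite invr_gt0 ltr0n. Qed.
Lemma dl_le n : dl n <= 2^-1.
Proof. by rewrite lef_pV2 ?posrE ?ltr0n// ler_nat. Qed.
Lemma la_gt0 n : 0 < la n. Proof. rewrite /la; have := dl_le n; lra. Qed.
Lemma la_ge n : 2^-1 <= la n. Proof. rewrite /la; have := dl_le n; lra. Qed.
Lemma ep_gt0 n : 0 < ep n. Proof. by rewrite !mulr_gt0 ?invr_gt0 ?dl_gt0. Qed.

Lemma dl_cvg : dl @ \oo --> (0 : R).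
Proof.
have := @cvg_harmonic R; rewrite -(cvg_shiftn 1) /harmonic /=.
by under eq_fun do rewrite addn1.
Qed.

Lemma mass_cvg : (fun n => (la n)^-1 * (la n)^-1) @ \oo --> (1 : R).
Proof.
have lc : la @ \oo --> (1 : R).
  by rewrite -[X in _ --> X]subr0; apply: cvgB; [exact: cvg_cst|exact: dl_cvg].
have h : (fun n => (la n)^-1) @ \oo --> (1 : R).
  by rewrite -[X in _ --> X]invr1; apply: cvgV => //; rewrite oner_eq0.
by rewrite -[X in _ --> X]mulr1; exact: (cvgM h h).
Qed.

Lemma mass_ge0 n : 0 <= (la n)^-1 * (la n)^-1.
Proof. by rewrite mulr_ge0// invr_ge0 ltW// la_gt0. Qed.

Lemma mass_le4 n : (la n)^-1 * (la n)^-1 <= 4.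
Proof.
have h : (la n)^-1 <= 2.
  by rewrite -[leRHS]invrK lef_pV2 ?posrE ?la_gt0 ?invr_gt0// la_ge.
have h0 : 0 <= (la n)^-1 by rewrite invr_ge0 ltW// la_gt0.
by rewrite (_ : 4 = 2 * 2) ?ler_pM//; ring.
Qed.

Lemma kn_near x (e : R) : 0 < e -> \forall n \near \oo, forall y, kn n x y != 0 ->
  `|y.1 - x.1| < e /\ `|y.2 - x.2| < e.
Proof.
(* On the support, [la n] times a coordinate of [y - x] is below [dl n * D]; with [la n] at least
   1/2 this bounds the coordinate by [2 * D * dl n]. As [D] depends on [x], the convergence is
   pointwise. *)
move=> e0; pose D := `|x.1 - c.1| + `|x.2 - c.2| + r.
have D0 : 0 < D by rewrite ltr_wpDl// addr_ge0.
have [N _ HN] : \forall n \near \oo, dl n < e / (2 * D).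
  have e1 : 0 < e / (2 * D) by rewrite divr_gt0// mulr_gt0.
  move/cvgrPdist_lt : dl_cvg => /(_ _ e1); apply: filterS => n.
  by rewrite sub0r normrN gtr0_norm// dl_gt0.
exists N => // n /HN hd y /(kap_supp b_out (ep_gt0 n)) => -[h1 h2].
have key (u v d : R) : `|u - (1 - la n) * d - la n * v| < ep n -> `|u - d| + r <= D -> `|v - u| < e.
  move=> h hD; have l2 := la_ge n; have d0 := dl_gt0 n.
  have : la n * `|v - u| < dl n * D.
    rewrite -{1}(gtr0_norm (la_gt0 n)) -normrM.
    have -> : la n * (v - u) = dl n * (u - d) - (u - (1 - la n) * d - la n * v).
      by rewrite /la; ring.
    apply: (le_lt_trans (ler_normB _ _)); rewrite normrM (gtr0_norm d0).
    apply: (@lt_le_trans _ _ (dl n * `|u - d| + dl n * r)); last by rewrite -mulrDr ler_pM2l.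
    rewrite ltrD2l; apply: (lt_le_trans h); rewrite /ep ler_pdivrMr// ler_peMr ?ler1n//.
    by rewrite mulr_ge0// ltW.
  move: hd; rewrite ltr_pdivlMr ?mulr_gt0// => hd hl.
  have : 2^-1 * `|v - u| <= la n * `|v - u| by rewrite ler_wpM2r.
  lra.
by split; [apply: (key _ _ c.1 h1)|apply: (key _ _ c.2 h2)]; rewrite /D; have := normr_ge0 (x.1 - c.1); have := normr_ge0 (x.2 - c.2); lra.
Qed.

Variable (K : set (R * R)).
Hypothesis oK : open K.
Let mK : measurable (K : set mT) := open_measurable2 oK.
Hypothesis fK : (leb2 K < +oo)%E.

Let mk n := measurable_kap db c (la n) (ep n).
Let kbd n := kap_bd b_bd c (la n) (ep n).
Let kge0 n := kap_ge0 b0 c (la n) (ep_gt0 n).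

(** The inner product of [g] with the average of [h] by the kernel. *)
Definition It n g h := \int[leb2]_(x in K) (g x * \int[leb2]_(y in K) (h y * kn n x y)).

(** The averages converge at every point of continuity of [h], and are bounded by 4 times the bound
    of [h]: dominated convergence applies. *)
Lemma It_cvg_bounded g h (C : R) (N : set mT) : L2 K g ->
  measurable_fun (K : set mT) (h : mT -> R) -> (forall y, K y -> `|h y| <= C) ->
  measurable N -> leb2 N = 0 -> (forall x, K x -> ~ N x -> {for x, continuous h}) ->
  (fun n => It n g h) @ \oo --> inner K g h.
Proof.
move=> Lg mh hC mN N0 ch.
have [mg _] := Lg; have ig := L2_integrable mK fK Lg.
pose C' := `|C|; have {}hC y : K y -> `|h y| <= C' by move=> /hC /le_trans; apply; exact: ler_norm.
have C0 : 0 <= C' by exact: normr_ge0.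
have ih := bounded_integrable mK fK mh hC.
have [_ _ cv] : [/\ leb2.-integrable K (fun x => (g x * h x)%:E),
  [sequence \int[leb2]_(x in K) `|(g x * \int[leb2]_(y in K) (h y * kn n x y))%:E - (g x * h x)%:E|]_n @ \oo --> 0%E &
  [sequence \int[leb2]_(x in K) (g x * \int[leb2]_(y in K) (h y * kn n x y))%:E]_n @ \oo --> (\int[leb2]_(x in K) (g x * h x)%:E)]%E.
  apply: (@dominated_convergence _ _ _ leb2 K mK
    (fun n x => (g x * \int[leb2]_(y in K) (h y * kn n x y))%:E) _ (fun x => (4 * C')%:E * `|(g x)%:E|)%E).
  - move=> n; apply/measurable_EFinP; apply: measurable_funM => //.
    exact: (measurable_avg mK (mk n) (kbd n) fK ih).
  - by apply/measurable_EFinP; exact: measurable_funM.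
  - exists N; split => // x hx; apply: contrapT => nN; apply: hx => Kx.
    apply: (@cvg_comp _ _ _ (fun n => g x * \int[leb2]_(y in K) (h y * kn n x y)) EFin _ (nbhs (g x * h x))); last by [].
    apply: cvgM; first exact: cvg_cst.
    have c1 : (fun n => (la n)^-1 * (la n)^-1 * h x) @ \oo --> h x.
      by rewrite -[X in _ --> X]mul1r; apply: cvgM; [exact: mass_cvg|exact: cvg_cst].
    apply/cvgrPdist_lt => e e0.
    (* The mass is at most 4, so the error of the average is at most e / 4; the deviation of the
       mass from 1 takes e / 2. *)
    have e8 : 0 < e / 16 by rewrite divr_gt0.
    have e2 : 0 < e / 2 by rewrite divr_gt0.
    have /cvgrPdist_lt/(_ _ e8) hn := ch x Kx nN.
    have nK : nbhs x K by exact: open_nbhs_nbhs.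
    have : nbhs x [set y | K y /\ `|h x - h y| < e / 16] by exact: filterI.
    move=> /nbhs_ballP[d /= d0 hd].
    near=> n.
    have near_x y : kn n x y != 0 -> K y /\ `|h y - h x| <= e / 16.
      move=> kn0; have [y1 y2] : `|y.1 - x.1| < d /\ `|y.2 - x.2| < d.
        by move: y kn0; near: n; exact: kn_near.
      have [Ky hy] : K y /\ `|h x - h y| < e / 16.
        by apply: hd; split; rewrite /ball /= distrC.
      by split => //; rewrite distrC ltW.
    have := avg_close mK (mk n) (kge0 n)
      (integral_kapy db b0 b_int c (la_gt0 n) (ep_gt0 n)) (ltW e8) mh hC near_x.
    rewrite -/(kn n) => hA.
    have hB : `|h x - (la n)^-1 * (la n)^-1 * h x| < e / 2.
      by near: n; move/cvgrPdist_lt : c1 => /(_ _ e2).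
    have h4 := mass_le4 n.
    have hA' := le_trans hA (ler_wpM2r (ltW e8) h4).
    exact: close2 hA' hB.
  - by apply: integrableZl => //; exact: integrable_abse.
  - apply: aeW => x n Kx; rewrite -EFinM lee_fin normrM mulrC ler_wpM2r//.
    apply: le_trans (avg_bound mK (mk n) (kge0 n) (integral_kapy db b0 b_int c (la_gt0 n) (ep_gt0 n)) _ mh hC C0) _.
    by rewrite ler_wpM2r// mass_le4.
have : (fine \o (fun n => (\int[leb2]_(x in K) (g x * \int[leb2]_(y in K) (h y * kn n x y))%:E)%E)) @ \oo --> inner K g h.
  apply: fine_cvg; rewrite /inner /Rintegral fineK; first exact: cv.
  by apply: integrable_fin_num => //; apply: L2_integrableM => //; exact: (bounded_L2 mK fK mh hC).
by [].
Unshelve. all: by end_near. Qed.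

(** Replacing [h] by an approximant costs an error that Schur's test bounds uniformly in [n], so one
    fixed [hm m] suffices for all [n]. *)
Lemma It_cvg g h (hm : nat -> R * R -> R) : L2 K g -> L2 K h ->
  (forall m, L2 K (hm m)) ->
  (fun m => inner K (hm m \- h) (hm m \- h)) @ \oo --> (0 : R) ->
  (forall m, (fun n => It n g (hm m)) @ \oo --> inner K g (hm m)) ->
  (fun n => It n g h) @ \oo --> inner K g h.
Proof.
move=> Lg Lh Lhm c0 cm; apply/cvgrPdist_lt => e e0.
have e3 : 0 < e / 3 by rewrite divr_gt0.
(* The factor 4 serves both estimates: it bounds the mass in Schur's test and exceeds the factor 1
   of the plain inner product. *)
have a0 : 0 <= 4 * inner K g g by rewrite mulr_ge0// inner_ge0.
have [t [d [t0 d0 H]]] := young_small 0 a0 e3.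
have [m Hm] : exists m, inner K (hm m \- h) (hm m \- h) < d.
  move/cvgrPdist_lt : c0 => /(_ _ d0) [m _ Hm]; exists m.
  by have := Hm m (leqnn m); rewrite sub0r normrN; apply: le_lt_trans; exact: ler_norm.
have {}H := H _ Hm.
have Lb := L2B mK (Lhm m) Lh.
have s1 : `|inner K g (hm m) - inner K g h| < e / 3.
  rewrite -innerBr//; apply: le_lt_trans (inner_young mK Lg Lb t0) _.
  apply: le_lt_trans H; apply: lerD => //; apply: ler_wpM2l; first by rewrite divr_ge0// ltW.
  by rewrite ler_peMl ?inner_ge0// ler1n.
have s2 n : `|It n g (hm m) - It n g h| < e / 3.
  rewrite /It -(joint_sub mK (mk n) (kbd n)); try exact: L2_integrable.
  apply: le_lt_trans (schur mK (mk n) (kbd n) (kge0 n) (mass_ge0 n)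
    (integral_kapx db b0 b_int c (la n) (ep_gt0 n)) (integral_kapy db b0 b_int c (la_gt0 n) (ep_gt0 n)) fK Lg Lb t0) _.
  apply: le_lt_trans H; apply: lerD => //; apply: ler_wpM2l; first by rewrite divr_ge0// ltW.
  by rewrite ler_wpM2r ?inner_ge0// mass_le4.
move/cvgrPdist_lt : (cm m) => /(_ _ e3); apply: filterS => n s3.
exact: close3 s1 (s2 n) s3.
Qed.

End Limit.

(** * Geometry of the polygon and its triangulation *)

Section Diam.
Context {R : realType}.

Lemma edist_gt0 (x y : R * R) : x != y -> 0 < Defs.edist x y.
Proof.
move=> xy; rewrite /Defs.edist sqrtr_gt0 lt0r addr_ge0 ?sqr_ge0// andbT.
rewrite paddr_eq0 ?sqr_ge0// !sqrf_eq0 !subr_eq0; apply: contra xy.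
by case: x y => [? ?] [? ?] /= /andP[/eqP -> /eqP ->].
Qed.

(** Boundedness of [S] makes [diam S] a true supremum rather than a default value. *)
Lemma diam_gt0 (S : set (R * R)) (M : R) x y :
  (forall z, S z -> `|z.1| <= M /\ `|z.2| <= M) -> S x -> S y -> x != y -> 0 < diam S.
Proof.
move=> SM Sx Sy xy; apply: lt_le_trans (edist_gt0 xy) _.
apply: ub_le_sup; last by exists (x, y).
exists (Num.sqrt ((M + M) ^+ 2 + (M + M) ^+ 2)) => _ [[z w] [/= /SM[z1 z2] /SM[w1 w2]] <-].
rewrite /Defs.edist ler_sqrt; last by rewrite addr_ge0 ?sqr_ge0.
have key (a b : R) : `|a| <= M -> `|b| <= M -> (a - b) ^+ 2 <= (M + M) ^+ 2.
  move=> h1 h2; rewrite -real_normK ?num_real// lerXn2r ?nnegrE ?addr_ge0//; try exact: le_trans h1.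
  by apply: le_trans (ler_normB _ _) _; exact: lerD.
by apply: lerD; exact: key.
Qed.

Lemma bounded_set_coord (K : set (R * R)) : bounded_set K ->
  exists M : R, forall x, K x -> `|x.1| < M /\ `|x.2| < M.
Proof.
move=> [M [_ HM]]; exists (M + 2) => x Kx.
have : `|x| <= M + 1 by apply: HM => //; rewrite ltrDl.
by rewrite prod_normE ge_max => /andP[h1 h2]; split; lra.
Qed.

(** The point [x] lies on the segment from [y] to [c'], obtained by moving [c] by the offset divided
    by [d]. Both coordinates of that move are at most r / 2, so its length is below [r]. *)
Lemma star_box (K : set (R * R)) (c : R * R) (r d : R) y x : 0 < r -> 0 < d <= 1 ->
  star_shaped K (disc c r) -> K y ->
  `|x.1 - d * c.1 - (1 - d) * y.1| <= d * r / 2 ->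
  `|x.2 - d * c.2 - (1 - d) * y.2| <= d * r / 2 -> K x.
Proof.
move=> r0 /andP[d0 d1] star Ky.
set u := x.1 - _ - _; set v := x.2 - _ - _ => hu hv.
pose c' := (c.1 + u / d, c.2 + v / d).
have hd : disc c r c'.
  rewrite /disc /= /Defs.edist /=.
  have key (w : R) : `|w| <= d * r / 2 -> (w / d) ^+ 2 <= r ^+ 2 / 4.
    move=> hw; have : `|w / d| <= r / 2.
      by rewrite normrM normfV (gtr0_norm d0) ler_pdivrMr//; apply: le_trans hw _; rewrite le_eqVlt; apply/orP; left; apply/eqP; field.
    move=> h; rewrite -real_normK ?num_real//; apply: (@le_trans _ _ ((r / 2) ^+ 2)).
      by rewrite lerXn2r ?nnegrE// divr_ge0// ltW.
    by rewrite le_eqVlt; apply/orP; left; apply/eqP; field.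
  rewrite -[ltRHS](gtr0_norm r0) -sqrtr_sqr ltr_sqrt ?exprn_gt0//.
  have -> : c.1 - (c.1 + u / d) = - (u / d) by ring.
  have -> : c.2 - (c.2 + v / d) = - (v / d) by ring.
  have := key _ hu; have := key _ hv; rewrite !sqrrN.
  have : 0 < r ^+ 2 by rewrite exprn_gt0.
  lra.
apply: (star y c' Ky hd); exists d; first by rewrite /= in_itv /= (ltW d0).
rewrite /param /=; rewrite /u /v; case: (x) => x1 x2 /=.
by congr pair; field; rewrite gt_eqF.
Qed.

End Diam.

(** * Null overlaps and the decomposition of integrals over the triangulation *)

Section NullSets.
Context {R : realType}.
Notation mT := (measurableTypeR R * measurableTypeR R)%type.

Lemma segment_line (e : (R * R) * (R * R)) : exists N : set mT,
  [/\ measurable N, leb2 N = 0 & segment e `<=` N].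
Proof.
have H (a b c : R) : (a != 0) || (b != 0) -> (forall t, a * (param e t).1 + b * (param e t).2 + c = 0) ->
    exists N : set mT, [/\ measurable N, leb2 N = 0 & segment e `<=` N].
  move=> ab h; exists [set x | a * x.1 + b * x.2 + c = 0]; split.
  - apply: closed_measurable2; rewrite (_ : [set _ | _] = (fun x : R * R => a * x.1 + b * x.2 + c) @^-1` [set 0])//.
    apply: preimage_closed; last exact: closed_eq.
    by move=> x; have [+ _] := C1_affine a b c; exact.
  - exact: null_line.
  - by move=> x [t _ <-]; exact: h.
(* A segment reduced to a point is put on the vertical line through it. *)
case: (eqVneq e.1 e.2) => [ee|ne].
  apply: (H 1 0 (- e.1.1)); first by rewrite oner_eq0.
  by move=> t; rewrite /param -ee /=; ring.
apply: (H (e.2.2 - e.1.2) (e.1.1 - e.2.1) (- ((e.2.2 - e.1.2) * e.1.1 + (e.1.1 - e.2.1) * e.1.2))).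
  apply: contraNT ne; rewrite negb_or !negbK !subr_eq0 => /andP[/eqP h1 /eqP h2].
  by case: (e) h1 h2 => [[? ?] [? ?]] /= -> ->.
by move=> t; rewrite /param /=; ring.
Qed.

Lemma sub_null (A N : set mT) : measurable A -> measurable N -> leb2 N = 0 -> A `<=` N -> leb2 A = 0.
Proof.
move=> mA mN N0 AN; apply/eqP; rewrite eq_le measure_ge0 andbT -N0.
by apply: le_measure; rewrite ?inE.
Qed.

Lemma null_curve (s : seq (R * R)) : exists N : set mT,
  [/\ measurable N, leb2 N = 0 & closed_curve s `<=` N].
Proof.
rewrite /closed_curve; elim: (edges s) => [|e l [N [mN N0 HN]]].
  by exists set0; split; rewrite ?measure0// => x [].
have [L [mL L0 HL]] := segment_line e.
exists (L `|` N); split; [exact: measurableU|exact: null_set_setU|].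
move=> x [e']; rewrite inE => /orP[/eqP ->|e'l] h; first by left; exact: HL.
by right; apply: HN; exists e'.
Qed.

Lemma null_conforming (T T' : @triangle R) : conforming T T' ->
  leb2 (closed_triangle T `&` closed_triangle T' : set mT) = 0.
Proof.
have mTT : measurable (closed_triangle T `&` closed_triangle T' : set mT).
  by apply: measurableI; apply: closed_measurable2; exact: closed_closed_triangle.
move=> [-> |[a [_ _ e]]|[a [b [_ _ _ e]]]]; first by rewrite measure0.
  have [N [mN N0 HN]] := segment_line (a, a).
  apply: (sub_null mTT mN N0); rewrite e => _ ->; apply: HN; exists 0.
    by rewrite /= in_itv /= lexx ler01.
  by rewrite /param /=; case: (a) => ? ?; congr pair => /=; ring.
have [N [mN N0 HN]] := segment_line (a, b).
by apply: (sub_null mTT mN N0); rewrite e.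
Qed.

Lemma mclosed_triangle (T : @triangle R) : measurable (closed_triangle T : set mT).
Proof. by apply: closed_measurable2; exact: closed_closed_triangle. Qed.

Definition cup (TT : seq (@triangle R)) : set (R * R) := [set x | exists2 T, T \in TT & closed_triangle T x].

Lemma cup_nil : cup [::] = set0.
Proof. by apply/seteqP; split => x // []. Qed.

Lemma cup_cons T TT : cup (T :: TT) = closed_triangle T `|` cup TT.
Proof.
apply/seteqP; split => x.
  by move=> [T']; rewrite inE => /orP[/eqP ->|h]; [left|right; exists T'].
by move=> [h|[T' h h']]; [exists T; rewrite ?mem_head|exists T' => //; rewrite inE h orbT].
Qed.

Lemma measurable_cup TT : measurable (cup TT : set mT).
Proof.
elim: TT => [|T TT IH]; first by rewrite cup_nil.
by rewrite cup_cons; apply: measurableU => //; exact: mclosed_triangle.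
Qed.

Lemma null_inter_cup T TT : (forall T', T' \in TT -> conforming T T') ->
  leb2 (closed_triangle T `&` cup TT : set mT) = 0.
Proof.
elim: TT => [|T' TT IH] conf; first by rewrite cup_nil setI0 measure0.
rewrite cup_cons setIUr; apply: null_set_setU.
- by apply: measurableI; exact: mclosed_triangle.
- by apply: measurableI; [exact: mclosed_triangle|exact: measurable_cup].
- by apply: null_conforming; apply: conf; rewrite mem_head.
- by apply: IH => T2 h; apply: conf; rewrite inE h orbT.
Qed.

Lemma Rintegral_setD_null (A B : set mT) (F : R * R -> R) : measurable A -> measurable B ->
  leb2 (A `&` B) = 0 -> leb2.-integrable A (EFin \o F) ->
  \int[leb2]_(x in A) F x = \int[leb2]_(x in A `\` B) F x.
Proof.
move=> mA mB AB0 iF; have mAB : measurable (A `&` B) by exact: measurableI.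
rewrite /Rintegral (negligible_integral mAB mA iF AB0); congr (fine (integral _ _ _)).
apply/seteqP; split => x [h1 h2]; split => // h3; first exact: h2.
by case: h3.
Qed.

Lemma integral_triangles TT (F : R * R -> R) :
  uniq TT -> (forall T T', T \in TT -> T' \in TT -> T != T' -> conforming T T') ->
  leb2.-integrable (cup TT) (EFin \o F) ->
  (forall T, T \in TT -> \int[leb2]_(x in closed_triangle T) F x = 0) ->
  \int[leb2]_(x in cup TT) F x = 0.
Proof.
elim: TT => [|T TT IH] /=.
  by move=> _ _ _ _; rewrite cup_nil; exact: Rintegral_set0.
rewrite cup_cons => /andP[TnT uTT] conf iF F0.
have mT1 := mclosed_triangle T; have mA := measurable_cup TT.
have mU : measurable (closed_triangle T `|` cup TT : set mT) by exact: measurableU.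
have iA : leb2.-integrable (cup TT) (EFin \o F).
  by apply: (integrableS mU) => //; exact: subsetUr.
have A0 : \int[leb2]_(x in cup TT) F x = 0.
  apply: IH => //.
    by move=> T1 T2 h1 h2; apply: conf; rewrite inE ?h1 ?h2 orbT.
  by move=> T' h; apply: F0; rewrite inE h orbT.
have null : leb2 (cup TT `&` closed_triangle T : set mT) = 0.
  rewrite setIC; apply: null_inter_cup => T' h; apply: conf.
  - by rewrite mem_head.
  - by rewrite inE h orbT.
  - by apply: contraNneq TnT => ->.
have E : closed_triangle T `|` cup TT = closed_triangle T `|` (cup TT `\` closed_triangle T).
  apply/seteqP; split => x [h|h]; [by left| |by left|by right; case: h].
  by have [h'|h'] := pselect (closed_triangle T x); [left|right].
rewrite E in iF *.
rewrite Rintegral_setU//; last 2 first.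
- exact: measurableD.
- by apply/disj_setPS => x [h1 [h2]].
rewrite F0 ?mem_head// add0r -A0; apply/esym; exact: Rintegral_setD_null.
Qed.

Lemma integral_interior (K : set (R * R)) (s : seq (R * R)) (F : R * R -> R) : open K ->
  closure K `\` K = closed_curve s -> leb2.-integrable (closure K) (EFin \o F) ->
  \int[leb2]_(x in K) F x = \int[leb2]_(x in closure K) F x.
Proof.
move=> oK bd iF.
have mcK : measurable (closure K : set mT) by apply: closed_measurable2; exact: closed_closure.
have mK : measurable (K : set mT) by exact: open_measurable2.
have mC : measurable (closed_curve s : set mT) by rewrite -bd; exact: measurableD.
have [N [mN N0 HN]] := null_curve s.
have -> : K = closure K `\` closed_curve s.
  rewrite -bd; apply/seteqP; split => x.
    by move=> Kx; split; [exact: subset_closure|move=> []].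
  by move=> [h1 h2]; apply: contrapT => nK; apply: h2.
apply/esym.
rewrite {1}(_ : closure (closure K `\` closed_curve s) = closure K); last first.
  congr closure; rewrite -bd; apply/seteqP; split => x.
    by move=> [h1 h2]; apply: contrapT => nK; apply: h2.
  by move=> Kx; split; [exact: subset_closure|move=> []].
apply: Rintegral_setD_null => //.
apply: (sub_null _ mN N0); first exact: measurableI.
by move=> x [_ /HN].
Qed.

End NullSets.

(** * Unisolvence on edges and triangles *)

Section Polynomials.
Context {R : realType}.
Notation mT := (measurableTypeR R * measurableTypeR R)%type.
Notation leb := (@lebesgue_measure R).

Lemma Pol_param (k : nat) f (e : (R * R) * (R * R)) : Pol k%:Z f ->
  exists2 P : {poly R}, (size P <= k.+1)%N & forall t, f (param e t) = P.[t].
Proof.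
move=> [c fE].
pose A : {poly R} := e.1.1%:P + (e.2.1 - e.1.1) *: 'X.
pose B : {poly R} := e.1.2%:P + (e.2.2 - e.1.2) *: 'X.
have sz (a b : R) : (size (a%:P + b *: 'X : {poly R})%R <= 2)%N.
  apply: leq_trans (size_polyD _ _) _; rewrite geq_max; apply/andP; split.
    by apply: leq_trans (size_polyC_leq1 _) _.
  by apply: leq_trans (size_scale_leq _ _) _; rewrite size_polyX.
exists (\sum_(i < `|k%:Z|%N.+1) \sum_(j < `|k%:Z|%N.+1 | (i + j)%:Z <= k%:Z) c i j *: (A ^+ i * B ^+ j)).
  apply: leq_trans (size_sum _ _ _) _; apply/bigmax_leqP => i _.
  apply: leq_trans (size_sum _ _ _) _; apply/bigmax_leqP => j hij.
  apply: leq_trans (size_scale_leq _ _) _.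
  have sX (C : {poly R}) n : (size C <= 2)%N -> (size (C ^+ n) <= n.+1)%N.
    move=> sC; apply: leq_trans (size_poly_exp_leq _ _) _; rewrite ltnS.
    by case: (size C) sC => [|[|[|]]]// _; rewrite ?mul0n ?mul1n.
  apply: leq_trans (size_polyMleq _ _) _.
  have h1 := sX A i (sz _ _); have h2 := sX B j (sz _ _).
  rewrite lez_nat in hij; rewrite -subn1 leq_subLR add1n; apply: leq_trans (leq_add h1 h2) _.
  by rewrite addSn addnS !ltnS.
move=> t; rewrite fE horner_sum; apply: eq_bigr => i _; rewrite horner_sum; apply: eq_bigr => j _.
have -> : (param e t).1 = A.[t] by rewrite /A !hornerE /param /=; ring.
have -> : (param e t).2 = B.[t] by rewrite /B !hornerE /param /=; ring.
by rewrite hornerZ hornerM !horner_exp mulrA.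
Qed.

(** On the three edges the barycentric coordinates are (1 - t, t, 0), (0, 1 - t, t) and (t, 0, 1 -
    t). *)
Lemma edge_triangle (T : @triangle R) e t : Defs.nondegenerate T -> e \in edges (vertices T) ->
  t \in `[0, 1] -> closed_triangle T (param e t) /\ bubble T (param e t) = 0.
Proof.
case: T => [[[a1 a2] [b1 b2]] [c1 c2]]; rewrite /Defs.nondegenerate /= => nd.
move=> he; rewrite in_itv /= => /andP[t0 t1]; move: he; rewrite /edges /vertices /= !inE => he.
have t1' : 0 <= 1 - t by rewrite subr_ge0.
pose D := area2 (a1, a2) (b1, b2) (c1, c2).
have D0 : D != 0 by [].
have key (u v w : R) x : area2 x (b1, b2) (c1, c2) = u * D -> area2 (a1, a2) x (c1, c2) = v * D ->
   area2 (a1, a2) (b1, b2) x = w * D -> 0 <= u -> 0 <= v -> 0 <= w -> u * v * w = 0 ->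
   closed_triangle (a1, a2, (b1, b2), (c1, c2)) x /\ bubble (a1, a2, (b1, b2), (c1, c2)) x = 0.
  move=> hu hv hw u0 v0 w0 uvw; rewrite /closed_triangle /bubble /bary1 /bary2 /bary3 /= hu hv hw -/D.
  by rewrite !mulfK.
case/or3P: he => /eqP ->.
- by apply: (key (1 - t) t 0); rewrite ?mulr0// /D /area2 /param /=; ring.
- by apply: (key 0 (1 - t) t); rewrite ?mul0r// /D /area2 /param /=; ring.
- by apply: (key t 0 (1 - t)); rewrite ?mulr0 ?mul0r// /D /area2 /param /=; ring.
Qed.

Lemma param_reversed e (t : R) : param (reversed e) t = param e (1 - t).
Proof. by rewrite /param /reversed /=; congr pair; ring. Qed.

(** The bubble terms vanish on the edges, so there [f] reduces to its part of degree [k], although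
    its degree inside the triangles is higher. *)
Lemma edge_poly (k : nat) (TT : seq (@triangle R)) (f : R * R -> R) e :
  (forall T, T \in TT -> Defs.nondegenerate T) ->
  (forall T, T \in TT -> Vt_local k T f) -> is_edge TT e \/ is_edge TT (reversed e) ->
  exists2 P : {poly R}, (size P <= k.+1)%N & forall t, t \in `[0, 1] -> f (param e t) = P.[t].
Proof.
move=> nd fV.
have H e' : is_edge TT e' -> exists2 p, Pol k%:Z p & forall t, t \in `[0, 1] -> f (param e' t) = p (param e' t).
  move=> [T TTT eT]; have [p [q2 [q1 [q0 [Pp _ _ _ fE]]]]] := fV T TTT.
  exists p => // t ht; have [hT hb] := edge_triangle (nd T TTT) eT ht.
  by rewrite fE// hb !mul0r !addr0.
move=> [/H[p Pp fp]|/H[p Pp fp]]; have [P sP PE] := Pol_param e Pp; exists P => // t ht; rewrite -PE.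
  exact: fp.
have ht' : 1 - t \in `[0, 1] by move: ht; rewrite !in_itv /= => /andP[? ?]; apply/andP; split; lra.
by have := fp _ ht'; rewrite param_reversed subKr.
Qed.

Lemma bmeas_horner (P : {poly R}) : bmeas (fun t => P.[t]).
Proof.
split.
  by apply: measurable_funTS; apply: continuous_measurable_fun; exact: continuous_horner.
have cp : compact (horner P @` `[0, 1]%classic).
  by apply: continuous_compact; [apply: continuous_subspaceT; exact: continuous_horner|exact: segment_compact].
have [C [_ HC]] := compact_bounded cp; exists (C + 1) => t ht.
by apply: HC; [rewrite ltrDl|exists t].
Qed.

(** The integrand would vanish almost everywhere on [0, 1], whereas a nonzero polynomial has
    finitely many roots. *)
Lemma poly_sq_int0 (P : {poly R}) : (forall t, t \in `[0, 1] -> 0 <= P.[t]) ->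
  \int[leb]_(t in `[0, 1]) P.[t] = 0 -> P = 0.
Proof.
move=> P0 iP; apply/eqP; apply: contraT => Pn0.
have bP := bmeas_horner P; have i1 := bmeas_integrable bP.
have i0 : (\int[leb]_(t in `[0%R, 1%R]) `|(P.[t])%:E| = 0)%E.
  under eq_integral => t ht.
    rewrite gee0_abs; last by rewrite lee_fin P0//; move: ht; rewrite inE.
    over.
  rewrite -[LHS]fineK; first by rewrite -/(Rintegral _ _ _) iP.
  exact: integrable_fin_num.
have mP : measurable_fun (`[0, 1]%classic : set (measurableTypeR R)) (fun t => (P.[t])%:E : \bar R).
  by apply/measurable_EFinP; case: bP.
have [N [mN N0 HN]] := (ae_eq_integral_abs leb (measurable_itv _) mP).1 i0.
have [rs Hrs] : exists rs : seq R, forall t, P.[t] = 0 -> t \in rs.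
  elim: {P0 iP bP i1 i0 HN}(size P) {-2}P (leqnn (size P)) Pn0 => [|n IH] Q sQ Qn0.
    by rewrite leqn0 size_poly_eq0 (negbTE Qn0) in sQ.
  have [[a Ra]|nR] := pselect (exists a, root Q a); last first.
    by exists [::] => t /eqP Qt; exfalso; apply: nR; exists t.
  have /factor_theorem[Q' QE] := Ra.
  have Q'n0 : Q' != 0 by apply: contraNneq Qn0 => Q'0; rewrite QE Q'0 mul0r.
  have [|rs Hrs] := IH Q' _ Q'n0.
    by move: sQ; rewrite QE size_Mmonic ?monicXsubC// size_XsubC addn2 /= ltnS.
  exists (a :: rs) => t; rewrite QE hornerM hornerXsubC => /eqP.
  by rewrite mulf_eq0 inE subr_eq0 => /orP[/eqP/Hrs ->|/eqP ->]; rewrite ?eqxx ?orbT.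
have mrs : measurable ([set` rs] : set (measurableTypeR R)).
  by apply: countable_measurable => //; apply: finite_set_countable; exact: finite_seq.
have rs0 : leb [set` rs] = 0.
  by apply: countable_lebesgue_measure0; apply: finite_set_countable; exact: finite_seq.
have : (leb `[0%R, 1%R]%classic <= leb (N `|` [set` rs]))%E.
  apply: le_measure; rewrite ?inE//; first exact: measurableU.
  move=> t ht; have [Pt|Pt] := eqVneq P.[t] 0; first by right; exact: Hrs.
  by left; apply: HN => /= /(_ ht) [] /eqP; rewrite (negbTE Pt).
rewrite (_ : leb (N `|` [set` rs]) = 0); last exact: (null_set_setU mN mrs N0 rs0).
rewrite lebesgue_measure_itv /= lte_fin ltr01 -EFinB lee_fin.
by rewrite subr0 ler10.
Qed.

Lemma bmeas_sum0 n (F : nat -> R -> R) (c : nat -> R) : (forall j, bmeas (F j)) ->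
  (forall j, (j < n)%N -> \int[leb]_(t in `[0, 1]) F j t = 0) ->
  bmeas (fun t => \sum_(j < n) c j * F j t) /\
  \int[leb]_(t in `[0, 1]) (\sum_(j < n) c j * F j t) = 0.
Proof.
move=> bF; elim: n => [|n IH] HF.
  have -> : (fun t => \sum_(j < 0) c j * F j t) = (fun t => 0 * F 0%N t).
    by apply/funext => t; rewrite big_ord0 mul0r.
  by split; [exact: bmeasZ|rewrite (RintegralZl _ _ (bmeas_integrable (bF 0%N)))// mul0r].
have [b0 i0] := IH (fun j hj => HF j (ltnW hj)).
have -> : (fun t => \sum_(j < n.+1) c j * F j t) = (fun t => \sum_(j < n) c j * F j t - (- c n) * F n t).
  by apply/funext => t; rewrite big_ord_recr /= mulNr opprK.
have bn := bmeasZ (- c n) (bF n).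
split; first exact: (bmeasB b0 bn).
rewrite (RintegralB _ (bmeas_integrable b0) (bmeas_integrable bn))// i0 sub0r.
by rewrite (RintegralZl _ _ (bmeas_integrable (bF n)))// HF// mulr0 oppr0.
Qed.

(** The two roots give D = t (t - 1) S with S of degree at most k - 2. The moments make D orthogonal
    to S, so the integral of t (1 - t) S^2 is 0. *)
Lemma edge_unisolvent (k : nat) (D : {poly R}) : (size D <= k.+1)%N -> D.[0] = 0 -> D.[1] = 0 ->
  (forall j : nat, j%:Z <= k%:Z - 2 -> \int[leb]_(t in `[0, 1]) (D.[t] * (t - 2^-1) ^+ j) = 0) -> D = 0.
Proof.
move=> sD D0 D1 HD; apply/eqP; apply: contraT => Dn0.
have /factor_theorem[D' DE] : root D 0 by apply/rootP.
have D'1 : root D' 1.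
  by apply/rootP; move: D1; rewrite DE hornerM hornerXsubC subr0 mulr1.
have /factor_theorem[S SE] := D'1.
rewrite SE in DE.
have Sn0 : S != 0 by apply: contraNneq Dn0 => S0; rewrite DE S0 !mul0r.
have sS : (size S <= k.-1)%N.
  move: sD; rewrite DE !size_Mmonic ?monicXsubC// ?mulf_neq0 ?polyXsubC_eq0//.
  by rewrite !size_XsubC !addn2 /=; case: (k) => [|[|m]].
(* The moments are centred at the midpoint, hence the expansion of [S] in powers of [t - 2^-1]. *)
pose S' := S \Po ('X + (2^-1)%:P).
have sS' : size S' = size S by rewrite size_comp_poly2// size_XaddC.
have SE' t : S.[t] = \sum_(j < size S) S'`_j * (t - 2^-1) ^+ j.
  rewrite -sS' -horner_coef horner_comp !hornerE; congr (_.[_]); ring.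
have iDS : \int[leb]_(t in `[0, 1]) (D * S).[t] = 0.
  have bD j : bmeas (fun t => D.[t] * (t - 2^-1) ^+ j).
    have := bmeas_horner (D * ('X - (2^-1)%:P) ^+ j); apply: eq_bmeas => t _.
    by rewrite hornerM horner_exp hornerXsubC.
  have -> : (fun t => (D * S).[t]) = (fun t => \sum_(j < size S) S'`_j * (D.[t] * (t - 2^-1) ^+ j)).
    apply/funext => t; rewrite hornerM SE' mulr_sumr; apply: eq_bigr => j _; ring.
  have Hj : forall j, (j < size S)%N -> \int[leb]_(t in `[0, 1]) (D.[t] * (t - 2^-1) ^+ j) = 0.
    move=> j hj; apply: HD; have := leq_trans hj sS; case: (k) => [|[|m]] // hm.
    by rewrite lerBrDr -PoszD lez_nat addn2.
  exact: (bmeas_sum0 (F := fun j t => D.[t] * (t - 2^-1) ^+ j) _ (fun j => bD j) Hj).2.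
have : (- (D * S)) = 0.
  apply: poly_sq_int0.
    move=> t; rewrite in_itv /= => /andP[t0 t1].
    rewrite hornerN DE !hornerM !hornerXsubC subr0.
    have -> : - (S.[t] * (t - 1) * t * S.[t]) = (1 - t) * t * S.[t] ^+ 2 by ring.
    by rewrite mulr_ge0 ?sqr_ge0// mulr_ge0// subr_ge0.
  under eq_Rintegral do rewrite hornerN -mulN1r.
  rewrite RintegralZl ?iDS ?mulr0//; exact: (bmeas_integrable (bmeas_horner (D * S))).
by move/eqP; rewrite oppr_eq0 mulf_eq0 (negbTE Dn0) (negbTE Sn0).
Qed.

End Polynomials.

Section Moments.
Context {R : realType}.
Notation mT := (measurableTypeR R * measurableTypeR R)%type.

Lemma binomial_term (A B h1 h2 X Y : R) n m :
  (A * (h1 * X)) *+ n * ((B * (h2 * Y)) *+ m) = (A * h1 *+ n) * (B * h2 *+ m) * (X * Y).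
Proof.
rewrite -(mulr_natr (A * (h1 * X)) n) -(mulr_natr (B * (h2 * Y)) m).
by rewrite -(mulr_natr (A * h1) n) -(mulr_natr (B * h2) m); ring.
Qed.

(** Writing x = a + h ((x - a) / h), possible as the diameter [h] is nonzero, the binomial formula
    expands a monomial in scaled ones of no higher degree. *)
Lemma Pol_moments (S : set (R * R)) (k : nat) (u : R * R -> R) : measurable (S : set mT) ->
  (forall f, continuous f -> L2 S f) -> L2 S u -> diam S != 0 ->
  (forall q, monomials k%:Z S q -> inner S u q = 0) ->
  forall p, Pol k%:Z p -> inner S u p = 0.
Proof.
move=> mS cL Lu d0 H p [c pE].
(* Square integrability is carried along because the inner product is additive only on such
   functions. *)
pose Z (p : R * R -> R) := L2 S p /\ inner S u p = 0.
have Z0 : Z (fun=> 0).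
  split; first by apply: cL; exact: cst_continuous.
  rewrite /inner (@eq_Rintegral _ _ _ _ _ (cst 0)); last by move=> x _; rewrite mulr0.
  by rewrite Rintegral_cst// mul0r.
have ZD f g : Z f -> Z g -> Z (f \+ g).
  by move=> [Lf f0] [Lg g0]; split; [exact: L2D|rewrite innerDr// f0 g0 addr0].
have ZZ a f : Z f -> Z (fun x => a * f x).
  by move=> [Lf f0]; split; [exact: L2Z|rewrite innerZr// f0 mulr0].
have Zsum (I : Type) (r : seq I) (P : pred I) (F : I -> R * R -> R) : (forall i, P i -> Z (F i)) ->
    Z (fun x => \sum_(i <- r | P i) F i x).
  move=> hF; elim: r => [|i r IH].
    by rewrite (_ : (fun x => _) = fun=> 0)//; apply/funext => x; rewrite big_nil.
  have [Pi|nPi] := boolP (P i).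
    rewrite (_ : (fun x => _) = F i \+ (fun x => \sum_(i <- r | P i) F i x)); first exact: ZD (hF i Pi) IH.
    by apply/funext => x; rewrite big_cons Pi.
  rewrite (_ : (fun x => _) = (fun x => \sum_(i <- r | P i) F i x))//.
  by apply/funext => x; rewrite big_cons (negbTE nPi).
set h := diam S in d0; set a := (barycenter S).1; set b := (barycenter S).2.
have Zm i j : (i + j <= k)%N -> Z (fun x => ((x.1 - a) / h) ^+ i * ((x.2 - b) / h) ^+ j).
  move=> hij; split.
    apply: cL; have [+ _] : C1 (fun x : R * R => ((x.1 - a) / h) ^+ i * ((x.2 - b) / h) ^+ j).
      by apply: C1M; apply: C1X; (apply: C1M; last exact: C1_cst); apply: C1B;
        [exact: C1_fst|exact: C1_cst|exact: C1_snd|exact: C1_cst].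
    exact.
  by apply: H; exists i, j; split.
have Zx i j : (i + j <= k)%N -> Z (fun x => x.1 ^+ i * x.2 ^+ j).
  move=> hij.
  have E : (fun x : R * R => x.1 ^+ i * x.2 ^+ j) = (fun x =>
     \sum_(i' < i.+1) \sum_(j' < j.+1) (a ^+ (i - i') * h ^+ i' *+ 'C(i, i')) * (b ^+ (j - j') * h ^+ j' *+ 'C(j, j')) *
        (((x.1 - a) / h) ^+ i' * ((x.2 - b) / h) ^+ j')).
    apply/funext => x.
    have e1 : x.1 = a + h * ((x.1 - a) / h) by field.
    have e2 : x.2 = b + h * ((x.2 - b) / h) by field.
    rewrite {1}e1 {1}e2 !exprDn mulr_suml; apply: eq_bigr => i' _.
    rewrite mulr_sumr; apply: eq_bigr => j' _.
    rewrite [(h * _) ^+ i']exprMn [(h * _) ^+ j']exprMn; exact: binomial_term.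
  rewrite E; apply: (Zsum) => i' _; apply: (Zsum) => j' _; apply: (ZZ); apply: Zm.
  by apply: leq_trans hij; apply: leq_add; rewrite -ltnS.
have [] : Z p; last by [].
have -> : p = (fun x => \sum_(i < `|k%:Z|%N.+1) \sum_(j < `|k%:Z|%N.+1 | (i + j)%:Z <= k%:Z)
             c i j * (x.1 ^+ i * x.2 ^+ j)).
  by apply/funext => x; rewrite pE; apply: eq_bigr => i _; apply: eq_bigr => j _; rewrite mulrA.
apply: (Zsum) => i _; apply: (Zsum) => j hij; apply: (ZZ); apply: Zx.
by rewrite -lez_nat.
Qed.

End Moments.

(** * Positivity of lengths, and boundary values of the interpolant *)

Section Setting.
Context {R : realType}.
Notation mT := (measurableTypeR R * measurableTypeR R)%type.
Notation leb := (@lebesgue_measure R).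
Variables (rho : R) (s : seq (R * R)) (K : set (R * R)) (TT : seq (@triangle R)) (k : nat).
Hypothesis rho_gt0 : 0 < rho.
Hypothesis admK : admissible_polygon rho s K.
Hypothesis triK : triangulation s K TT.
Let polygonK := admissible_polygon_polygon admK.

Lemma coordK : exists M, forall x, K x -> `|x.1| < M /\ `|x.2| < M.
Proof. by apply: bounded_set_coord; exact: polygon_bounded polygonK. Qed.

(** The boundary curve is nonempty and contained in the closure of [K]. *)
Lemma K_nonempty : exists x, K x.
Proof.
have bd := polygon_boundary polygonK; have sz := polygon_size polygonK.
have [e eE] : exists e, e \in edges s.
  rewrite /edges; case: (s) sz => [|a [|b l]] // _; exists (a, b).
  by rewrite rot1_cons /= mem_head.
have : closed_curve s (param e 0).
  by exists e => //; exists 0 => //; rewrite /= in_itv /= lexx ler01.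
rewrite -bd => -[clK _]; have [x [Kx _]] := clK _ filterT.
by exists x.
Qed.

Lemma diamK_gt0 : 0 < diam K.
Proof.
have [x Kx] := K_nonempty; have [M HM] := coordK.
have /nbhs_ballP[e /= e0 he] : nbhs x K by apply: open_nbhs_nbhs; split => //; exact: polygon_open polygonK.
apply: (@diam_gt0 _ K M x (x.1 + e / 2, x.2)) => //.
- by move=> z /HM[? ?]; split; exact: ltW.
- apply: he; split; rewrite /ball /= ?subrr ?normr0//.
  by rewrite opprD addNKr normrN gtr0_norm ?divr_gt0// ltr_pdivrMr// ltr_pMr// ltr1n.
- by apply/eqP => /(congr1 fst) /= h; lra.
Qed.

Lemma length_gt0 e : e \in edges s -> 0 < length e.
Proof.
move=> eE; apply: lt_le_trans (admissible_polygon_edges admK eE).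
by rewrite mulr_gt0// diamK_gt0.
Qed.

Lemma edge_ends e : e \in edges s -> e.1 \in s /\ e.2 \in s.
Proof.
move=> eE; split.
  have : e.1 \in unzip1 (edges s) by exact: map_f.
  by rewrite unzip1_zip// size_rot.
have : e.2 \in unzip2 (edges s) by exact: map_f.
by rewrite unzip2_zip ?size_rot// mem_rot.
Qed.

Lemma interpolant_on_edge (f g : R * R -> R) : (forall T, T \in TT -> Vt_local k T f) ->
  (forall e, e \in edges s -> edge_Pol k%:Z e g) -> (forall d, d \in s -> f d = g d) ->
  (forall e, e \in edges s -> forall r, edge_monomials (k%:Z - 2) e r -> edge_inner e (f \- g) r = 0) ->
  forall e t, e \in edges s -> t \in `[0, 1] -> f (param e t) = g (param e t).
Proof.
move=> fV gP fg_vert fg_mom e t eE ht.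
have nd := triangulation_nondegenerate triK.
have [P sP PE] := edge_poly nd fV (triangulation_not_subdivided triK eE).
have [G [sG GE]] := gP e eE.
have [v1 v2] := edge_ends eE.
have p0 : param e 0 = e.1 by rewrite /param !subr0 !mul1r !mul0r !addr0 -surjective_pairing.
have p1 : param e 1 = e.2 by rewrite /param !subrr !mul1r !mul0r !add0r -surjective_pairing.
have i0 : (0 : R) \in `[0, 1] by rewrite in_itv /= lexx ler01.
have i1 : (1 : R) \in `[0, 1] by rewrite in_itv /= lexx ler01.
have l0 := length_gt0 eE.
suff D0 : P - G = 0.
  by rewrite PE// GE//; apply/eqP; rewrite -subr_eq0 -hornerN -hornerD D0 horner0.
apply: (@edge_unisolvent _ k).
- apply: leq_trans (size_polyD _ _) _; rewrite size_polyN geq_max sP /=.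
  by move: sG; rewrite -PoszD lez_nat addn1.
- by rewrite hornerD hornerN -PE// -GE// p0 fg_vert// subrr.
- by rewrite hornerD hornerN -PE// -GE// p1 fg_vert// subrr.
- move=> j hj.
  have := fg_mom e eE (fun x => let c := param e 2^-1 in
       (((x.1 - c.1) * (e.2.1 - e.1.1) + (x.2 - c.2) * (e.2.2 - e.1.2)) / length e ^+ 2) ^+ j).
  have hr : edge_monomials (k%:Z - 2) e (fun x => let c := param e 2^-1 in
       (((x.1 - c.1) * (e.2.1 - e.1.1) + (x.2 - c.2) * (e.2.2 - e.1.2)) / length e ^+ 2) ^+ j).
    by exists j.
  move=> /(_ hr) /eqP; rewrite /edge_inner /edge_int mulf_eq0 (gt_eqF l0) /= => /eqP h0; apply: etrans h0.
  apply: eq_Rintegral => u; rewrite inE => hu.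
  rewrite /= PE// GE// hornerD hornerN; congr (_ * _ ^+ _).
  (* At the parameter [u] the base of the edge monomial is exactly [u - 2^-1]: the scalar product
     with the edge vector produces the squared length in the denominator. *)
  have l2 : length e ^+ 2 = (e.2.1 - e.1.1) ^+ 2 + (e.2.2 - e.1.2) ^+ 2.
    by rewrite /length /Defs.edist sqr_sqrtr ?addr_ge0 ?sqr_ge0//; ring.
  have l2n : length e ^+ 2 != 0 by rewrite expf_neq0// gt_eqF.
  apply: (mulIf l2n); rewrite divfK// l2 /param /=; field => //.
Qed.

End Setting.

(** * Integration by parts and the interpolant *)

Lemma sum_ord2 (V : nmodType) (F : 'I_2 -> V) : \sum_(i < 2) F i = F ord0 + F (lift ord0 ord0).
Proof. by rewrite !big_ord_recl big_ord0 addr0. Qed.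

Section Average.
Context {R : realType}.
Notation mT := (measurableTypeR R * measurableTypeR R)%type.

Lemma L2_avg (K : set (R * R)) (k : R * R -> R * R -> R) g : measurable (K : set mT) ->
  (leb2 K < +oo)%E -> measurable_fun [set: mT * mT] (fun z => k z.1 z.2 : R) ->
  (exists C, forall x y, `|k x y| <= C) -> L2 K g ->
  L2 K (fun y => \int[leb2]_(x in K) (g x * k x y)).
Proof.
move=> mK fK mk [C HC] Lg; have ig := L2_integrable mK fK Lg.
have mk' : measurable_fun [set: mT * mT] (fun z => k z.2 z.1 : R).
  exact: (measurableT_comp mk (measurable_fun_pair measurable_snd measurable_fst)).
have k'bd : exists C, forall y x, `|k x y| <= C by exists C => y x; exact: HC.
apply: (@bounded_L2 _ _ _ (`|C| * \int[leb2]_(x in K) `|g x|)) => //.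
  exact: (measurable_avg mK mk' k'bd fK ig).
move=> y Ky.
have igk : leb2.-integrable K (EFin \o (fun x => g x * k x y)).
  apply: (L2_integrableM mK Lg); apply: (@bounded_L2 _ _ _ C) => //.
  exact: measurable_funTS (measurable_ky mk y).
have iag : leb2.-integrable K (EFin \o (fun x => `|g x|)).
  by have := integrable_norm ig.
apply: le_trans (le_normr_Rintegral mK igk) _; rewrite -RintegralZl//.
apply: le_Rintegral => //.
- exact: integrable_norm igk.
- by have := integrableZl mK `|C| iag.
- move=> x _; rewrite normrM mulrC ler_wpM2r//.
  by apply: le_trans (HC x y) (ler_norm _).
Qed.

End Average.

Section StarKernel.
Context {R : realType}.
Notation mT := (measurableTypeR R * measurableTypeR R)%type.
Notation leb := (@lebesgue_measure R).
Variables (b : nat -> R -> R).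
Hypothesis db : dseq b.
Hypothesis b_out : forall n x, 1 <= `|x| -> b n x = 0.
Hypothesis b_bd : forall n, exists C, forall x, `|b n x| <= C.
Hypothesis b0 : forall x, 0 <= b 0%N x.
Hypothesis b_int : (\int[leb]_x (b 0%N x)%:E = 1)%E.
Variables (c : R * R) (r : R) (K : set (R * R)) (M : R).
Hypothesis r0 : 0 < r.
Hypothesis oK : open K.
Hypothesis bK : forall x, K x -> `|x.1| < M /\ `|x.2| < M.
Hypothesis starK : star_shaped K (disc c r).
Let mK : measurable (K : set mT) := open_measurable2 oK.
Let fK := finK oK bK.

Local Notation la := (@la R).
Local Notation ep := (ep r).
Local Notation kn := (kn b c r).
Local Notation dkn n := (dkap b c (la n) (ep n)).
Local Notation It := (It b c r K).

Let ep0 n : 0 < ep n := ep_gt0 r0 n.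
Let mkn n := measurable_kap db c (la n) (ep n).
Let knbd n := kap_bd b_bd c (la n) (ep n).
Let mdkn n i := measurable_dkap db c (la n) (ep n) i.
Let dknbd n i := dkap_bd b_bd c (la n) (ep n) i.

Lemma test_kn n y : K y -> test_function K (fun x => kn n x y).
Proof.
move=> Ky; apply: test_kap => // x; rewrite /ep {1 3}/la opprB addrCA subrr addr0.
move=> h1 h2; apply: (star_box r0 _ starK Ky h1 h2).
have hd := @dl_le R n.
by rewrite dl_gt0 /= (le_trans hd)// invf_le1 ?ltr0n// ler1n.
Qed.

(** Piecewise continuous approximants are bounded on [K] and continuous off the lines carrying the
    sides, a null set. *)
Lemma It_cvg_pw (TT : seq (@triangle R)) g h (G : nat -> triangle -> R * R -> R) :
  (forall T, T \in TT -> Defs.nondegenerate T) -> L2 K g -> L2 K h ->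
  (forall m T, continuous (G m T)) ->
  (fun m => inner K (pw TT (G m) \- h) (pw TT (G m) \- h)) @ \oo --> (0 : R) ->
  (fun n => It n g h) @ \oo --> inner K g h.
Proof.
move=> nd Lg Lh cG c0; have [N [mN N0 HN]] := null_on_line nd.
apply: (It_cvg db b_bd b0 b_int r0 oK fK Lg Lh _ c0) => m; first exact: (L2_pw TT oK bK (cG m)).
have [C HC] := bounded_pw TT M (cG m).
apply: (@It_cvg_bounded _ _ db b_out b_bd b0 b_int c r r0 K oK fK g _ C N Lg _ _ mN N0).
- exact: measurable_pw.
- by move=> y /bK[h1 h2]; apply: HC; exact: ltW.
- move=> x _ nN; apply: continuous_pw (cG m) => xl; apply: nN; exact: HN.
Qed.

(** Once the integrals are swapped, [g] is integrated against a test function for each [y]. Combined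
    with the limit in [n], this yields the uniqueness of weak derivatives. *)
Lemma It_test0 n g h : L2 K g -> L2 K h ->
  (forall phi, test_function K phi -> inner K g phi = 0) -> It n g h = 0.
Proof.
move=> Lg Lh g0; rewrite /It (joint_swap mK (mkn n) (knbd n)); try exact: L2_integrable.
rewrite (@eq_Rintegral _ _ _ _ _ (cst 0)) ?Rintegral_cst ?mul0r// => y; rewrite inE => Ky.
by rewrite -[X in _ * X]/(inner K g (fun x => kn n x y)) g0 ?mulr0//; exact: test_kn.
Qed.

(* [kn n] is a function of [x - la n * y], so that a derivative in [x] is
   traded for a derivative in [y]; the first hypothesis then integrates by parts in [y]. *)
Lemma It_parts n (u : R * R -> R) (F w : 'I_2 -> R * R -> R) p :
  L2 K u -> (forall i, L2 K (F i)) -> (forall i, L2 K (w i)) -> L2 K p ->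
  (forall i h, C1 h -> inner K (F i) h + inner K u (partial i h) = 0) ->
  (forall phi, test_function K phi ->
     \sum_(i < 2) inner K (w i) (partial i phi) = - inner K p phi) ->
  \sum_(i < 2) It n (w i) (F i) = - (la n * It n p u).
Proof.
move=> Lu LF Lw Lp parts lap.
have Ldk i x : L2 K (fun y => dkn n i x y).
  have [C HC] := dknbd n i; apply: (@bounded_L2 _ _ _ C) => //.
  exact: measurable_funTS (measurable_kx (mdkn n i) x).
have E1 i : It n (w i) (F i) = la n * inner K u (fun y => \int[leb2]_(x in K) (w i x * dkn n i x y)).
  rewrite /inner -(joint_swap mK (mdkn n i) (dknbd n i)); try exact: L2_integrable.
  rewrite -[RHS](innerZr _ mK (Lw i)); last first.
    apply: (@L2_avg _ K (fun y x => dkn n i x y) u mK fK _ _ Lu).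
      exact: (measurableT_comp (mdkn n i) (measurable_fun_pair measurable_snd measurable_fst)).
    by have [C HC] := dknbd n i; exists C => y x; exact: HC.
  apply: eq_Rintegral => x _; congr (_ * _).
  have := parts i (kn n x) (smooth_C1 (smooth_kapy db c _ (ep0 n) x)).
  rewrite partial_kapy// => /eqP; rewrite innerZr// mulNr subr_eq0 => /eqP; exact.
under eq_bigr do rewrite E1; rewrite -mulr_sumr.
have -> : It n p u = inner K u (fun y => \int[leb2]_(x in K) (p x * kn n x y)).
  by rewrite /It (joint_swap mK (mkn n) (knbd n)) //; exact: L2_integrable.
have Lw' i : L2 K (fun y => \int[leb2]_(x in K) (w i x * dkn n i x y)).
  exact: (L2_avg mK fK (mdkn n i) (dknbd n i) (Lw i)).
rewrite -mulrN; congr (_ * _); rewrite sum_ord2 -innerDr//.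
have Lp' := L2_avg mK fK (mkn n) (knbd n) Lp.
rewrite -mulN1r -(innerZr (-1) mK Lu Lp').
apply: eq_Rintegral => y; rewrite inE => Ky; congr (_ * _).
transitivity (- inner K p (fun x => kn n x y)); last exact: (esym (mulN1r _)).
rewrite -(lap _ (test_kn n Ky)) sum_ord2.
by rewrite !(partial_kapx db c (la n) (ep0 n)).
Qed.

End StarKernel.

Section Pieces.
Context {R : realType}.
Notation mT := (measurableTypeR R * measurableTypeR R)%type.
Implicit Types (f : R * R -> R) (T : @triangle R) (TT : seq (@triangle R)).

(** The formula that gives [f] on a triangle makes sense on the whole plane, and provides a C^1
    extension of each piece. *)
Lemma Vt_local_C1 k TT f : (forall T, T \in TT -> Vt_local k T f) ->
  exists fT : triangle -> R * R -> R, (forall T, C1 (fT T)) /\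
    forall T x, T \in TT -> closed_triangle T x -> f x = fT T x.
Proof.
move=> fV; have /choice[fT HfT] : forall T, exists F : R * R -> R, C1 F /\
    (T \in TT -> forall x, closed_triangle T x -> f x = F x).
  move=> T; have [TT1|nT] := boolP (T \in TT); last by exists (cst 0); split => //; exact: C1_cst.
  have [p [q2 [q1 [q0 [hp h2 h1 h0 fE]]]]] := fV T TT1.
  exists (fun x => p x + bubble T x * q2 x + bubble T x * q1 x + bubble T x * q0 x); split; last by move=> _.
  by apply: C1D; first (apply: C1D; first (apply: C1D; first exact: C1_Pol hp));
    apply: C1M; (exact: C1_bubble || (apply: C1_homPol; eassumption)).
exists fT; split => [T|T x hT hx]; first by have [] := HfT T.
by have [_ ->] := HfT T.
Qed.

Variables (S : set (R * R)) (M : R).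
Hypothesis mS : measurable (S : set mT).
Hypothesis bS : forall x, S x -> `|x.1| <= M /\ `|x.2| <= M.

Lemma leb2_bounded : (leb2 S < +oo)%E.
Proof.
apply: le_lt_trans (leb2_square (- M) M); apply: le_measure; rewrite ?inE//.
  by apply: measurableX; exact: measurable_itv.
by move=> x /bS [h1 h2]; split; rewrite /= in_itv /= -ler_norml.
Qed.

Lemma L2_continuous_bounded f : continuous f -> L2 S f.
Proof.
move=> cf; have [C HC] := continuous_bounded_square M cf.
apply: (@bounded_L2 _ _ _ C mS leb2_bounded); first exact: continuous_measurable2 mS cf.
by move=> x /bS[h1 h2]; apply: HC.
Qed.

Lemma eq_L2 f f' : {in S, f =1 f'} -> L2 S f -> L2 S f'.
Proof.
move=> ff [mf i2]; split; first exact: eq_measurable_fun mf.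
by apply: (eq_integrable mS) i2 => x xA; rewrite ff.
Qed.

End Pieces.

Section Final.
Context {R : realType}.
Notation mT := (measurableTypeR R * measurableTypeR R)%type.
Variables (rho : R) (s : seq (R * R)) (K : set (R * R)) (TT : seq (@triangle R)) (k : nat).
Hypothesis rho_gt0 : 0 < rho.
Hypothesis admK : admissible_polygon rho s K.
Hypothesis triK : triangulation s K TT.
Let polygonK := admissible_polygon_polygon admK.
Let oK := polygon_open polygonK.
Let bdK := polygon_boundary polygonK.
Let cov := triangulation_cover triK.
Let nd := triangulation_nondegenerate triK.
Let mK : measurable (K : set mT) := open_measurable2 oK.

Lemma wpartialP v i : H1 K v -> is_wpartial K i v (wpartial K i v).
Proof. by move=> [_ /(_ i) h]; exact: (xgetPex (cst 0) h). Qed.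

Lemma L2_Pol p : Pol k%:Z p -> L2 K p.
Proof.
move=> hp; have [M bK] := coordK admK.
by apply: (L2_continuous oK bK); have [] := C1_Pol hp.
Qed.

Lemma closed_triangle_diam T : T \in TT -> 0 < diam (closed_triangle T).
Proof.
move=> hT; have [M bK] := coordK admK; have ndT := nd hT.
have TM z : closed_triangle T z -> `|z.1| <= M /\ `|z.2| <= M.
  by move=> h; apply: (bclK bK); rewrite cov; exists T.
have d0 := ndT; rewrite /Defs.nondegenerate in d0.
have n0 (n d : R) : n = 0 -> 0 <= n / d by move=> ->; rewrite mul0r.
apply: (diam_gt0 TM (x := T.1.1) (y := T.1.2)).
- by split; rewrite /bary1 /bary2 /bary3 ?divff ?ler01//; apply: n0; rewrite /area2; ring.
- by split; rewrite /bary1 /bary2 /bary3 ?divff ?ler01//; apply: n0; rewrite /area2; ring.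
- by apply: contra d0 => /eqP ->; rewrite /area2; apply/eqP; ring.
Qed.

Lemma interpolation_error_orthogonal f v q : L2 K v -> (forall T, T \in TT -> Vt_local k T f) ->
  is_Q k K v q ->
  (forall T, T \in TT -> forall r, monomials k%:Z (closed_triangle T) r ->
     inner (closed_triangle T) (f \- q) r = 0) ->
  forall p, Pol k%:Z p -> inner K (f \- v) p = 0.
Proof.
move=> Lv fV [hq Qq] mom p hp; have [M bK] := coordK admK.
have [fT [C1f fE]] := Vt_local_C1 fV.
have Lf := L2_U oK bK cov C1f fE.
have Lp := L2_Pol hp; have Lq := L2_Pol hq.
have [cq _] := C1_Pol hq; have [cp _] := C1_Pol hp.
rewrite innerBl// -Qq// -innerBl//.
have iT T : T \in TT -> inner (closed_triangle T) (f \- q) p = 0.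
  move=> hT; have mS := mclosed_triangle T.
  have TM z : closed_triangle T z -> `|z.1| <= M /\ `|z.2| <= M.
    by move=> h; apply: (bclK bK); rewrite cov; exists T.
  apply: (@Pol_moments _ (closed_triangle T) k) => //.
  - by move=> g cg; exact: (L2_continuous_bounded mS TM cg).
  - apply: (@eq_L2 _ _ mS (fT T \- q)); first by move=> x /set_mem hx /=; rewrite -fE.
    apply: L2B => //; apply: (L2_continuous_bounded mS TM) => //.
    by have [] := C1f T.
  - by rewrite gt_eqF// closed_triangle_diam.
  - exact: mom.
have mcl : measurable (closure K : set mT) by apply: closed_measurable2; exact: closed_closure.
have bcl z : closure K z -> `|z.1| <= M /\ `|z.2| <= M := @bclK _ K M bK z.
have icl : leb2.-integrable (closure K) (EFin \o (fun x => (f \- q) x * p x)).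
  apply: L2_integrableM => //; last exact: (L2_continuous_bounded mcl bcl cp).
  apply: L2B => //; last exact: (L2_continuous_bounded mcl bcl cq).
  apply: (@eq_L2 _ _ mcl (pw TT fT)); first by move=> x /set_mem hx; rewrite -(pw_eq cov fE).
  have cfT T : continuous (fT T) by have [] := C1f T.
  have [C HC] := bounded_pw TT M cfT.
  apply: (@bounded_L2 _ _ _ C mcl (leb2_bounded mcl bcl)); first exact: measurable_pw mcl cfT.
  by move=> x /bcl[h1 h2]; exact: HC.
rewrite /inner (integral_interior oK bdK icl).
have cupE : closure K = cup TT := cov.
rewrite cupE; apply: integral_triangles.
- exact: triangulation_uniq triK.
- exact: triangulation_conforming triK.
- by rewrite -cupE.
- exact: iT.
Qed.

Lemma grad_inner_interpolant f v g w h p q : H1 K v -> is_trace s K v g -> is_Q k K v q ->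
  (forall T, T \in TT -> Vt_local k T f) ->
  (forall e, e \in edges s -> edge_Pol k%:Z e g) ->
  (forall d, d \in s -> f d = g d) ->
  (forall e, e \in edges s -> forall r, edge_monomials (k%:Z - 2) e r ->
     edge_inner e (f \- g) r = 0) ->
  (forall T, T \in TT -> forall r, monomials k%:Z (closed_triangle T) r ->
     inner (closed_triangle T) (f \- q) r = 0) ->
  H1 K w -> is_trace s K w h -> Pol k%:Z p -> is_laplacian K w p ->
  grad_inner K f w = grad_inner K v w.
Proof.
move=> hv [_ [phi [sphi cphi cdphi cedge]]] hq fV gP fg_vert fg_mom momT hw [_ [psi [spsi _ cdpsi _]]] hp lap.
have [M bK] := coordK admK.
have [c [r [rge starK]]] := admissible_polygon_star admK.
have r0 : 0 < r by apply: lt_le_trans rge; rewrite mulr_gt0// (diamK_gt0 admK).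
have [b [db b_out b_bd b0 b_int]] := @exists_bump R.
have [fT [C1f fE]] := Vt_local_C1 fV.
have Lv : L2 K v by have [] := hv.
have LDv i : L2 K (wpartial K i v) by have [] := wpartialP i hv.
have LDw i : L2 K (wpartial K i w) by have [] := wpartialP i hw.
have Lf := L2_U oK bK cov C1f fE.
have LDf i := L2_pdU TT oK bK C1f i.
have Lp := L2_Pol hp.
have C1phi m := smooth_C1 (sphi m).
have C1psi m := smooth_C1 (spsi m).
have LC a : C1 a -> L2 K a by move=> [ca _]; exact: (L2_continuous oK bK ca).
have wf i := wpartial_pw oK bK bdK cov C1f fE i.
have hf : H1 K f by split => // i; exists (pdU TT fT i).
have LDf' i : L2 K (wpartial K i f) by have [] := wpartialP i hf.
(* [wpartial K i f] is picked by choice; it is compared with the piecewise derivative only through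
   its pairing with the derivative of [w], which the smooth functions [psi m] approximate. *)
have uniq_wf i : inner K (wpartial K i f) (wpartial K i w) = inner K (pdU TT fT i) (wpartial K i w).
  apply/eqP; rewrite -subr_eq0 -innerBl//; apply/eqP.
  have LG := L2B mK (LDf' i) (LDf i).
  have G0 a : test_function K a -> inner K (wpartial K i f \- pdU TT fT i) a = 0.
    move=> ta; have La : L2 K a by apply: LC; apply: smooth_C1; have [] := ta.
    rewrite innerBl//; have [_ /(_ _ ta) e1] := wpartialP i hf; have [_ /(_ _ ta) e2] := wf i.
    by apply/eqP; rewrite subr_eq0 -eqr_opp -e1 -e2.
  have := @It_cvg_pw _ _ db b_out b_bd b0 b_int c r K M r0 oK bK TT _ (wpartial K i w) (fun m _ => partial i (psi m)) nd LG (LDw i).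
  move=> /(_ _ (cdpsi i)) cv; apply/esym.
  apply: (@cvg_unique _ (@norm_hausdorff _ R) ((fun=> 0) @ \oo)); first exact: cvg_cst.
  have E : (fun n => It b c r K n (wpartial K i f \- pdU TT fT i) (wpartial K i w)) = fun=> 0.
    by apply/funext => n; exact: (It_test0 db b_out b_bd r0 oK bK starK n LG (LDw i) G0).
  by rewrite -E; apply: cv => m T; have [_ /(_ i)[]] := C1psi m.
have fg e t : e \in edges s -> t \in `[0, 1] -> f (param e t) = g (param e t).
  exact: (interpolant_on_edge rho_gt0 admK triK fV gP fg_vert fg_mom).
have parts i a : C1 a -> inner K (pdU TT fT i \- wpartial K i v) a + inner K (f \- v) (partial i a) = 0.
  exact: (extension oK bK bdK cov C1f fE Lv LDv C1phi cphi cdphi cedge fg).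
pose F i := pdU TT fT i \- wpartial K i v.
have LF i : L2 K (F i) by exact: L2B.
have Lu : L2 K (f \- v) by exact: L2B.
have cvF i : (fun n => It b c r K n (wpartial K i w) (F i)) @ \oo --> inner K (wpartial K i w) (F i).
  (* The piecewise derivative of [f] cancels in the error of these approximants, which is that of
     [partial i (phi m)] as an approximation of the derivative of [v]. *)
  apply: (@It_cvg_pw _ _ db b_out b_bd b0 b_int c r K M r0 oK bK TT _ _ (fun m T => partial i (fT T \- phi m)) nd (LDw i) (LF i)).
    by move=> m T; have [_ /(_ i)[]] := C1B (C1f T) (C1phi m).
  apply: cvg_trans (cdphi i); apply: near_eq_cvg; near=> m; apply: eq_Rintegral => x _ /=.
  by have := pdUB TT C1f i x (C1phi m); rewrite /F /pdU /= => ->; ring.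
have cvu : (fun n => It b c r K n p (f \- v)) @ \oo --> inner K p (f \- v).
  apply: (@It_cvg_pw _ _ db b_out b_bd b0 b_int c r K M r0 oK bK TT _ _ (fun m T => fT T \- phi m) nd Lp Lu).
    by move=> m T; have [] := C1B (C1f T) (C1phi m).
  apply: cvg_trans cphi; apply: near_eq_cvg; near=> m; apply: eq_Rintegral => x; rewrite inE => Kx /=.
  have fx : f x = pw TT fT x by apply: (pw_eq cov fE); exact: subset_closure.
  by rewrite (_ : pw TT _ x = f x - phi m x) ?fx//; ring.
have cl : (@la R) @ \oo --> (1 : R).
  by rewrite -[X in _ --> X]subr0; apply: cvgB; [exact: cvg_cst|exact: dl_cvg].
(* Two limits of one sequence: the pairing of the gradients, and, through the mollified integration
   by parts, minus the pairing of [p] with [f \- v], which vanishes by orthogonality. *)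
have S0 : \sum_(i < 2) inner K (wpartial K i w) (F i) = 0.
  apply: (@cvg_unique _ (@norm_hausdorff _ R) ((fun n => \sum_(i < 2) It b c r K n (wpartial K i w) (F i)) @ \oo)).
    rewrite sum_ord2; apply: cvg_trans (cvgD (cvF _) (cvF _)).
    by apply: near_eq_cvg; near=> n; rewrite sum_ord2.
  have -> : (fun n => \sum_(i < 2) It b c r K n (wpartial K i w) (F i)) =
      (fun n => - (la n * It b c r K n p (f \- v))).
    apply/funext => n.
    exact: (It_parts db b_out b_bd r0 oK bK starK n Lu LF LDw Lp parts lap).
  have <- : - (1 * inner K p (f \- v)) = 0.
    by rewrite innerC (interpolation_error_orthogonal Lv fV hq momT hp) mulr0 oppr0.
  by apply: cvgN; exact: cvgM.
apply/eqP; rewrite -subr_eq0 /grad_inner -sumrB; apply/eqP; rewrite -[RHS]S0; apply: eq_bigr => i _.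
by rewrite uniq_wf -(innerBl mK (LDw i) (LDf i) (LDv i)) innerC.
Unshelve. all: by end_near. Qed.

End Final.

Theorem lemma3p2 (R : realType) (rho sigma : R) (s : seq (R * R))
    (K : set (R * R)) (TT : seq (@triangle R)) (k : nat)
    (rho_gt0 : 0 < rho) (sigma_gt0 : 0 < sigma)
    (polygonK : admissible_polygon rho s K)
    (triangulationK : admissible_triangulation sigma s K TT)
    (k_ge1 : (1 <= k)%N)
    (vh : R * R -> R) (vhV : Vc k s K vh)
    (Ivh : R * R -> R) (Ivh_interp : is_interpolant k s K TT vh Ivh)
    (wh : R * R -> R) (whV : Vc k s K wh) :
  grad_inner K Ivh wh = grad_inner K vh wh.
Proof.
have [v1 _ _ _] := vhV; have [w1 [p hp lap] [h trw _] _] := whV.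
have [[_ fV] [g [pi [q [[trv [_ gP]] _ hq [vert _ edge _ mom]]]]]] := Ivh_interp.
exact: (grad_inner_interpolant rho_gt0 polygonK (admissible_triangulation_triangulation triangulationK)
  v1 trv hq fV gP vert edge mom w1 trw hp lap).
Qed.
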